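(* Let $\mu$ be a probability measure on the unit sphere $S^d$ of dimension $d$ whose Fréchet mean $\bar\mu$ is unique, and suppose that $\mu$ is absolutely continuous and rotationally symmetric about $\bar\mu$, i.e. $d\mu(q)=f(\mathbf{d}(\bar\mu,q))\,dV(q)$. Assume in addition that (i) the density $f$ is bounded on an open neighborhood of the cut locus $\mathcal{C}_{\bar\mu}$ (the antipode of $\bar\mu$); and (ii) $\alpha_d>0$, where $\alpha_d=\frac{V(S^{d-1})}{d}\int_0^\pi f(\varphi)\,d(\varphi\sin^{d-1}\varphi)$. Let $X_1,X_2,\dots$ be i.i.d. with law $\mu$, let $\bar\mu_n$ be any measurable choice of sample Fréchet mean of $X_1,\dots,X_n$, and let $\mathcal{N}$ be the tangent limit distribution of $\mu$. Then $$n^{1/2}\log_{\bar\mu}\bar\mu_n\xrightarrow{\ \mathcal{D}\ }H_\sharp\mathcal{N},$$ where the correction map $H:T_{\bar\mu}S^d\to T_{\bar\mu}S^d$ is defined by $H(Z)=\alpha_d^{-1}Z$.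
   Context: $S^d$ carries its standard round metric; $\mathbf{d}$ is the great-circle distance, $dV$ the volume element, $V(S^k)$ the volume of the $k$-dimensional unit sphere, and $\log_{p}$ the inverse of the Riemannian exponential map at $p$ (defined off the antipode of $p$). The Fréchet function of a probability measure $\nu$ is $x\mapsto\int\frac12\mathbf{d}^2(y,x)\,d\nu(y)$; its Fréchet mean set is the set of its global minimizers. The sample Fréchet mean set is the Fréchet mean set of the empirical measure $\mu_n=\frac1n\sum_{i=1}^n\delta_{X_i}$. The tangent limit distribution $\mathcal{N}$ of $\mu$ is the Gaussian law on $T_{\bar\mu}S^d$ that is the limit in distribution of $n^{1/2}\cdot\frac1n\sum_{i=1}^n\log_{\bar\mu}X_i$ (i.e. $n^{1/2}$ times the Euclidean mean of the pushforward of $\mu_n$ under $\log_{\bar\mu}$). $H_\sharp$ denotes pushforward of measures by $H$, $\xrightarrow{\mathcal{D}}$ convergence in distribution, and $\int_0^\pi f(\varphi)\,d(g(\varphi))$ means $\int_0^\pi f(\varphi)g'(\varphi)\,d\varphi$.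
   Formalization: The dimension is assumed to be d ≥ 2: on the circle (d = 1) the formula gives α_1 = 1 for every density, whereas the true limit for f continuous at π is N scaled by 1/(1 − 2πf(π)), so the claim fails whenever f(π) > 0. *)

(* Defs.v *)
From HB Require Import structures.
From mathcomp Require Import all_boot all_order all_algebra.
From mathcomp Require Import all_classical all_reals all_analysis.

Set Implicit Arguments.
Unset Strict Implicit.
Unset Printing Implicit Defensive.

Import Order.TTheory GRing.Theory Num.Theory.
Import numFieldNormedType.Exports.

Local Open Scope classical_set_scope.
Local Open Scope ring_scope.

Section borel_matrix.
Context (R : realType) (m n : nat).

HB.instance Definition _ :=
  @isMeasurable.Build (sigma_display (@open 'M[R]_(m, n))) 'M[R]_(m, n)
    <<s (@open 'M[R]_(m, n)) >> (@sigma_algebra0 _ setT _)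
    (@sigma_algebraC _ _) (@sigma_algebra_bigcup _ setT _).

End borel_matrix.

Section euclidean.
Context {R : realType} {n : nat}.
Implicit Types u v : 'rV[R]_n.

Definition dotp u v : R := (u *m v^T) ord0 ord0.

(* The library norm `|u| on 'rV[R]_n is the sup norm. *)
Definition enorm u : R := Num.sqrt (dotp u u).

End euclidean.

Definition sphere_set (R : realType) (n : nat) : set 'rV[R]_n.+1 :=
  [set x | dotp x x = 1].
Arguments sphere_set : clear implicits.

Definition sphere (R : realType) (n : nat) : Type := sphere_set R n.

Section sphere_structures.
Context (R : realType) (n : nat).

Definition to_sphere (x : 'rV[R]_n.+1) (x1 : dotp x x = 1) : sphere R n :=
  exist (fun y : 'rV[R]_n.+1 => y \in sphere_set R n) x
    (mem_set (x1 : sphere_set R n x)).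

Definition vec (x : sphere R n) : 'rV[R]_n.+1 := set_val x.

Lemma dotp_vec (x : sphere R n) : dotp (vec x) (vec x) = 1.
Proof. exact: (set_valP x). Qed.

Lemma dotp_north : dotp (delta_mx 0 0 : 'rV[R]_n.+1) (delta_mx 0 0) = 1.
Proof. by rewrite /dotp trmx_delta mul_delta_mx mxE. Qed.

HB.instance Definition _ := Choice.on (sphere R n).

HB.instance Definition _ :=
  isPointed.Build (sphere R n) (to_sphere dotp_north).

HB.instance Definition _ := Topological.copy (sphere R n) (sphere_set R n).

HB.instance Definition _ :=
  @isMeasurable.Build (sigma_display (@open (sphere R n))) (sphere R n)
    <<s (@open (sphere R n)) >> (@sigma_algebra0 _ setT _)
    (@sigma_algebraC _ _) (@sigma_algebra_bigcup _ setT _).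

Lemma dotp_opp (x : sphere R n) : dotp (- vec x) (- vec x) = 1.
Proof. by rewrite /dotp linearN /= mulmxN mulNmx opprK; exact: dotp_vec. Qed.

Definition antipode (x : sphere R n) : sphere R n := to_sphere (dotp_opp x).

End sphere_structures.

Section volume.
Context {R : realType}.

Lemma dotp_polar n (t : R) (w : sphere R n) :
  dotp (row_mx (cos t)%:M (sin t *: vec w) : 'rV[R]_n.+2)
       (row_mx (cos t)%:M (sin t *: vec w) : 'rV[R]_n.+2) = 1.
Proof.
rewrite /dotp (@tr_row_mx _ 1 1 n.+1) (@mul_row_col _ 1 1 n.+1 1) mxE.
rewrite linearZ /= -scalemxAl -scalemxAr !mxE.
have := dotp_vec w; rewrite /dotp mxE => ->.
by rewrite big_ord1 !mxE /= !mulr1n mulr1 -!expr2 cos2Dsin2.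
Qed.

Definition polar n (t : R) (w : sphere R n) : sphere R n.+1 :=
  to_sphere (dotp_polar t w).

Local Open Scope ereal_scope.

(* Riemannian volume in geodesic polar coordinates about the pole (1, 0, ..., 0):
   the round metric is dt^2 + sin(t)^2 g, with g the round metric of the sphere
   of one dimension less, and the volume of S^0 is the counting measure. *)
Fixpoint volume n : set (sphere R n) -> \bar R :=
  match n with
  | 0 => fun A => \d_(point : sphere R 0) A + \d_(antipode point) A
  | k.+1 => fun A =>
      \int[lebesgue_measure]_(t in `[0%R, pi])
        ((sin t ^+ k)%:E * volume (polar t @^-1` A))
  end.

End volume.

Section geometry.
Context {R : realType} {n : nat}.
Implicit Types p q x y : sphere R n.

Definition sdist p q : R := acos (dotp (vec p) (vec q)).

Definition tangent p : set 'rV[R]_n.+1 := [set v | dotp (vec p) v = 0].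

(* At v = 0 the second term vanishes, so [sphere_exp p 0 = vec p]. *)
Definition sphere_exp p (v : 'rV[R]_n.+1) : 'rV[R]_n.+1 :=
  cos (enorm v) *: vec p + (sin (enorm v) / enorm v) *: v.

(* Junk value 0 at the antipode of p, where no such v exists. *)
Definition sphere_log p q : 'rV[R]_n.+1 :=
  xget 0 [set v | [/\ tangent p v, enorm v < pi & sphere_exp p v = vec q]].

Definition cut_locus p : set (sphere R n) := [set antipode p].

Definition frechet_fun (nu : set (sphere R n) -> \bar R) x : \bar R :=
  \int[nu]_y (2^-1 * sdist y x ^+ 2)%:E.

Definition frechet_mean_set (nu : set (sphere R n) -> \bar R) :
    set (sphere R n) :=
  [set x | forall y, (frechet_fun nu x <= frechet_fun nu y)%E].

End geometry.

Section probability_notions.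
Context {d : measure_display} {Omega : measurableType d} {R : realType}.
Variable P : probability Omega R.

Definition mutually_independent {d' : measure_display} {T : measurableType d'}
    (X : nat -> Omega -> T) : Prop :=
  forall (s : seq nat) (A : nat -> set T), uniq s ->
    (forall i, measurable (A i)) ->
    P (\bigcap_(i in [set` s]) (X i @^-1` A i)) =
      (\prod_(i <- s) P (X i @^-1` A i))%E.

Definition iid {d' : measure_display} {T : measurableType d'}
    (X : nat -> {RV P >-> T}) (mu : set T -> \bar R) : Prop :=
  mutually_independent X /\
  forall i A, measurable A -> distribution P (X i) A = mu A.

Definition cvg_in_distribution {m : nat} (Y : nat -> Omega -> 'rV[R]_m)
    (L : set 'rV[R]_m -> \bar R) : Prop :=
  forall g : 'rV[R]_m -> R, continuous g ->
    (exists M : R, forall v, `|g v| <= M) ->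
    (\int[P]_w (g (Y k w))%:E)%E @[k --> \oo] --> (\int[L]_v (g v)%:E)%E.

(* [X 0, ..., X k.-1] are the first k observations. *)
Definition empirical {d' : measure_display} {T : measurableType d'}
    (X : nat -> Omega -> T) (k : nat) (w : Omega) : set T -> \bar R :=
  mscale (k%:R^-1)%:nng (msum (fun i => \d_(X i w)) k).

End probability_notions.

(* Normal laws on the line, with the Dirac masses as the variance-zero case
   ([normal_prob m 0] is something else in the library). *)
Definition gaussian1 {R : realType} (m s : R) : set R -> \bar R :=
  if s == 0 then \d_m else normal_prob m s.

Definition gaussian {R : realType} {m : nat} (N : set 'rV[R]_m -> \bar R) : Prop :=
  forall u : 'rV[R]_m, exists a s : R, forall A : set R, measurable A ->
    pushforward N (dotp u) A = gaussian1 a s A.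

Section limit_theorem.
Context {d : measure_display} {Omega : measurableType d} {R : realType}.
Context {n : nat}.

(* Laws on the tangent space at p are laws on the ambient space that are carried
   by [tangent p]. *)
Definition tangent_limit_distribution (P : probability Omega R) (p : sphere R n)
    (X : nat -> Omega -> sphere R n)
    (N : probability 'rV[R]_n.+1 R) : Prop :=
  [/\ N (tangent p) = 1%E, gaussian N &
      cvg_in_distribution P
        (fun k w => Num.sqrt k%:R *:
                    (k%:R^-1 *: \sum_(i < k) sphere_log p (X i w))) N].

End limit_theorem.

Definition sphere_volume (R : realType) (k : nat) : R :=
  fine (@volume R k [set: sphere R k]).

Definition alpha {R : realType} (d : nat) (f : R -> R) : R :=
  sphere_volume R d.-1 / d%:R *
  \int[lebesgue_measure]_(t in `[0, pi])
    (f t * derive1 (fun s : R => s * sin s ^+ d.-1) t).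

Definition correction {R : realType} {m : nat} (a : R) (Z : 'rV[R]_m) : 'rV[R]_m :=
  a^-1 *: Z.

(* Main.v *)
Require Import Defs.
From HB Require Import structures.
From mathcomp Require Import all_boot all_order all_algebra.
From mathcomp Require Import all_classical all_reals all_analysis.
From mathcomp Require Import measurable_realfun simple_functions.
From mathcomp Require Import measurable_fun_approximation.
From mathcomp Require Import interval_inference ring lra.

Set Implicit Arguments.
Unset Strict Implicit.
Unset Printing Implicit Defensive.

Import Order.TTheory GRing.Theory Num.Theory.
Import numFieldNormedType.Exports.

Local Open Scope classical_set_scope.
Local Open Scope ring_scope.

(** The sample mean minimizes an empirical criterion, and the proof is a central limit theorem for
    such minimizers when the criterion is not smooth at the cut locus. Write p for the mean,
    [rho x q] for half the squared distance, and [dev p x q] for the deviation of [rho x q] from its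
    linearization at p, that is [rho x q - rho p q] plus the inner product of x with log_p q. Let
    [edev] be the empirical average of [dev] and g, called [emean], that of log_p. Up to a constant
    in x the sample Fréchet function is edev(x) - <x, g>, where <x, g> = <x - p, g> because g is
    tangent at p. If edev(x) were alpha/2 |x - p|^2, the minimizer would satisfy x - p = g / alpha,
    and sqrt k g converges to N: this is the source of the factor 1/alpha in H.

    Population side. The density depends on the distance to p only, and the volume is invariant
    under enough isometries ([volume_isometry_transitive]), which has to be proved because the
    volume is defined by polar coordinates about one fixed pole. Hence log_p has mean 0, and D(x),
    the integral of [dev p x], is the increase of the Fréchet function from p to x. At a point q at
    distance t, the Hessian of [rho] at p in a direction making an angle theta with q is cos^2 theta
    + t cot t sin^2 theta, and its mean is alpha ([Rintegral_dev2_limit]). Passing to the limit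
    under the integral is legitimate since [dev] is at most the squared distance times [dev_dom], of
    order 1 / sin t near the antipode, which is integrable as f is bounded there. So D(x) is
    equivalent to alpha/2 |x - p|^2 ([popdev_chord_cvg]), and uniqueness of the mean with
    compactness gives D(x) >= c0 |x - p|^2 everywhere ([popdev_ge]). Multiplying this second order
    bound on [dev] by a first order one bounds its second moment by C |x - p|^3
    ([Rintegral_sqr_dev]).

    Empirical side. Smoothness is replaced by semiconcavity ([dev_semiconcave]): when a multiple of
    x is a convex combination of nearby points, edev(x) is at least the average of [edev] over them,
    up to the mean squared spread. On the ball of radius s, lower bounds for [edev] therefore need
    to be checked only on a net of bounded cardinality, and an upper bound is needed only at one
    competitor. Chebyshev's inequality at the net points fails with probability O(s^3 / (k s^4)) =
    O(1 / (k s)) ([uniform_edev]). Summed over dyadic shells this gives the rate 1 / sqrt k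
    ([minimizer_rate]). At the scale K / sqrt k it gives sqrt k (x - p) = sqrt k g / alpha + o(1) in
    probability ([minimizer_expansion]), by comparing the sample mean with a point close to p + g /
    alpha. Since log_p x = x - p + O(|x - p|^2), [slutsky] transfers the limit of sqrt k g /
    alpha. *)

(** * Integration against a pushed-forward density *)

Section integral_of_density.
Local Open Scope ereal_scope.
Context d1 d2 (X : measurableType d1) (Y : measurableType d2) (R : realType).
Variables (nu : {measure set X -> \bar R}) (w : X -> R) (phi : X -> Y).
Hypotheses (mw : measurable_fun [set: X] w) (w0 : forall x, (0 <= w x)%R).
Hypothesis mphi : measurable_fun [set: X] phi.
Variable m : {measure set Y -> \bar R}.
Hypothesis mE : forall A, measurable A ->
  m A = \int[nu]_x (w x * \1_A (phi x))%:E.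

Import HBNNSimple.

(** The hypothesis [mE] is the case of indicators; linearity gives simple functions, and monotone
    convergence along [nnsfun_approx] the rest. Polar coordinates, the cosine substitution and the
    density of [mu] are all instances. *)
Lemma ge0_integral_density (g : Y -> \bar R) :
  measurable_fun [set: Y] g -> (forall y, 0 <= g y) ->
  \int[m]_y g y = \int[nu]_x ((w x)%:E * g (phi x)).
Proof.
move=> mg g0.
pose f_ := nnsfun_approx measurableT mg.
have fcvg y : (EFin \o f_ ^~ y) @ \oo --> g y by exact: cvg_nnsfun_approx.
have fnd y : nondecreasing_seq (fun n => (f_ n y)%:E).
  by move=> a b ab; rewrite lee_fin; exact/lefP/nd_nnsfun_approx.
transitivity (limn (fun n => \int[m]_x (f_ n x)%:E)).
  rewrite -monotone_convergence//.
  - by apply: eq_integral => y _; apply/esym/cvg_lim => //; exact: fcvg.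
  - by move=> n; exact/measurable_EFinP/measurable_funP.
  - by move=> n y _; rewrite lee_fin.
rewrite [X in limn X](_ : _ = (fun n => \int[nu]_x ((w x)%:E * (f_ n (phi x))%:E))).
  rewrite -monotone_convergence//.
  - apply: eq_integral => x _; apply/cvg_lim => //.
    by apply: cvgeZl => //; exact: fcvg.
  - move=> n; apply: emeasurable_funM => //; first exact/measurable_EFinP.
    by apply/measurable_EFinP; apply: measurableT_comp => //; exact: measurable_funP.
  - by move=> n x _; rewrite mule_ge0// lee_fin.
  - by move=> x _ a b ab; rewrite lee_wpmul2l ?lee_fin//; exact: fnd.
apply/funext => n.
have mf r : measurable (f_ n @^-1` [set r]) by exact: measurable_sfunP.
have mi r : measurable_fun setT (fun x => \1_(f_ n @^-1` [set r]) (phi x) : R).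
  have := @measurable_indic _ Y R setT _ (mf r).
  by move=> h1; exact: (measurableT_comp h1 mphi).
rewrite [LHS](_ : _ = \sum_(k \in range (f_ n)) \int[m]_x (k * \1_(f_ n @^-1` [set k]) x)%:E).
  rewrite [RHS](_ : _ = \sum_(k \in range (f_ n))
     \int[nu]_x (k * (w x * \1_(f_ n @^-1` [set k]) (phi x)))%:E).
    apply: eq_fsbigr => r _; have [r0|r0] := ltP r 0%R.
      have -> : f_ n @^-1` [set r] = set0 by rewrite preimage_nnfun0.
      by rewrite !integral0_eq// => x _; rewrite indic0 ?mulr0.
    rewrite integralZl_indic_nnsfun// integral_indic// setIT mE//.
    under [RHS]eq_integral do rewrite EFinM.
    rewrite ge0_integralZl//; first exact/measurable_EFinP/measurable_funM.
    by move=> x _; rewrite lee_fin mulr_ge0.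
  rewrite -ge0_integral_fsum//.
  - apply: eq_integral => x _; rewrite fsumEFin// -EFinM; congr EFin.
    rewrite {1}(fimfunE (f_ n)) mulrC mulr_fsuml//=.
    by apply: eq_fsbigr => r _; rewrite [in RHS]mulrCA mulrC.
  - by move=> r; apply/measurable_EFinP; do 2 apply: measurable_funM => //.
  - move=> r x _; rewrite lee_fin mulrCA mulr_ge0//.
    exact: (nnfun_muleindic_ge0 (f_ n) r (phi x)).
rewrite -ge0_integral_fsum//.
- by apply: eq_integral => x _; rewrite fsumEFin// -fimfunE.
- by move=> r; exact/measurable_EFinP/measurable_funM.
- by move=> r x _; rewrite nnfun_muleindic_ge0.
Qed.

End integral_of_density.

(** * Borel measurability of row vectors and of points of the sphere *)

Section borel_rows.
Context d (T : measurableType d) (R : realType).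


(** Every open set of rows is a countable union of boxes with rational corners, and the preimage of
    a box is a finite intersection of conditions on single coordinates. *)
Lemma measurable_fun_row n (f : T -> 'rV[R]_n) :
  (forall j, measurable_fun setT (fun x => f x 0 j)) -> measurable_fun setT f.
Proof.
move=> mf; apply: (@measurability _ _ T _ setT f (@open _)) => //.
move=> _ [U oU <-]; rewrite setTI.
pose box (ab : 'rV[rat]_n * 'rV[rat]_n) : set 'rV[R]_n :=
  [set v | forall j, ratr (ab.1 0 j) < v 0 j < ratr (ab.2 0 j)].
have -> : f @^-1` U =
    \bigcup_ab (if `[< box ab `<=` U >] then f @^-1` box ab else set0).
  apply/seteqP; split=> x /=; last first.
    by move=> [ab _]; case: ifPn => // /asboolP; apply.
  move=> Ufx; have /nbhs_ballP[e /= e0 bO] : nbhs (f x) U by exact: open_nbhs_nbhs.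
  have /choice[a ha] : forall j, exists q : rat, f x 0 j - e < ratr q < f x 0 j.
    move=> j; have /rat_in_itvoo[q] : f x 0 j - e < f x 0 j by rewrite ltrBlDr ltrDl.
    by rewrite in_itv => hq; exists q.
  have /choice[b hb] : forall j, exists q : rat, f x 0 j < ratr q < f x 0 j + e.
    move=> j; have /rat_in_itvoo[q] : f x 0 j < f x 0 j + e by rewrite ltrDl.
    by rewrite in_itv => hq; exists q.
  exists (\row_j a j, \row_j b j) => //.
  case: ifPn => [_ /= j|/asboolP bOn].
    by rewrite !mxE; case/andP: (ha j) (hb j) => _ -> /andP[-> _].
  apply: bOn => v /= hv; apply: bO; split => // i j.
  rewrite (ord1 i) /ball /= ltr_distlC.
  have := hv j; rewrite !mxE => /andP[h1 h2].
  case/andP: (ha j) => h3 _; case/andP: (hb j) => _ h4.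
  by rewrite (lt_trans h3 h1) (lt_trans h2 h4).
apply: countable_bigcupT_measurable; first exact: countableP.
move=> ab; case: ifPn => // _.
rewrite (_ : _ @^-1` _ = \bigcap_(j in [set: 'I_n])
    ((fun x => f x 0 j) @^-1` `]ratr (ab.1 0 j), ratr (ab.2 0 j)[)).
  apply: fin_bigcap_measurable => // j _; rewrite -[X in measurable X]setTI.
  by apply: mf.
apply/seteqP; split=> x /=.
  by move=> h j _; rewrite /= in_itv/=; exact: h.
by move=> h j; have := h j Logic.I; rewrite /= in_itv.
Qed.

Lemma continuous_measurable_row n (g : 'rV[R]_n -> R) (f : T -> 'rV[R]_n) :
  continuous g -> measurable_fun setT f -> measurable_fun setT (g \o f).
Proof.
move=> cg mf.
have mg : measurable_fun setT g.
  apply: (measurability _ (RGenOInfty.measurableE R)) => //.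
  move=> _ [_ [x ->] <-]; rewrite setTI; apply: sub_sigma_algebra.
  by apply: open_comp => //= v _; exact: cg.
exact: measurableT_comp.
Qed.

End borel_rows.

Section borel_sphere.
Context (R : realType) (n : nat).

Lemma continuous_vec : continuous (@vec R n).
Proof. exact: initial_continuous. Qed.

Lemma measurable_vec : measurable_fun setT (@vec R n).
Proof.
apply: (@measurability _ _ (sphere R n) _ setT (@vec R n) (@open _)) => // _ [U oU <-]; rewrite setTI.
apply: sub_sigma_algebra; apply: open_comp => // x _; exact: continuous_vec.
Qed.

Lemma measurable_vec_coord j : measurable_fun setT (fun x : sphere R n => vec x 0 j).
Proof.
exact: (continuous_measurable_row (@coord_continuous _ 1 n.+1 0 j) measurable_vec).
Qed.

Lemma measurable_fun_sphere d (T : measurableType d) (f : T -> sphere R n) :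
  (forall j, measurable_fun setT (fun x => vec (f x) 0 j)) -> measurable_fun setT f.
Proof.
move=> /measurable_fun_row mf.
apply: (@measurability _ _ T _ setT f (@open _)) => // _ [_ [U oU <-] <-]; rewrite setTI.
rewrite -[X in measurable X]setTI; apply: (mf measurableT _ _).
exact: sub_sigma_algebra.
Qed.

Lemma vec_inj : injective (@vec R n).
Proof. exact: val_inj. Qed.

End borel_sphere.

(** * The volume of the sphere as a finite measure, in polar coordinates *)

Section polar_measure.
Context (R : realType) (k : nat).
Local Notation leb := (@lebesgue_measure R).

Lemma vec_polar0 (t : R) (w : sphere R k) : vec (polar t w) 0 0 = cos t.
Proof.
rewrite [vec _](_ : _ = row_mx (cos t)%:M (sin t *: vec w) :> 'rV[R]_(1 + k.+1))//.
rewrite mxE; case: splitP => // j _; by rewrite (ord1 j) mxE.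
Qed.

Lemma vec_polar_lift (t : R) (w : sphere R k) j :
  vec (polar t w) 0 (lift ord0 j) = sin t * vec w 0 j.
Proof.
rewrite [vec _](_ : _ = row_mx (cos t)%:M (sin t *: vec w) :> 'rV[R]_(1 + k.+1))//.
rewrite mxE; case: splitP => [i /esym|i].
  by move=> /= h; have := ltn_ord i; rewrite h.
rewrite /= /bump /= !add1n => -[ji]; rewrite mxE; congr (_ * vec w _ _).
exact: val_inj.
Qed.

Lemma measurable_polar :
  measurable_fun setT (fun z : R * sphere R k => polar z.1 z.2).
Proof.
apply: measurable_fun_sphere => j.
have [->|[i ->]] : j = ord0 \/ exists i, j = lift ord0 i.
  by case: (unliftP ord0 j) => [i|] ->; [right; exists i|left].
  under eq_fun do rewrite vec_polar0.
  apply: measurableT_comp; last exact: measurable_fst.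
  by apply: continuous_measurable_fun; exact: continuous_cos.
under eq_fun do rewrite vec_polar_lift.
apply: measurable_funM.
  apply: measurableT_comp; last exact: measurable_fst.
  by apply: continuous_measurable_fun; exact: continuous_sin.
by apply: (measurableT_comp (measurable_vec_coord i)); exact: measurable_snd.
Qed.

Lemma measurable_polar1 (t : R) : measurable_fun setT (@polar R k t).
Proof. exact: (measurable_fun_pair2 t measurable_polar). Qed.

Lemma measurable_preimage_polar (t : R) A :
  measurable A -> measurable (@polar R k t @^-1` A).
Proof.
move=> mA; rewrite -[X in measurable X]setTI.
exact: (measurable_polar1 t measurableT mA).
Qed.

Lemma measurable_sinX n (D : set R) : measurable_fun D (fun t : R => sin t ^+ n).
Proof.
apply: measurable_funTS; apply: measurable_funX.
by apply: continuous_measurable_fun; exact: continuous_sin.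
Qed.

Variable m : {finite_measure set (sphere R k) -> \bar R}.

(** One step of the recursion defining [volume], abstracted over the measure one dimension below, so
    that countable additivity and finiteness propagate by induction on the dimension. *)
Definition polar_measure (A : set (sphere R k.+1)) : \bar R :=
  (\int[leb]_(t in `[0%R, pi]) ((sin t ^+ k)%:E * m (polar t @^-1` A)))%E.

Local Open Scope ereal_scope.

Lemma sinX_ge0 n (t : R) : t \in `[0%R, pi] -> 0 <= (sin t ^+ n)%:E.
Proof. by rewrite in_itv /= => h; rewrite lee_fin exprn_ge0// sin_ge0_pi. Qed.

Let measurable_section A : measurable A ->
  measurable_fun setT (fun t : R => m (polar t @^-1` A)).
Proof.
move=> mA.
have mB : measurable ((fun z : R * sphere R k => polar z.1 z.2) @^-1` A).
  by rewrite -[X in measurable X]setTI; exact: measurable_polar.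
have := measurable_fun_xsection m mB; congr (measurable_fun _ _).
by apply/funext => t /=; congr (m _); apply/seteqP; split => x; rewrite /xsection/= inE.
Qed.

Let pm0 : polar_measure set0 = 0.
Proof.
by rewrite /polar_measure integral0_eq// => t _; rewrite preimage_set0 measure0 mule0.
Qed.

Let pm_ge0 A : 0 <= polar_measure A.
Proof.
by apply: integral_ge0 => t /= ht; rewrite mule_ge0// sinX_ge0.
Qed.

Let pm_sigma_additive : semi_sigma_additive polar_measure.
Proof.
move=> F mF tF mUF.
rewrite [X in _ --> X](_ : _ = \sum_(n <oo) polar_measure (F n)).
  by apply/cvg_closeP; split; [exact: is_cvg_nneseries|rewrite closeE].
rewrite -integral_nneseries//.
- apply: eq_integral => t /[!inE] ht.
  rewrite -[LHS]/(_ * _) preimage_bigcup measure_semi_bigcup.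
  + by rewrite nneseriesZl.
  + by move=> i; exact: measurable_preimage_polar.
  + apply/trivIsetP => i j _ _ ij; rewrite -preimage_setI.
    by move/trivIsetP : tF => ->//; rewrite preimage_set0.
  + by rewrite -preimage_bigcup; exact: measurable_preimage_polar.
- move=> n; apply: emeasurable_funM; first by apply/measurable_EFinP; exact: measurable_sinX.
  by apply: measurable_funTS; exact: measurable_section.
- by move=> n t ht; rewrite mule_ge0// sinX_ge0.
Qed.

HB.instance Definition _ := isMeasure.Build _ _ _ polar_measure
  pm0 pm_ge0 pm_sigma_additive.

Let pm_fin : fin_num_fun polar_measure.
Proof.
move=> A mA; rewrite ge0_fin_numE//.
apply: (@le_lt_trans _ _ (\int[leb]_(t in `[0%R, pi]) m setT)).
  apply: ge0_le_integral => //.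
  - by move=> t ht; rewrite mule_ge0// sinX_ge0.
  - apply: emeasurable_funM; first by apply/measurable_EFinP; exact: measurable_sinX.
    by apply: measurable_funTS; exact: measurable_section.
  - move=> t ht; rewrite -[leRHS]mul1e lee_pmul//; first exact: sinX_ge0.
    + rewrite lee_fin -[leRHS](expr1n _ k); apply: lerXn2r; rewrite ?nnegrE//.
        by apply: sin_ge0_pi; rewrite /= in_itv in ht.
    + apply: le_measure; rewrite ?inE//.
      exact: measurable_preimage_polar.
rewrite integral_cst//; apply: lte_mul_pinfty => //.
  by rewrite fin_num_measure.
have := lebesgue_measure_itv `[0%R, pi : R]; rewrite /= lte_fin pi_gt0 => ->.
by rewrite -EFinB ltry.
Qed.

HB.instance Definition _ := Measure_isFinite.Build _ _ _ polar_measure pm_fin.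

(** [polar_measure] is the image under [polar] of the product measure with density sin^k on [0, pi],
    so the density formula and Tonelli's theorem apply. *)
Lemma ge0_integral_polar (h : sphere R k.+1 -> \bar R) :
  measurable_fun setT h -> (forall x, 0 <= h x) ->
  \int[polar_measure]_x h x =
  \int[leb]_(t in `[0%R, pi]) ((sin t ^+ k)%:E * \int[m]_w h (polar t w)).
Proof.
move=> mh h0.
pose I : set R := `[0%R, pi]%classic.
pose wt (z : R * sphere R k) : R := (sin z.1 ^+ k * \1_I z.1)%R.
have mI : measurable_fun setT (\1_I : R -> R) by apply: measurable_indic; exact: measurable_itv.
have mwt : measurable_fun setT wt.
  apply: (measurableT_comp (f := fun t : R => (sin t ^+ k * \1_I t)%R)).
    by apply: measurable_funM => //; exact: measurable_sinX.
  exact: measurable_fst.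
have wt0 z : (0 <= wt z)%R.
  rewrite /wt indicE; case: (boolP (z.1 \in I)) => zI; rewrite ?mulr0// mulr1.
  by have := sinX_ge0 k (set_mem zI); rewrite lee_fin.
have key (g : sphere R k.+1 -> \bar R) : measurable_fun setT g -> (forall x, 0 <= g x) ->
  \int[leb \x m]_z ((wt z)%:E * g (polar z.1 z.2)) =
  \int[leb]_(t in I) ((sin t ^+ k)%:E * \int[m]_w g (polar t w)).
  move=> mg g0; 
  have h1 : measurable_fun setT (fun z : R * sphere R k => (wt z)%:E * g (polar z.1 z.2)).
    apply: emeasurable_funM; first exact/measurable_EFinP.
    exact: (measurableT_comp mg measurable_polar).
  have h2 z : 0 <= (wt z)%:E * g (polar z.1 z.2) by rewrite mule_ge0// lee_fin.
  rewrite (@fubini_tonelli1 _ _ _ _ R leb m _ h1 h2).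
  - rewrite [RHS]integral_mkcond; apply: eq_integral => t _.
    rewrite /fubini_F /= patchE; case: ifPn => tI.
      rewrite -ge0_integralZl//.
      + by apply: eq_integral => w _; rewrite /wt /= indicE tI mulr1.
      + exact: (measurableT_comp mg (measurable_polar1 t)).
      + exact: sinX_ge0 (set_mem tI).
    by rewrite integral0_eq// => w _; rewrite /wt /= indicE (negbTE tI) mulr0 mul0e.
rewrite -key//.
apply: ge0_integral_density => //; first exact: measurable_polar.
move=> A mA; transitivity (\int[leb \x m]_z ((wt z)%:E * (EFin \o \1_A) (polar z.1 z.2))) => //.
rewrite (key (EFin \o \1_A))//.
- apply: eq_integral => t _; congr (_ * _).
  transitivity (\int[m]_w (\1_(polar t @^-1` A) w)%:E).
    rewrite integral_indic// ?setIT//.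
    exact: measurable_preimage_polar.
  by [].
- by apply/measurable_EFinP; exact: measurable_indic.
- by move=> x; rewrite lee_fin.
Qed.

End polar_measure.

Section vol.
Context (R : realType).
Local Open Scope ereal_scope.

Definition vol0 : set (sphere R 0) -> \bar R :=
  measure_add (\d_(point : sphere R 0)) (\d_(antipode point)).

HB.instance Definition _ := Measure.on vol0.

Let vol0_fin : fin_num_fun vol0.
Proof. by move=> A mA; rewrite /vol0 measure_addE fin_numD !fin_num_measure. Qed.

HB.instance Definition _ := Measure_isFinite.Build _ _ _ vol0 vol0_fin.

(** [volume] is a bare set function; this copy carries the structure of a finite measure, and [volE]
    identifies the two. *)
Fixpoint vol n : {finite_measure set (sphere R n) -> \bar R} :=
  match n with
  | 0 => vol0
  | k.+1 => polar_measure (vol k)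
  end.

Lemma volE n : volume (R := R) (n := n) = vol n :> (set (sphere R n) -> \bar R).
Proof.
elim: n => [|n IH] /=; first by apply/funext => A; rewrite /vol0 measure_addE.
by rewrite IH.
Qed.

End vol.

Section density_measure.
Local Open Scope ereal_scope.
Context d1 d2 (X : measurableType d1) (Y : measurableType d2) (R : realType).
Variables (nu : {measure set X -> \bar R}) (w : X -> R) (phi : X -> Y).

Definition density_measure (mw : measurable_fun [set: X] w)
    (w0 : forall x, (0 <= w x)%R) (mphi : measurable_fun [set: X] phi)
    (A : set Y) : \bar R := \int[nu]_x (w x * \1_A (phi x))%:E.

Variables (mw : measurable_fun [set: X] w) (w0 : forall x, (0 <= w x)%R).
Variables (mphi : measurable_fun [set: X] phi).
Let m := density_measure mw w0 mphi.

Let m0 : m set0 = 0.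
Proof. by rewrite /m /density_measure integral0_eq// => x _; rewrite indic0 mulr0. Qed.

Let m_ge0 A : 0 <= m A.
Proof. by apply: integral_ge0 => x _; rewrite lee_fin mulr_ge0. Qed.

Let m_sigma_additive : semi_sigma_additive m.
Proof.
move=> F mF tF mUF.
rewrite [X in _ --> X](_ : _ = \sum_(n <oo) m (F n)).
  by apply/cvg_closeP; split; [exact: is_cvg_nneseries|rewrite closeE].
rewrite -integral_nneseries//.
- apply: eq_integral => x _.
  have dE B : (\1_B (phi x) : R)%:E = \d_(phi x) B by [].
  under eq_eseriesr do rewrite EFinM dE.
  rewrite nneseriesZl//.
  by rewrite EFinM dE measure_semi_bigcup.
- move=> n; apply/measurable_EFinP; apply: measurable_funM => //.
  have mi := @measurable_indic _ Y R setT _ (mF n).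
  exact: (measurableT_comp mi mphi).
- by move=> n x _; rewrite lee_fin mulr_ge0.
Qed.

HB.instance Definition _ := isMeasure.Build _ _ _
  (density_measure mw w0 mphi) m0 m_ge0 m_sigma_additive.

End density_measure.

(** * Changes of variables on the line: translation, reflection, cosine *)

Section lebesgue_change_of_variables.
Context (R : realType).
Local Notation leb := (@lebesgue_measure R).
Local Open Scope ereal_scope.

Lemma measurable_shift (c : R) : measurable_fun setT (fun x : R => x + c)%R.
Proof. exact: measurable_funD. Qed.

Lemma lebesgue_measure_shift (c : R) (A : set R) : measurable A ->
  pushforward leb ((fun x => x + c)%R : _ -> measurableTypeR R) A = leb A.
Proof.
move=> mA.
have mc : measurable_fun setT ((fun x => x + c)%R : measurableTypeR R -> measurableTypeR R).
  exact: measurable_shift.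
pose f : {mfun measurableTypeR R >-> measurableTypeR R} :=
  HB.pack (fun x : measurableTypeR R => x + c : measurableTypeR R)%R (isMeasurableFun.Build _ _ _ _ _ mc).
apply/esym; apply: (lebesgue_measure_unique (mu := pushforward leb f)) => //.
move=> _ [[a b]] _ <-.
rewrite /pushforward /= [X in _ = leb X](_ : _ = `](a - c)%R, (b - c)%R]%classic); last first.
  by apply/seteqP; split=> x /=; rewrite !in_itv /= ltrBlDr lerBrDr.
rewrite !lebesgue_measure_itv/= !lte_fin ltrD2r.
by case: ifP => // _; rewrite -!EFinB; congr EFin; ring.
Qed.

Lemma ge0_integral_shift (c : R) (h : R -> \bar R) :
  measurable_fun setT h -> (forall x, 0 <= h x) ->
  \int[leb]_x h (x + c)%R = \int[leb]_x h x.
Proof.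
move=> mh h0.
have mc : measurable_fun setT ((fun x => x + c)%R : _ -> measurableTypeR R).
  exact: measurable_shift.
have := @ge0_integral_pushforward _ _ (measurableTypeR R) _ R _ mc leb setT h measurableT mh (fun y _ => h0 y).
rewrite preimage_setT => <-.
by apply: eq_measure_integral => A mA _; exact: lebesgue_measure_shift.
Qed.

Lemma ge0_integral_opp (h : R -> \bar R) :
  measurable_fun setT h -> (forall x, 0 <= h x) ->
  \int[leb]_x h (- x)%R = \int[leb]_x h x.
Proof.
move=> mh h0.
have mN : measurable_fun setT (-%R : _ -> measurableTypeR R).
  exact: oppr_measurable.
have := @ge0_integral_pushforward _ _ (measurableTypeR R) _ R _ mN leb setT h measurableT mh (fun y _ => h0 y).
rewrite preimage_setT => <-.
by apply: eq_measure_integral => A mA _; exact: lebesgue_measureN.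
Qed.

End lebesgue_change_of_variables.

Section cosine_substitution.
Context (R : realType).
Local Notation leb := (@lebesgue_measure R).

Lemma integral_sin_itv (sg a : R) : (0 <= a < pi) ->
  (\int[leb]_(s in `[a, pi]) (sg * sin s)%:E = (sg + sg * cos a)%:E)%E.
Proof.
move=> /andP[a0 api].
have cF : continuous (fun s : R => - sg * cos s).
  by move=> s; apply: cvgM; [exact: cvg_cst|exact: continuous_cos].
have dF s : is_derive (s : R) (1 : R) (fun s : R => - sg * cos s) (sg * sin s).
  by apply: is_derive_eq; rewrite [LHS]mulrNN.
rewrite (@continuous_FTC2 _ _ (fun s => - sg * cos s)) //.
- by rewrite cospi -EFinB; congr EFin; ring.
- apply: continuous_subspaceT => s.
  by apply: cvgM; [exact: cvg_cst|exact: continuous_sin].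
- split.
  + by move=> s _; have [] := dF s.
  + by apply: cvg_at_right_filter; exact: cF.
  + by apply: cvg_at_left_filter; exact: cF.
- by move=> s _; rewrite derive1E derive_val.
Qed.

(** The substitution y = sg cos s tested on rays, which generate the Borel sets and are stable under
    intersection. The integrand lives on the angles s beyond acos (x / sg), where -sg cos s is an
    explicit antiderivative. *)
Lemma cos_density_lt (sg x : R) : (0 < sg) ->
  (\int[leb]_s (sg * sin s * \1_(`[0%R, pi]) s * \1_(`]-oo, x[) (sg * cos s))%:E
  = leb (`]-oo, x[ `&` `[(- sg)%R, sg]))%E.
Proof.
move=> sg0.
have [xs|sx] := leP x (- sg).
  rewrite integral0_eq.
    rewrite (_ : _ `&` _ = set0) ?measure0//; apply/seteqP; split => y //= [].
    by rewrite !in_itv/= => /lt_le_trans/(_ xs) yx /andP[] /(lt_le_trans yx); rewrite ltxx.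
  move=> s _; rewrite [X in (_ * X)]indicE memNset ?mulr0//= in_itv/=.
  apply/negP; rewrite -leNgt (le_trans xs)// -mulrN1 ler_pM2l//.
  exact: cos_geN1.
(* Past sg the ray already contains the whole segment, so its endpoint is truncated to stay in the
   domain of [acos]. *)
pose c := Num.min x sg.
have cs : (- sg < c <= sg) by rewrite lt_min sx/= gtrN// ge_min lexx orbT.
have c1 : (-1 < c / sg <= 1).
  by rewrite ltr_pdivlMr// ler_pdivrMr// mul1r mulN1r.
have c1' : (-1 <= c / sg <= 1) by case/andP: c1 => /ltW -> ->.
pose a := acos (c / sg).
have a0 : (0 <= a < pi) by rewrite acos_ge0//= acos_ltpi.
have cosa : cos a = (c / sg) by rewrite /a acosK// in_itv.
have aI : a \in `[0, pi] by rewrite in_itv/=; case/andP: a0 => -> /ltW ->.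
transitivity (\int[leb]_(s in `]a, pi]) (sg * sin s)%:E)%E.
  rewrite [RHS]integral_mkcond; apply: eq_integral => s _.
  rewrite patchE; case: ifPn => [/set_mem|/negP h].
    rewrite /= in_itv /= => /andP[as_ spi].
    have s0 : (0 <= s) by case/andP: a0 => h _; rewrite (le_trans h)// ltW.
    rewrite !indicE !mem_set ?mulr1//=; rewrite in_itv/= ?s0//.
    rewrite mulrC -ltr_pdivlMr// (lt_le_trans (_ : _ < cos a))//.
      by rewrite ltr_cos// in_itv/= s0 spi.
    by rewrite cosa ler_pM2r ?invr_gt0// ge_min lexx.
  congr EFin.
  have [s0pi|] := boolP (s \in `[0, pi]); last first.
    by move=> s0pi; rewrite [X in (_ * X * _)]indicE memNset ?mulr0 ?mul0r//; exact/negP.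
  have [->|s_neq0] := eqVneq s 0; first by rewrite sin0 mulr0 !mul0r.
  rewrite [X in (_ * X)]indicE memNset ?mulr0//= in_itv/=.
  move=> sx'; apply: h; apply/mem_set => /=; rewrite in_itv/=.
  move: s0pi; rewrite in_itv/= => /andP[s0 spi]; rewrite spi andbT.
  have s0' : (0 < s) by rewrite lt_neqAle eq_sym s_neq0.
  have sI : s \in `[0, pi] by rewrite in_itv/= s0 spi.
  rewrite -ltr_cos//.
  rewrite cosa ltr_pdivlMr// mulrC lt_min sx'/= gtr_pMr//.
  by rewrite -[ltRHS]cos0 ltr_cos// in_itv/= lexx pi_ge0.
rewrite integral_itv_obnd_cbnd; last first.
  apply/measurable_EFinP; apply: measurable_funM => //.
  by apply: measurable_funTS; apply: continuous_measurable_fun; exact: continuous_sin.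
rewrite integral_sin_itv// cosa mulrCA divff ?mulr1 ?gt_eqF//.
have [xs|sx'] := leP x sg.
  rewrite (_ : _ `&` _ = `[- sg, x[%classic).
    rewrite lebesgue_measure_itv/= lte_fin sx -EFinB /c min_l//.
    by congr EFin; ring.
  apply/seteqP; split=> y /=; rewrite !in_itv/=; first by case=> -> /andP[->].
  by move=> /andP[-> yx]; rewrite yx (ltW (lt_le_trans yx xs)).
rewrite (_ : _ `&` _ = `[- sg, sg]%classic).
  rewrite lebesgue_measure_itv/= lte_fin gtrN// -EFinB /c min_r ?(ltW sx')//.
  by congr EFin; ring.
apply/seteqP; split=> y /=; rewrite !in_itv/=; first by case.
by move=> /andP[h1 h2]; rewrite h1 h2 (le_lt_trans h2).
Qed.

(** By [cos_density_lt] the image of sg sin s ds and Lebesgue measure restricted to [-sg, sg] agree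
    on rays, hence on all Borel sets. The density formula then evaluates h against both. *)
Lemma ge0_integral_cos_subst (sg : R) (h : R -> \bar R) : (0 < sg) ->
  measurable_fun setT h -> (forall x, (0 <= h x)%E) ->
  (\int[leb]_(s in `[0%R, pi]) ((sg * sin s)%:E * h (sg * cos s)%R) =
  \int[leb]_(y in `[(- sg)%R, sg]) h y)%E.
Proof.
move=> sg0 mh h0.
pose w (s : R) : R := (sg * sin s * \1_(`[0, pi]) s).
pose phi (s : R) : R := (sg * cos s).
have mw : measurable_fun setT w.
  apply: measurable_funM; last by apply: measurable_indic; exact: measurable_itv.
  by apply: measurable_funM => //; apply: continuous_measurable_fun; exact: continuous_sin.
have w0 s : (0 <= w s).
  rewrite /w indicE; case: (boolP (s \in _)) => si; rewrite ?mulr0// mulr1.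
  rewrite mulr_ge0 ?(ltW sg0)// sin_ge0_pi//.
  by move/set_mem: si; rewrite /= in_itv.
have mphi : measurable_fun setT phi.
  by apply: measurable_funM => //; apply: continuous_measurable_fun; exact: continuous_cos.
have mD : measurable (`[- sg, sg]%classic : set R) by exact: measurable_itv.
pose mr : {measure set (measurableTypeR R) -> \bar R} := mrestr leb mD.
pose dm : {measure set (measurableTypeR R) -> \bar R} :=
  @density_measure _ _ (measurableTypeR R) (measurableTypeR R) _ leb w phi mw w0 mphi.
have mE A : measurable A -> mr A = dm A.
  move=> mA; apply: (@measure_unique _ R (measurableTypeR R) (RGenInftyO.G (R := R))
      (fun k : nat => `]-oo, k%:R[%classic) (RGenInftyO.measurableE R) _ _ _ mr dm _ _ A mA) => //.
  - move=> _ _ [x ->] [y ->]; exists (Num.min x y).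
    by apply/seteqP; split=> z /=; rewrite !in_itv/= lt_min; [case=> -> ->|case/andP].
  - by move=> k; exists k%:R.
  - apply/seteqP; split=> // x _; exists (Num.truncn x).+1 => //=.
    by rewrite in_itv/= truncnS_gt.
  - by move=> _ [x ->]; exact: (esym (cos_density_lt x sg0)).
  - move=> k; rewrite /mr /= /mrestr (@le_lt_trans _ _ (leb `[- sg, sg]))//.
      by apply: le_measure; rewrite ?inE//; exact: measurableI.
    by rewrite lebesgue_measure_itv/=; case: ifP => // _; rewrite -EFinB ltry.
have -> : (\int[leb]_(y in `[(- sg)%R, sg]) h y = \int[mr]_y h y)%E.
  have m1 : measurable_fun setT (\1_(`[- sg, sg]) : measurableTypeR R -> R).
    exact: measurable_indic.
  have i0 (x : measurableTypeR R) : (0 : R) <= \1_(`[- sg, sg]) x by [].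
  have mid : measurable_fun setT (fun x : measurableTypeR R => x) by exact: measurable_id.
  have mrE A : measurable A -> mr A = (\int[leb]_x (\1_(`[- sg, sg]) x * \1_A x)%:E)%E.
    move=> mA; under eq_integral do rewrite -[X in X%:E]/((\1_(`[- sg, sg]) \* \1_A) _) -indicI.
    by rewrite integral_indic ?setIT ?/mr ?/= /mrestr 1?setIC//; exact: measurableI.
  rewrite (ge0_integral_density m1 i0 mid mrE mh h0) [LHS]integral_mkcond.
  apply: eq_integral => y _.
  by rewrite patchE indicE; case: ifP => _; rewrite ?mul1e ?mul0e.
rewrite (@ge0_integral_density _ _ (measurableTypeR R) (measurableTypeR R) R leb w phi mw w0 mphi mr mE h mh h0).
rewrite [LHS]integral_mkcond; apply: eq_integral => y _.
rewrite patchE /w indicE; case: ifP => _; first by rewrite mulr1.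
by rewrite mulr0 mul0e.
Qed.

End cosine_substitution.

(** * Rotation invariance of the law of two coordinates *)

Section planar_rotation.
Context (R : realType).
Local Notation leb := (@lebesgue_measure R).
Local Notation mR := (measurableTypeR R).
Implicit Types H : mR * mR -> \bar R.

Let double_integral H := (\int[leb]_x \int[leb]_y H (x, y))%E.

Let mpair (f g : mR * mR -> mR) : measurable_fun setT f -> measurable_fun setT g ->
  measurable_fun setT (fun z => (f z, g z)).
Proof. by move=> mf mg; exact: measurable_fun_pair. Qed.

Let m1 : measurable_fun setT (fst : mR * mR -> mR). Proof. exact: measurable_fst. Qed.
Let m2 : measurable_fun setT (snd : mR * mR -> mR). Proof. exact: measurable_snd. Qed.

Let mlin (a b : R) : measurable_fun setT (fun z : mR * mR => a * z.1 + b * z.2 : mR).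
Proof. by apply: measurable_funD; apply: measurable_funM. Qed.

Lemma measurable_shear1 (c : R) :
  measurable_fun setT (fun z : mR * mR => (z.1 + c * z.2, z.2) : mR * mR).
Proof.
by apply: mpair => //; have := mlin 1 c; under eq_fun do rewrite mul1r.
Qed.

Lemma measurable_shear2 (c : R) :
  measurable_fun setT (fun z : mR * mR => (z.1, z.2 + c * z.1) : mR * mR).
Proof.
by apply: mpair => //; have := mlin c 1; under eq_fun do rewrite mul1r addrC.
Qed.

Lemma ge0_integral_shear2 H (c : R) : measurable_fun setT H ->
  (forall z, (0 <= H z)%E) ->
  double_integral (fun z => H (z.1, z.2 + c * z.1)) = double_integral H.
Proof.
move=> mH H0; apply: eq_integral => x _ /=.
apply: (@ge0_integral_shift R (c * x) (fun y => H (x, y))) => //.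
exact: (measurable_fun_pair2 x mH).
Qed.

Lemma ge0_integral_shear1 H (c : R) : measurable_fun setT H ->
  (forall z, (0 <= H z)%E) ->
  double_integral (fun z => H (z.1 + c * z.2, z.2)) = double_integral H.
Proof.
move=> mH H0; rewrite /double_integral.
have mH' := measurableT_comp mH (measurable_shear1 c).
apply: (etrans (fubini_tonelli (m1 := leb) (m2 := leb) _ mH' (fun z => H0 _))).
apply: (etrans _ (esym (fubini_tonelli (m1 := leb) (m2 := leb) _ mH H0))).
apply: eq_integral => y _ /=.
apply: (@ge0_integral_shift R (c * y) (fun x => H (x, y))) => //.
exact: (measurable_fun_pair1 y mH).
Qed.

(* A rotation of angle [b <> pi] is a product of three shears, with slopes
   [- tan (b / 2)], [sin b] and [- tan (b / 2)]. *)
Lemma ge0_integral_rotation H (c s : R) : c ^+ 2 + s ^+ 2 = 1 -> c != -1 ->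
  measurable_fun setT H -> (forall z, (0 <= H z)%E) ->
  double_integral (fun z => H (c * z.1 - s * z.2, s * z.1 + c * z.2)) =
  double_integral H.
Proof.
move=> cs1 cN1 mH H0.
have c1 : 1 + c != 0 by rewrite addrC addr_eq0.
pose t := - (s / (1 + c)).
have st : s * t = c - 1.
  apply: (mulIf c1); rewrite /t mulrN mulNr mulrA divfK//.
  have ss : s * s = 1 - c ^+ 2 by rewrite -cs1; ring.
  by rewrite ss; ring.
have tt : t * (1 + c) = - s by rewrite /t mulNr divfK.
have mK := measurableT_comp mH (measurable_shear1 t).
have mL := measurableT_comp mK (measurable_shear2 s).
rewrite -(ge0_integral_shear1 t mH H0).
rewrite -(ge0_integral_shear2 s mK (fun z => H0 _)).
rewrite -(ge0_integral_shear1 t mL (fun z => H0 _)).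
congr (double_integral _); apply/funext => -[x y] /=; congr (H (_, _)).
  transitivity (x * (1 + s * t) + y * (t + t * (1 + s * t))); last by ring.
  rewrite st (_ : 1 + (c - 1) = c); last by ring.
  have -> : t + t * c = - s by rewrite -tt; ring.
  by ring.
transitivity (x * s + y * (1 + s * t)); last by ring.
by rewrite st; ring.
Qed.

Lemma measurable_rotation (c s : R) :
  measurable_fun setT (fun z : mR * mR => (c * z.1 - s * z.2, s * z.1 + c * z.2) : mR * mR).
Proof.
by apply: mpair => //; have := mlin c (- s); under eq_fun do rewrite mulNr.
Qed.

(** This is r to the power k - 1 with r = sqrt (1 - x^2 - y^2). As a quotient it makes sense for k =
    0, and it vanishes off the open unit disc, the square root of a nonpositive number and the
    inverse of 0 being 0. *)
Let disc (k : nat) (z : mR * mR) : R :=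
  let r := Num.sqrt (1 - z.1 ^+ 2 - z.2 ^+ 2) in r ^+ k / r.

Let measurable_disc k : measurable_fun setT (disc k).
Proof.
have ms : measurable_fun setT (fun z : mR * mR => Num.sqrt (1 - z.1 ^+ 2 - z.2 ^+ 2) : mR).
  have mq : measurable_fun setT (@Num.sqrt R : mR -> mR).
    by apply: continuous_measurable_fun; exact: sqrt_continuous.
  apply: (measurableT_comp mq).
  by do ! apply: measurable_funB => //; apply: measurable_funX.
apply: measurable_funM; first exact: measurable_funX.
under eq_fun do rewrite -powR_inv1 ?sqrtr_ge0//.
exact: (measurableT_comp (measurable_powR _) ms).
Qed.

(* In the coordinates [x = cos t], [y = sin t * cos s] the measure
   [sin t ^ k.+1 * sin s ^ k dt ds] has a density which is radial. *)
Lemma ge0_integral_bipolar k (H : mR * mR -> \bar R) : measurable_fun setT H ->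
  (forall z, (0 <= H z)%E) ->
  (\int[leb]_(t in `[0%R, pi]) ((sin t ^+ k.+1)%:E *
     \int[leb]_(s in `[0%R, pi]) ((sin s ^+ k)%:E * H (cos t, sin t * cos s)%R)))%E =
  double_integral (fun z => ((disc k z)%:E * H z)%E).
Proof.
move=> mH H0.
have md : measurable_fun setT (fun z => ((disc k z)%:E * H z)%E).
  by apply: emeasurable_funM => //; apply/measurable_EFinP; exact: measurable_disc.
have d0 z : (0 <= (disc k z)%:E * H z)%E.
  by rewrite mule_ge0// lee_fin divr_ge0 ?exprn_ge0 ?sqrtr_ge0.
pose h (x y : R) := ((disc k (x, y))%:E * H (x, y))%E.
have mh x : measurable_fun setT (h x) by exact: (measurable_fun_pair2 x md).
have h0 x y : (0 <= h x y)%E by exact: d0.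
have hout x y : 1 - x ^+ 2 <= y ^+ 2 -> h x y = 0%E.
  move=> xy; rewrite /h /disc /= ler0_sqrtr ?invr0 ?mulr0 ?mul0e//.
  by rewrite subr_le0.
pose L (x : R) := (\int[leb]_y h x y)%E.
have mL : measurable_fun setT L.
  exact: (measurable_fun_fubini_tonelli_F (m2 := leb) _ md d0).
have L0 x : (0 <= L x)%E by apply: integral_ge0 => y _; exact: h0.
have Lout x : 1 <= x ^+ 2 -> L x = 0%E.
  move=> x1; rewrite /L integral0_eq// => y _; apply: hout.
  by rewrite (@le_trans _ _ 0) ?sqr_ge0// subr_le0.
have sqr_out (r x : R) : 0 <= r -> x \notin `[- r, r] -> r ^+ 2 <= x ^+ 2.
  move=> r0; rewrite in_itv/= -ler_norml -ltNge => rx.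
  by rewrite -(real_normK (num_real x)) lerXn2r ?nnegrE// ltW.
have -> : double_integral (fun z => ((disc k z)%:E * H z)%E) = (\int[leb]_(x in `[(-1)%R, 1%R]) L x)%E.
  rewrite [RHS]integral_mkcond; apply: eq_integral => x _; rewrite patchE.
  case: ifPn => // xN; apply: Lout; rewrite -(expr1n _ 2); apply: sqr_out => //.
  by apply: contra xN => xI; rewrite inE.
rewrite -(ge0_integral_cos_subst ltr01 mL L0).
apply: eq_integral => t /set_mem; rewrite /= in_itv/= => tI; rewrite !mul1r.
have [st0|st0] := eqVneq (sin t) 0; first by rewrite st0 expr0n /= !mul0e.
have sg0 : 0 < sin t by rewrite lt_neqAle eq_sym st0 sin_ge0_pi.
have ct : 1 - cos t ^+ 2 = sin t ^+ 2 by rewrite sin2cos2.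
have -> : L (cos t) = (\int[leb]_(y in `[(- sin t)%R, sin t]) h (cos t) y)%E.
  rewrite [RHS]integral_mkcond; apply: eq_integral => y _; rewrite patchE.
  case: ifPn => // yN; apply: hout; rewrite ct; apply: sqr_out; first exact: ltW.
  by apply: contra yN => yI; rewrite inE.
rewrite -(ge0_integral_cos_subst sg0 (mh _) (h0 _)).
have msin (n : nat) (D : set R) : measurable_fun D (fun s : R => (sin s ^+ n)%:E).
  by apply/measurable_EFinP; exact: measurable_sinX.
have mcos : measurable_fun setT (fun s : R => sin t * cos s : mR).
  by apply: measurable_funM => //; apply: continuous_measurable_fun; exact: continuous_cos.
have mHt : measurable_fun setT (fun s : R => H (cos t, sin t * cos s)).
  exact: (measurableT_comp (measurable_fun_pair2 (cos t) mH) mcos).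
have mht : measurable_fun setT (fun s : R => h (cos t) (sin t * cos s)).
  exact: (measurableT_comp (mh (cos t)) mcos).
have ms1 : measurable_fun setT (fun s : R => (sin t * sin s)%:E).
  apply/measurable_EFinP; apply: measurable_funM => //.
  by apply: continuous_measurable_fun; exact: continuous_sin.
(* The endpoints are negligible; away from them sin s is positive and can be cancelled. *)
rewrite integral_itv_bndoo; last by apply: measurable_funTS; apply: emeasurable_funM.
rewrite [in RHS]integral_itv_bndoo; last by apply: measurable_funTS; apply: emeasurable_funM.
have s0 s : s \in `]0, pi[ -> 0 < sin s by rewrite in_itv => /sin_gt0_pi.
rewrite -!ge0_integralZl//.
- apply: eq_integral => s /set_mem/s0 ss.
  rewrite /h /disc /= -/(_ ^+ _) ct (_ : sin t ^+ 2 - _ = (sin t * sin s) ^+ 2); last first.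
    by rewrite !exprMn (sin2cos2 s); ring.
  rewrite sqrtr_sqr ger0_norm ?mulr_ge0 ?ltW//.
  rewrite !muleA -!EFinM; congr (_%:E * _)%E.
  by rewrite exprMn exprS; field; rewrite !gt_eqF.
- by apply: measurable_funTS; apply: emeasurable_funM.
- by move=> s /s0 ss; rewrite mule_ge0// lee_fin mulr_ge0 ?ltW.
- by rewrite lee_fin ltW.
- by apply: measurable_funTS; apply: emeasurable_funM; [exact: msin|exact: mHt].
- by move=> s /s0 ss; rewrite mule_ge0// lee_fin exprn_ge0// ltW.
- by rewrite lee_fin exprn_ge0// ltW.
Qed.

(** In the variables of [ge0_integral_bipolar] the density [disc] depends on x^2 + y^2 only, so a
    planar rotation passes through it. *)
Lemma ge0_integral_bipolar_rotation k H (c s : R) : c ^+ 2 + s ^+ 2 = 1 -> c != -1 ->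
  measurable_fun setT H -> (forall z, (0 <= H z)%E) ->
  (\int[leb]_(t in `[0%R, pi]) ((sin t ^+ k.+1)%:E *
     \int[leb]_(r in `[0%R, pi]) ((sin r ^+ k)%:E *
        H (c * cos t - s * (sin t * cos r), s * cos t + c * (sin t * cos r))%R)) =
  \int[leb]_(t in `[0%R, pi]) ((sin t ^+ k.+1)%:E *
     \int[leb]_(r in `[0%R, pi]) ((sin r ^+ k)%:E * H (cos t, sin t * cos r)%R)))%E.
Proof.
move=> cs1 cN1 mH H0.
have mHr := measurableT_comp mH (measurable_rotation c s).
rewrite (ge0_integral_bipolar k mHr (fun z => H0 _)).
rewrite (ge0_integral_bipolar k mH H0).
have md : measurable_fun setT (fun z => ((disc k z)%:E * H z)%E).
  by apply: emeasurable_funM => //; apply/measurable_EFinP; exact: measurable_disc.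
have d0 z : (0 <= (disc k z)%:E * H z)%E.
  by rewrite mule_ge0// lee_fin divr_ge0 ?exprn_ge0 ?sqrtr_ge0.
rewrite -(ge0_integral_rotation cs1 cN1 md d0).
congr (double_integral _); apply/funext => z /=; congr (_%:E * _)%E.
rewrite /disc /= (_ : 1 - _ - _ = 1 - z.1 ^+ 2 - z.2 ^+ 2)//.
transitivity (1 - (c ^+ 2 + s ^+ 2) * (z.1 ^+ 2 + z.2 ^+ 2)); first by ring.
by rewrite cs1; ring.
Qed.

End planar_rotation.

(** * Bilinearity and positivity of the inner product *)

Section dot_product.
Context (R : realType).

Lemma dotpE n (u v : 'rV[R]_n) : dotp u v = \sum_j u 0 j * v 0 j.
Proof. by rewrite /dotp mxE; apply: eq_bigr => j _; rewrite mxE. Qed.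

Lemma dotpC n (u v : 'rV[R]_n) : dotp u v = dotp v u.
Proof. by rewrite !dotpE; apply: eq_bigr => j _; rewrite mulrC. Qed.

Lemma dotpDl n (u v w : 'rV[R]_n) : dotp (u + v) w = dotp u w + dotp v w.
Proof. by rewrite /dotp mulmxDl mxE. Qed.

Lemma dotpZl n a (u v : 'rV[R]_n) : dotp (a *: u) v = a * dotp u v.
Proof. by rewrite /dotp -scalemxAl mxE. Qed.

Lemma dotpDr n (u v w : 'rV[R]_n) : dotp u (v + w) = dotp u v + dotp u w.
Proof. by rewrite dotpC dotpDl !(dotpC u). Qed.

Lemma dotpZr n a (u v : 'rV[R]_n) : dotp u (a *: v) = a * dotp u v.
Proof. by rewrite dotpC dotpZl dotpC. Qed.

Lemma dotpNl n (u v : 'rV[R]_n) : dotp (- u) v = - dotp u v.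
Proof. by rewrite -scaleN1r dotpZl mulN1r. Qed.

Lemma dotpNr n (u v : 'rV[R]_n) : dotp u (- v) = - dotp u v.
Proof. by rewrite dotpC dotpNl dotpC. Qed.

Lemma dotpBl n (u v w : 'rV[R]_n) : dotp (u - v) w = dotp u w - dotp v w.
Proof. by rewrite dotpDl dotpNl. Qed.

Lemma dotpBr n (u v w : 'rV[R]_n) : dotp u (v - w) = dotp u v - dotp u w.
Proof. by rewrite dotpDr dotpNr. Qed.

Lemma dotp0l n (v : 'rV[R]_n) : dotp 0 v = 0.
Proof. by rewrite -(scale0r 0) dotpZl mul0r. Qed.

Lemma dotp0r n (v : 'rV[R]_n) : dotp v 0 = 0.
Proof. by rewrite dotpC dotp0l. Qed.

Lemma dotp_sumr n I (r : seq I) (P : pred I) (F : I -> 'rV[R]_n) u :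
  dotp u (\sum_(i <- r | P i) F i) = \sum_(i <- r | P i) dotp u (F i).
Proof.
elim/big_rec2: _ => [|i x y _ <-]; first exact: dotp0r.
by rewrite dotpDr.
Qed.

Lemma dotp_suml n I (r : seq I) (P : pred I) (F : I -> 'rV[R]_n) u :
  dotp (\sum_(i <- r | P i) F i) u = \sum_(i <- r | P i) dotp (F i) u.
Proof. by rewrite dotpC dotp_sumr; apply: eq_bigr => i _; rewrite dotpC. Qed.

Lemma dotp_ge0 n (u : 'rV[R]_n) : 0 <= dotp u u.
Proof. by rewrite dotpE; apply: sumr_ge0 => j _; rewrite -expr2 sqr_ge0. Qed.

Lemma dotp_eq0 n (u : 'rV[R]_n) : (dotp u u == 0) = (u == 0).
Proof.
apply/eqP/eqP => [|->]; last exact: dotp0l.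
rewrite dotpE => /eqP; rewrite psumr_eq0 => [/allP u0|j _]; last by rewrite -expr2 sqr_ge0.
apply/rowP => j; rewrite mxE; apply/eqP.
by have := u0 j (mem_index_enum j); rewrite -expr2 sqrf_eq0.
Qed.

Lemma dotp_delta n (u : 'rV[R]_n) j : dotp u (delta_mx 0 j) = u 0 j.
Proof.
rewrite dotpE (bigD1 j)//= big1 ?addr0 => [|i ij]; rewrite mxE ?eqxx ?mulr1//.
by rewrite (negbTE ij) andbF mulr0.
Qed.

Lemma measurable_dotp n (u : 'rV[R]_n) : measurable_fun setT (dotp u).
Proof.
rewrite (_ : dotp u = fun v => \sum_j u 0 j * v 0 j); last by apply/funext => v; exact: dotpE.
apply: measurable_sum => j; apply: measurable_funM => //.
exact: (continuous_measurable_row (@coord_continuous _ 1 n 0 j) (@measurable_id _ _ setT)).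
Qed.

End dot_product.

(** * Symmetries of the volume: blocks, circle rotations, planar rotations *)

Section volume_isometries.
Context (R : realType).
Local Notation leb := (@lebesgue_measure R).

(* Symmetries of the volume, as maps of the ambient space. *)
Definition volume_isometry n (tau : 'rV[R]_n.+1 -> 'rV[R]_n.+1) : Prop :=
  [/\ forall u v, dotp (tau u) (tau v) = dotp u v,
      forall a v, tau (a *: v) = a *: tau v,
      measurable_fun setT tau &
      forall g : 'rV[R]_n.+1 -> \bar R, measurable_fun setT g ->
        (forall v, (0 <= g v)%E) ->
        (\int[@vol R n]_q g (tau (vec q)) = \int[@vol R n]_q g (vec q))%E].

Lemma volume_isometry_comp n (tau1 tau2 : 'rV[R]_n.+1 -> 'rV[R]_n.+1) :
  volume_isometry tau1 -> volume_isometry tau2 -> volume_isometry (tau1 \o tau2).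
Proof.
move=> [d1 h1 m1 i1] [d2 h2 m2 i2]; split => /=.
- by move=> u v; rewrite d1 d2.
- by move=> a v; rewrite h2 h1.
- exact: measurableT_comp.
- move=> g mg g0.
  have := i2 (g \o tau1) (measurableT_comp mg m1) (fun v => g0 _).
  by move=> /= ->; exact: i1.
Qed.

Lemma ge0_integral_volS n (h : sphere R n.+1 -> \bar R) :
  measurable_fun setT h -> (forall x, (0 <= h x)%E) ->
  (\int[@vol R n.+1]_x h x =
  \int[leb]_(t in `[0%R, pi]) ((sin t ^+ n)%:E * \int[@vol R n]_w h (polar t w)))%E.
Proof. exact: ge0_integral_polar. Qed.

Definition block_map n (tau : 'rV[R]_n.+1 -> 'rV[R]_n.+1) (v : 'rV[R]_n.+2) : 'rV[R]_n.+2 :=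
  row_mx (v 0 0)%:M (tau (\row_j v 0 (lift ord0 j))).

Lemma block_map0 n (tau : 'rV[R]_n.+1 -> 'rV[R]_n.+1) v : block_map tau v 0 0 = v 0 0.
Proof. by rewrite mxE; case: splitP => // j _; rewrite (ord1 j) mxE. Qed.

Lemma block_map_lift n (tau : 'rV[R]_n.+1 -> 'rV[R]_n.+1) v j :
  block_map tau v 0 (lift ord0 j) = tau (\row_i v 0 (lift ord0 i)) 0 j.
Proof.
rewrite mxE; case: splitP => [i /esym|i]; first by move=> /= h; have := ltn_ord i; rewrite h.
by rewrite /= /bump /= !add1n => -[ji]; congr (tau _ _ _); exact: val_inj.
Qed.

Lemma rowP_lift n (u v : 'rV[R]_n.+2) : u 0 0 = v 0 0 ->
  (forall j, u 0 (lift ord0 j) = v 0 (lift ord0 j)) -> u = v.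
Proof.
by move=> uv0 uv; apply/rowP => i; case: (unliftP ord0 i) => [j|] ->.
Qed.

(** Polar coordinates split off the first coordinate, so a symmetry one dimension below acts inside
    each slice; its homogeneity lets it commute with the factor sin t. *)
Lemma volume_isometry_block n (tau : 'rV[R]_n.+1 -> 'rV[R]_n.+1) :
  volume_isometry tau -> volume_isometry (block_map tau).
Proof.
move=> [dt ht mt it].
have mc m (j : 'I_m) : measurable_fun setT (fun v : 'rV[R]_m => v 0 j).
  exact: (continuous_measurable_row (@coord_continuous _ 1 m 0 j) (@measurable_id _ _ setT)).
have mb : measurable_fun setT (block_map tau).
  apply: measurable_fun_row => j; case: (unliftP ord0 j) => [i|] ->.
    under eq_fun do rewrite block_map_lift.
    apply: (measurableT_comp (mc _ i)); apply: (measurableT_comp mt).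
    by apply: measurable_fun_row => k; under eq_fun do rewrite mxE; exact: mc.
  by under eq_fun do rewrite block_map0; exact: mc.
split => //.
- move=> u v; rewrite !dotpE [LHS]big_ord_recl [RHS]big_ord_recl !block_map0; congr (_ + _).
  transitivity (dotp (\row_i u 0 (lift ord0 i)) (\row_i v 0 (lift ord0 i))).
    by rewrite -dt dotpE; apply: eq_bigr => j _; rewrite !block_map_lift.
  by rewrite dotpE; apply: eq_bigr => j _; rewrite !mxE.
- move=> a v; apply: rowP_lift => [|j]; first by rewrite block_map0 [LHS]mxE [RHS]mxE block_map0.
  rewrite block_map_lift [RHS]mxE block_map_lift.
  have -> : \row_i (a *: v) 0 (lift ord0 i) = a *: \row_i v 0 (lift ord0 i).
    by apply/rowP => i; rewrite !mxE.
  by rewrite ht mxE.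
- move=> g mg g0 /=.
  have mgv := measurableT_comp mg (@measurable_vec R n.+1).
  have mgb := measurableT_comp mg (measurableT_comp mb (@measurable_vec R n.+1)).
  rewrite (ge0_integral_volS mgb (fun q => g0 _)) (ge0_integral_volS mgv (fun q => g0 _)).
  apply: eq_integral => t _; congr (_ * _)%E.
  pose e (v : 'rV[R]_n.+1) : 'rV[R]_n.+2 := row_mx (cos t)%:M (sin t *: v).
  have me : measurable_fun setT e.
    apply: measurable_fun_row => j; rewrite /e; under eq_fun do rewrite mxE.
    case: (fintype.split (m := 1) j) => i; first exact: measurable_cst.
    by under eq_fun do rewrite mxE; apply: measurable_funM.
  have <- := it (g \o e) (measurableT_comp mg me) (fun v => g0 _).
  apply: eq_integral => w _ /=; congr g; apply: rowP_lift => [|j].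
    by rewrite block_map0 vec_polar0 /e mxE; case: splitP => // i _; rewrite (ord1 i) mxE.
  rewrite block_map_lift (_ : \row_i _ = sin t *: vec w); last first.
    by apply/rowP => i; rewrite mxE vec_polar_lift mxE.
  rewrite ht /e [RHS]mxE; case: splitP => [i /esym|i].
    by move=> /= h; have := ltn_ord i; rewrite h.
  by rewrite /= /bump /= !add1n => -[ji]; congr (_ _ _); exact: val_inj.
Qed.

End volume_isometries.

Section circle.
Context (R : realType).
Local Notation leb := (@lebesgue_measure R).
Local Notation mR := (measurableTypeR R).

Lemma ge0_integral_itv_shift (a b c : R) (h : mR -> \bar R) :
  measurable_fun setT h -> (forall x, (0 <= h x)%E) ->
  (\int[leb]_(x in `]a, b]) h (x + c)%R = \int[leb]_(x in `](a + c)%R, (b + c)%R]) h x)%E.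
Proof.
move=> mh h0; rewrite [LHS]integral_mkcond [RHS]integral_mkcond.
have mp : measurable_fun setT (h \_ `](a + c)%R, (b + c)%R]).
  by apply/(measurable_restrictT _ _).1; [exact: measurable_itv|exact: (measurable_funTS mh)].
rewrite -(ge0_integral_shift c mp); last by move=> x; exact: erestrict_ge0.
apply: eq_integral => x _; rewrite !patchE.
suff -> : (x \in `]a, b]%classic) = ((x + c)%R \in `](a + c)%R, (b + c)%R]%classic) by [].
by apply/idP/idP; rewrite !inE/= !in_itv/= ltrD2r lerD2r.
Qed.

Lemma ge0_integral_itv_opp (a : R) (h : mR -> \bar R) :
  measurable_fun setT h -> (forall x, (0 <= h x)%E) ->
  (\int[leb]_(x in `[0%R, a[) h (- x)%R = \int[leb]_(x in `](- a)%R, 0%R]) h x)%E.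
Proof.
move=> mh h0; rewrite [LHS]integral_mkcond [RHS]integral_mkcond.
have mp : measurable_fun setT (h \_ `](- a)%R, 0%R]).
  by apply/(measurable_restrictT _ _).1; [exact: measurable_itv|exact: (measurable_funTS mh)].
rewrite -(ge0_integral_opp mp); last by move=> x; exact: erestrict_ge0.
apply: eq_integral => x _; rewrite !patchE.
suff -> : (x \in `[0, a[%classic) = ((- x)%R \in `](- a)%R, 0%R]%classic) by [].
by apply/idP/idP; rewrite !inE/= !in_itv/= ltrN2 oppr_le0 andbC.
Qed.

Lemma ge0_integral_itv_split (a b c : R) (h : mR -> \bar R) : a <= b -> b <= c ->
  measurable_fun setT h -> (forall x, (0 <= h x)%E) ->
  (\int[leb]_(x in `]a, c]) h x =
   \int[leb]_(x in `]a, b]) h x + \int[leb]_(x in `]b, c]) h x)%E.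
Proof.
move=> ab bc mh h0.
have -> : `]a, c]%classic = `]a, b] `|` `]b, c] :> set mR.
  apply/seteqP; split => x /=; rewrite !in_itv/=.
    by move=> /andP[-> ->]; rewrite andbT; case: (leP x b); [left|right].
  by case=> /andP[h1 h2]; rewrite ?h1 ?h2 ?(le_trans h2 bc) ?(le_lt_trans ab h1).
rewrite ge0_integral_setU//.
- exact: measurable_funTS.
- rewrite disj_set2E; apply/eqP/seteqP; split => x //= [].
  by rewrite !in_itv/= => /andP[_ xb] /andP[/(le_lt_trans xb)]; rewrite ltxx.
Qed.

(** The translated interval is cut at pi, and the part that sticks out is moved back by one
    period. *)
Lemma ge0_integral_periodic (b : R) (h : mR -> \bar R) : 0 <= b <= pi *+ 2 ->
  measurable_fun setT h -> (forall x, (0 <= h x)%E) ->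
  (forall x, h (x + pi *+ 2) = h x) ->
  (\int[leb]_(x in `](- pi)%R, pi]) h (x + b)%R = \int[leb]_(x in `](- pi)%R, pi]) h x)%E.
Proof.
move=> /andP[b0 b2] mh h0 hp.
rewrite ge0_integral_itv_shift//.
have b2' : - pi + b <= pi by move: b2; rewrite mulr2n; lra.
rewrite (@ge0_integral_itv_split _ pi)//; last by rewrite lerDl.
rewrite [RHS](@ge0_integral_itv_split _ (- pi + b))//; last by rewrite lerDl.
rewrite addeC; congr (_ + _)%E.
have := @ge0_integral_itv_shift (- pi) (- pi + b) (pi *+ 2) h mh h0.
under eq_integral do rewrite hp.
move=> ->; rewrite mulr2n.
have e1 : - pi + (pi + pi) = pi :> R by ring.
have e2 : - pi + b + (pi + pi) = pi + b :> R by ring.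
by rewrite e1 e2.
Qed.

Lemma circle_angle (c s : R) : c ^+ 2 + s ^+ 2 = 1 ->
  exists2 b : R, 0 <= b <= pi *+ 2 & c = cos b /\ s = sin b.
Proof.
move=> cs1.
have s2 : s ^+ 2 = 1 - c ^+ 2 by rewrite -cs1; ring.
have c1 : -1 <= c <= 1.
  by have := sqr_ge0 s; rewrite s2 => ?; apply/andP; split; nra.
have cI : c \in `[-1, 1] by rewrite in_itv.
have a0 := acos_ge0 c1; have api := acos_lepi c1.
have sa : sin (acos c) = `|s| by rewrite sin_acos// -s2 sqrtr_sqr.
have [s0|s0] := leP 0 s.
  exists (acos c); last by rewrite acosK// sa ger0_norm.
  by rewrite a0 mulr2n (le_trans api)// lerDl pi_ge0.
exists (pi *+ 2 - acos c).
  by rewrite subr_ge0 gerBl a0 andbT mulr2n (le_trans api)// lerDl pi_ge0.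
by rewrite cosB sinB cos2pi sin2pi !mul0r addr0 mul1r add0r mul1r acosK// sa ltr0_norm// opprK.
Qed.

End circle.

Section cons_row.
Context (R : realType).

Definition cons_row n (x : R) (v : 'rV[R]_n) : 'rV[R]_n.+1 := row_mx x%:M v.

Lemma cons_row0 n x (v : 'rV[R]_n) : cons_row x v 0 0 = x.
Proof. by rewrite mxE; case: splitP => // j _; rewrite (ord1 j) mxE. Qed.

Lemma cons_row_lift n x (v : 'rV[R]_n) j : cons_row x v 0 (lift ord0 j) = v 0 j.
Proof.
rewrite mxE; case: splitP => [i /esym|i]; first by move=> /= h; have := ltn_ord i; rewrite h.
by rewrite /= /bump /= !add1n => -[ji]; congr (v _ _); exact: val_inj.
Qed.

Lemma vec_polarE n t (w : sphere R n) : vec (polar t w) = cons_row (cos t) (sin t *: vec w).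
Proof. by []. Qed.

Lemma cons_row_scale n a x (v : 'rV[R]_n) : a *: cons_row x v = cons_row (a * x) (a *: v).
Proof.
apply/rowP => i; rewrite [LHS]mxE; case: (unliftP ord0 i) => [j|] ->.
  by rewrite !cons_row_lift mxE.
by rewrite !cons_row0.
Qed.

Lemma dotp_cons_row n x y (u v : 'rV[R]_n) :
  dotp (cons_row x u) (cons_row y v) = x * y + dotp u v.
Proof.
rewrite !dotpE big_ord_recl !cons_row0; congr (_ + _).
by apply: eq_bigr => j _; rewrite !cons_row_lift.
Qed.

Lemma cons_rowP n (v : 'rV[R]_n.+1) : v = cons_row (v 0 0) (\row_j v 0 (lift ord0 j)).
Proof.
apply/rowP => i; case: (unliftP ord0 i) => [j|] ->; last by rewrite cons_row0.
by rewrite cons_row_lift mxE.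
Qed.

Lemma measurable_cons_row d (T : measurableType d) n (f : T -> R) (g : T -> 'rV[R]_n) :
  measurable_fun setT f -> measurable_fun setT g ->
  measurable_fun setT (fun x => cons_row (f x) (g x)).
Proof.
move=> mf mg; apply: measurable_fun_row => i; case: (unliftP ord0 i) => [j|] ->.
  under eq_fun do rewrite cons_row_lift.
  exact: (continuous_measurable_row (@coord_continuous _ 1 n 0 j) mg).
by under eq_fun do rewrite cons_row0.
Qed.

Lemma measurable_coord n (j : 'I_n) : measurable_fun setT (fun v : 'rV[R]_n => v 0 j).
Proof.
exact: (continuous_measurable_row (@coord_continuous _ 1 n 0 j) (@measurable_id _ _ setT)).
Qed.

Definition planar n (c s : R) (v : 'rV[R]_n.+2) : 'rV[R]_n.+2 :=
  cons_row (c * v 0 0 - s * v 0 (lift ord0 ord0))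
    (cons_row (s * v 0 0 + c * v 0 (lift ord0 ord0))
      (\row_(j < n) v 0 (lift ord0 (lift ord0 j)))).

Lemma planar_cons n c s x y (v : 'rV[R]_n) :
  planar c s (cons_row x (cons_row y v)) =
  cons_row (c * x - s * y) (cons_row (s * x + c * y) v).
Proof.
rewrite /planar cons_row0 !cons_row_lift cons_row0; do 2 congr cons_row.
by apply/rowP => j; rewrite mxE !cons_row_lift.
Qed.

Lemma cons_rowP2 n (v : 'rV[R]_n.+2) : exists x y w, v = cons_row x (cons_row y w).
Proof. by rewrite (cons_rowP v) (cons_rowP (\row_j _)); do 3 eexists. Qed.

Lemma dotp_planar n (c s : R) (u v : 'rV[R]_n.+2) : c ^+ 2 + s ^+ 2 = 1 ->
  dotp (planar c s u) (planar c s v) = dotp u v.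
Proof.
have [x [y [w ->]]] := cons_rowP2 u; have [x' [y' [w' ->]]] := cons_rowP2 v => cs1.
rewrite !planar_cons !dotp_cons_row.
transitivity ((c ^+ 2 + s ^+ 2) * (x * x' + y * y') + dotp w w'); first by ring.
by rewrite cs1; ring.
Qed.

Lemma planarZ n c s a (v : 'rV[R]_n.+2) : planar c s (a *: v) = a *: planar c s v.
Proof.
have [x [y [w ->]]] := cons_rowP2 v.
rewrite planar_cons !cons_row_scale planar_cons.
by congr (cons_row _ (cons_row _ _)); ring.
Qed.

Lemma measurable_planar n c s : measurable_fun setT (@planar n c s).
Proof.
apply: measurable_cons_row.
  by apply: measurable_funB; apply: measurable_funM => //; exact: measurable_coord.
apply: measurable_cons_row.
  by apply: measurable_funD; apply: measurable_funM => //; exact: measurable_coord.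
by apply: measurable_fun_row => j; under eq_fun do rewrite mxE; exact: measurable_coord.
Qed.

End cons_row.

Section planar_isometry.
Context (R : realType).
Local Notation leb := (@lebesgue_measure R).
Local Notation mR := (measurableTypeR R).

Lemma ge0_integral_vol0 (h : sphere R 0 -> \bar R) :
  measurable_fun setT h -> (forall x, (0 <= h x)%E) ->
  (\int[@vol R 0]_x h x = h point + h (antipode point))%E.
Proof.
move=> mh h0; rewrite [LHS]ge0_integral_measure_add//.
by rewrite !integral_dirac// !diracT !mul1e.
Qed.

Lemma vec_point0 : vec (point : sphere R 0) = const_mx 1.
Proof. by apply/rowP => j; rewrite !ord1 !mxE. Qed.

Lemma volume_isometry_opp0 : volume_isometry (fun v : 'rV[R]_1 => - v).
Proof.
split.
- by move=> u v; rewrite dotpNl dotpNr opprK.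
- by move=> a v; rewrite scalerN.
- apply: measurable_fun_row => j; under eq_fun do rewrite mxE.
  by apply: measurable_funN; exact: measurable_coord.
- move=> g mg g0.
  have mN : measurable_fun setT (fun v : 'rV[R]_1 => - v).
    apply: measurable_fun_row => j; under eq_fun do rewrite mxE.
    by apply: measurable_funN; exact: measurable_coord.
  rewrite (ge0_integral_vol0 (measurableT_comp (measurableT_comp mg mN) (@measurable_vec R 0)) (fun v => g0 _)).
  rewrite (ge0_integral_vol0 (measurableT_comp mg (@measurable_vec R 0)) (fun v => g0 _)) /=.
  by rewrite addeC; congr (g _ + g _)%E; rewrite opprK.
Qed.

(** The recursive volume of the circle is a sum over two half circles. Glued along the angles of
    ]-pi, pi] it becomes Lebesgue measure, and a rotation becomes a translation of a periodic
    integrand. *)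
Lemma volume_isometry_circle (c s : R) : c ^+ 2 + s ^+ 2 = 1 ->
  volume_isometry (@planar R 0 c s).
Proof.
move=> cs1; split.
- by move=> u v; exact: dotp_planar.
- by move=> a v; exact: planarZ.
- exact: measurable_planar.
- move=> g mg g0.
  pose e (t : R) : 'rV[R]_2 := cons_row (cos t) (cons_row (sin t) 0).
  have me : measurable_fun setT (e : mR -> 'rV[R]_2).
    apply: measurable_cons_row; first by apply: continuous_measurable_fun; exact: continuous_cos.
    apply: measurable_cons_row; last exact: measurable_cst.
    by apply: continuous_measurable_fun; exact: continuous_sin.
  have key (h : 'rV[R]_2 -> \bar R) : measurable_fun setT h -> (forall v, (0 <= h v)%E) ->
      (\int[@vol R 1]_q h (vec q) = \int[leb]_(t in `](- pi)%R, pi]) h (e t))%E.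
    move=> mh h0.
    rewrite (ge0_integral_volS (measurableT_comp mh (@measurable_vec R 1)) (fun v => h0 _)).
    have mhe : measurable_fun setT (h \o e : mR -> _) := measurableT_comp mh me.
    have mheN : measurable_fun setT (fun t : mR => h (e (- t))).
      by apply: (measurableT_comp mhe); exact: oppr_measurable.
    transitivity (\int[leb]_(t in `[0%R, pi]) (h (e t) + h (e (- t)%R)))%E.
      apply: eq_integral => t _; rewrite expr0 mul1e.
      have mhp := measurableT_comp mh (measurableT_comp (@measurable_vec R 1) (measurable_polar1 t)).
      rewrite (ge0_integral_vol0 mhp (fun v => h0 _)) /=.
      congr (h _ + h _)%E; rewrite vec_polarE /e ?cosN ?sinN; congr cons_row;
        by apply/rowP => j; rewrite (ord1 j) cons_row0 !mxE ?mulr1 ?mulrN1.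
    rewrite ge0_integralD//; last 2 first.
      exact: (measurable_funTS mhe).
      exact: (measurable_funTS mheN).
    have pi0 := pi_ge0 R.
    have piN : - pi <= 0 :> R by rewrite oppr_le0.
    rewrite (ge0_integral_itv_split piN pi0 mhe (fun x => h0 _)).
    rewrite -(ge0_integral_itv_opp pi mhe (fun x => h0 _)) addeC; congr (_ + _)%E.
      by rewrite -integral_itv_bndo_bndc//; exact: (measurable_funTS mheN).
    by rewrite -integral_itv_obnd_cbnd//; exact: (measurable_funTS mhe).
  have mgp := measurableT_comp mg (@measurable_planar R 0 c s).
  rewrite (key _ mgp (fun v => g0 _)) (key _ mg g0).
  have [b b2pi [-> ->]] := circle_angle cs1.
  rewrite -(ge0_integral_periodic b2pi (measurableT_comp mg me) (fun x => g0 _)).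
    apply: eq_integral => t _ /=; rewrite /e planar_cons cosD sinD.
    by congr (g (cons_row _ (cons_row _ _))); ring.
  by move=> x /=; rewrite /e (cosD x) (sinD x) cos2pi sin2pi !mulr1 !mulr0 subr0 addr0.
Qed.

(** Two nested polar coordinates describe the first two coordinates z by the bipolar law and the
    others as sqrt (1 - |z|^2) times a point of a sphere two dimensions lower. The rotation moves z
    and preserves |z|. The half turn is excluded, as it is not a product of the three shears. *)
Lemma volume_isometry_planarN1 n (c s : R) : c ^+ 2 + s ^+ 2 = 1 -> c != -1 ->
  volume_isometry (@planar R n.+1 c s).
Proof.
move=> cs1 cN1; split.
- by move=> u v; exact: dotp_planar.
- by move=> a v; exact: planarZ.
- exact: measurable_planar.
- move=> g mg g0.
  pose e (z : mR * mR) (w : sphere R n) : 'rV[R]_n.+3 := cons_row z.1 (cons_row z.2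
     (Num.sqrt (1 - z.1 ^+ 2 - z.2 ^+ 2) *: vec w)).
  have me : measurable_fun setT (fun z : (mR * mR) * sphere R n => e z.1 z.2).
    have m1 : measurable_fun setT (fun z : (mR * mR) * sphere R n => z.1.1).
      exact: (measurableT_comp (@measurable_fst _ _ mR mR) measurable_fst).
    have m2 : measurable_fun setT (fun z : (mR * mR) * sphere R n => z.1.2).
      exact: (measurableT_comp (@measurable_snd _ _ mR mR) measurable_fst).
    do 2 (apply: measurable_cons_row => //).
    apply: measurable_fun_row => j; under eq_fun do rewrite mxE.
    apply: measurable_funM; last exact: (measurableT_comp (measurable_vec_coord j) measurable_snd).
    have mq : measurable_fun setT (@Num.sqrt R : mR -> mR).
      by apply: continuous_measurable_fun; exact: sqrt_continuous.
    apply: (measurableT_comp mq).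
    by do ! apply: measurable_funB => //; apply: measurable_funX.
  pose H (h : 'rV[R]_n.+3 -> \bar R) (z : mR * mR) := (\int[@vol R n]_w h (e z w))%E.
  have H0 h z : (forall v, (0 <= h v)%E) -> (0 <= H h z)%E by move=> h0; exact: integral_ge0.
  have mH h : measurable_fun setT h -> (forall v, (0 <= h v)%E) -> measurable_fun setT (H h).
    move=> mh h0.
    exact: (measurable_fun_fubini_tonelli_F (m2 := @vol R n) _ (measurableT_comp mh me) (fun z => h0 _)).
  have key h : measurable_fun setT h -> (forall v, (0 <= h v)%E) ->
      (\int[@vol R n.+2]_q h (vec q) =
       \int[leb]_(t in `[0%R, pi]) ((sin t ^+ n.+1)%:E *
         \int[leb]_(r in `[0%R, pi]) ((sin r ^+ n)%:E * H h (cos t, sin t * cos r)%R)))%E.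
    move=> mh h0.
    rewrite (ge0_integral_volS (measurableT_comp mh (@measurable_vec R n.+2)) (fun v => h0 _)).
    apply: eq_integral => t /set_mem/=; rewrite in_itv/= => tI; congr (_ * _)%E.
    have mhp := measurableT_comp mh (measurableT_comp (@measurable_vec R n.+2) (measurable_polar1 t)).
    rewrite (ge0_integral_volS mhp (fun v => h0 _)).
    apply: eq_integral => r /set_mem/=; rewrite in_itv/= => rI; congr (_ * _)%E.
    apply: eq_integral => w _ /=; congr h.
    rewrite vec_polarE vec_polarE cons_row_scale /e /= scalerA; congr (cons_row _ (cons_row _ (_ *: _))).
    rewrite (_ : 1 - _ - _ = (sin t * sin r) ^+ 2).
      by rewrite sqrtr_sqr ger0_norm// mulr_ge0// sin_ge0_pi.
    by rewrite !exprMn !sin2cos2; ring.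
  have mgp := measurableT_comp mg (@measurable_planar R n.+1 c s).
  rewrite (key _ mgp (fun v => g0 _)) (key _ mg g0).
  have -> : H (g \o planar c s) = (fun z => H g (c * z.1 - s * z.2, s * z.1 + c * z.2)).
    apply/funext => z; apply: eq_integral => w _ /=; rewrite /e planar_cons /=.
    congr (g (cons_row _ (cons_row _ (Num.sqrt _ *: _)))).
    transitivity (1 - (c ^+ 2 + s ^+ 2) * (z.1 ^+ 2 + z.2 ^+ 2)); first by rewrite cs1; ring.
    by ring.
  exact: (ge0_integral_bipolar_rotation n cs1 cN1 (mH g mg g0) (fun z => H0 g z g0)).
Qed.

Lemma volume_isometry_planar n (c s : R) : c ^+ 2 + s ^+ 2 = 1 ->
  volume_isometry (@planar R n c s).
Proof.
case: n => [|n] cs1; first exact: volume_isometry_circle.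
have [c1|] := eqVneq c (-1); last exact: volume_isometry_planarN1.
(* The half turn missed by the shears is the square of a quarter turn. *)
have h : volume_isometry (@planar R n.+1 0 1).
  apply: volume_isometry_planarN1; first by rewrite expr0n expr1n add0r.
  by rewrite eq_sym oppr_eq0 oner_eq0.
have s0 : s = 0.
  by apply/eqP; rewrite -sqrf_eq0; apply/eqP; move: cs1; rewrite c1 sqrrN expr1n; lra.
rewrite (_ : planar c s = @planar R n.+1 0 1 \o @planar R n.+1 0 1); first exact: volume_isometry_comp.
apply/funext => v; have [x [y [w ->]]] := cons_rowP2 v.
by rewrite /= !planar_cons c1 s0; congr (cons_row _ (cons_row _ _)); ring.
Qed.

(** By induction a block symmetry turns the last coordinates of a onto their first axis; a planar
    rotation then brings the result to the pole. *)
Lemma volume_isometry_transitive n (a : 'rV[R]_n.+1) : dotp a a = 1 ->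
  exists2 tau, volume_isometry tau & tau a = delta_mx 0 0.
Proof.
elim: n a => [|n IH] a a1.
  have : (a 0 0) ^+ 2 == 1 by move: a1; rewrite dotpE big_ord1 => /eqP; rewrite expr2.
  rewrite sqrf_eq1 => /orP[] /eqP h.
    exists id; last by apply/rowP => j; rewrite !ord1 h mxE eqxx.
    by split => //; exact: measurable_id.
  exists (fun v => - v); first exact: volume_isometry_opp0.
  by apply/rowP => j; rewrite !ord1 mxE h opprK mxE eqxx.
rewrite (cons_rowP a) in a1 *.
set c := a 0 0 in a1 *; set v := \row_j _ in a1 *.
rewrite dotp_cons_row in a1.
pose s := Num.sqrt (dotp v v).
have ss : s ^+ 2 = dotp v v by rewrite sqr_sqrtr// dotp_ge0.
have [w w1 vE] : exists2 w, dotp w w = 1 & v = s *: w.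
  have [s0|s0] := eqVneq s 0.
    exists (delta_mx 0 0); first by rewrite dotp_delta mxE eqxx.
    by rewrite s0 scale0r; apply/eqP; rewrite -dotp_eq0 -ss s0 expr0n.
  exists (s^-1 *: v); last by rewrite scalerA divff// scale1r.
  by rewrite dotpZl dotpZr -ss mulrA -expr2 exprVn mulVf// expf_neq0.
have [tau [dt ht mt it] tw] := IH w w1.
have cs1 : c ^+ 2 + (- s) ^+ 2 = 1 by rewrite sqrrN ss -a1 expr2.
exists (planar c (- s) \o block_map tau).
  by apply: volume_isometry_comp; [exact: volume_isometry_planar|exact: volume_isometry_block].
rewrite /=; have -> : block_map tau (cons_row c v) = cons_row c (s *: delta_mx 0 0).
  rewrite /block_map cons_row0 -/(cons_row _ _); congr cons_row.
  rewrite (_ : \row_j _ = v) ?vE ?ht ?tw//.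
  by apply/rowP => j; rewrite mxE cons_row_lift.
have -> : delta_mx 0 0 = cons_row 1 0 :> 'rV[R]_n.+1.
  apply/rowP => i; case: (unliftP ord0 i) => [j|] ->.
    by rewrite cons_row_lift !mxE.
  by rewrite cons_row0 mxE eqxx.
rewrite cons_row_scale planar_cons scaler0 mulr1 -[LHS]/(cons_row _ (cons_row _ _)).
have -> : delta_mx 0 0 = cons_row 1 (cons_row 0 0) :> 'rV[R]_n.+2.
  apply/rowP => i; case: (unliftP ord0 i) => [j|] ->; last by rewrite cons_row0 mxE eqxx.
  rewrite cons_row_lift; case: (unliftP ord0 j) => [k|] ->.
    by rewrite cons_row_lift !mxE.
  by rewrite cons_row0 mxE.
congr (cons_row _ (cons_row _ _)); last by ring.
by rewrite -cs1; ring.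
Qed.

End planar_isometry.

(** * Joint law of two orthogonal components under the volume *)

Section volume_laws.
Context (R : realType).
Local Notation leb := (@lebesgue_measure R).
Local Notation mR := (measurableTypeR R).

Lemma measurable_dotp_vec n (u : 'rV[R]_n.+1) :
  measurable_fun setT (fun q : sphere R n => dotp u (vec q) : mR).
Proof. exact: (measurableT_comp (measurable_dotp u) (@measurable_vec R n)). Qed.

Lemma dotp_delta_cons_row n x (v : 'rV[R]_n) : dotp (delta_mx 0 0) (cons_row x v) = x.
Proof. by rewrite dotpC dotp_delta cons_row0. Qed.

(** One symmetry brings p to the pole; then e lies in the equator, and a symmetry of the equator
    brings it to the first axis. The right-hand side therefore depends on neither p nor e, which is
    the rotational symmetry used later. *)
Lemma ge0_integral_vol_pair n (p e : 'rV[R]_n.+2) (G : mR * mR -> \bar R) :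
  dotp p p = 1 -> dotp e e = 1 -> dotp p e = 0 ->
  measurable_fun setT G -> (forall z, (0 <= G z)%E) ->
  (\int[@vol R n.+1]_q G (dotp p (vec q), dotp e (vec q)) =
   \int[leb]_(t in `[0%R, pi]) ((sin t ^+ n)%:E *
     \int[@vol R n]_w G (cos t, sin t * vec w 0 0)%R))%E.
Proof.
move=> pp ee pe mG G0.
have mdd m (u v : 'rV[R]_m) : measurable_fun setT (fun x : 'rV[R]_m => (dotp u x, dotp v x) : mR * mR).
  by apply: measurable_fun_pair; exact: measurable_dotp.
have [tau [dt ht mt it] tp] := volume_isometry_transitive pp.
have [x [e' te]] : exists x e', tau e = cons_row x e' by rewrite (cons_rowP (tau e)); do 2 eexists.
have x0 : x = 0 by rewrite -(dotp_delta_cons_row x e') -te -tp dt.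
have e1 : dotp e' e' = 1.
  by rewrite -ee -dt te dotp_cons_row x0 mul0r add0r.
have [tau' [dt' ht' mt' it'] te'] := volume_isometry_transitive e1.
pose g v := G (dotp (tau p) v, dotp (tau e) v).
have mg : measurable_fun setT g by exact: (measurableT_comp mG (mdd _ _ _)).
transitivity (\int[@vol R n.+1]_q g (vec q))%E.
  by rewrite -(it g mg (fun v => G0 _)); apply: eq_integral => q _; rewrite /g !dt.
rewrite (ge0_integral_volS (measurableT_comp mg (@measurable_vec R n.+1)) (fun v => G0 _)).
apply: eq_integral => t _; congr (_ * _)%E.
pose g' v := G (cos t, sin t * dotp (tau' e') v).
have mg' : measurable_fun setT g'.
  apply: (measurableT_comp mG); apply: measurable_fun_pair => //.
  by apply: measurable_funM => //; exact: measurable_dotp.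
transitivity (\int[@vol R n]_w g' (tau' (vec w)))%E.
  apply: eq_integral => w _; rewrite /g /g' /= vec_polarE tp te x0 dotp_delta_cons_row.
  by rewrite dotp_cons_row mul0r add0r dotpZr dt'.
rewrite (it' g' mg' (fun v => G0 _)); apply: eq_integral => w _.
by rewrite /g' te' dotpC dotp_delta.
Qed.

Lemma vol_setT n : vol R n setT = (sphere_volume R n)%:E.
Proof. by rewrite /sphere_volume volE fineK// fin_num_measure. Qed.

(** All coordinates have the same second moment by symmetry, and their squares add up to 1. *)
Lemma integral_vol_coord2 n :
  (\int[@vol R n]_w ((vec w 0 0) ^+ 2)%:E = (n.+1%:R^-1 * sphere_volume R n)%:E)%E.
Proof.
have mc j : measurable_fun setT (fun w : sphere R n => ((vec w 0 j) ^+ 2)%:E).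
  by apply/measurable_EFinP; apply: measurable_funX; exact: measurable_vec_coord.
have c0 j (w : sphere R n) : (0 <= ((vec w 0 j) ^+ 2)%:E)%E by rewrite lee_fin sqr_ge0.
have cE j : (\int[@vol R n]_w ((vec w 0 j) ^+ 2)%:E = \int[@vol R n]_w ((vec w 0 0) ^+ 2)%:E)%E.
  have d1 : dotp (delta_mx 0 j) (delta_mx 0 j) = 1 :> R by rewrite dotp_delta mxE !eqxx.
  have [tau [dt ht mt it] tj] := volume_isometry_transitive d1.
  pose g (v : 'rV[R]_n.+1) := ((v 0 0) ^+ 2)%:E.
  have mg : measurable_fun setT g.
    by apply/measurable_EFinP; apply: measurable_funX; exact: measurable_coord.
  rewrite -(it g mg) => [|v]; last by rewrite lee_fin sqr_ge0.
  by apply: eq_integral => w _; rewrite /g -!dotp_delta -tj dt.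
have : (\sum_(j < n.+1) \int[@vol R n]_w ((vec w 0 j) ^+ 2)%:E = (sphere_volume R n)%:E)%E.
  rewrite -ge0_integral_sum// -vol_setT -[RHS]mul1e -integral_cst//.
  apply: eq_integral => w _; rewrite sumEFin /=; congr EFin.
  by rewrite -(dotp_vec w) dotpE; apply: eq_bigr => j _; rewrite expr2.
under eq_bigr do rewrite cE.
have f0 : (\int[@vol R n]_w ((vec w 0 0) ^+ 2)%:E)%E \is a fin_num.
  rewrite ge0_fin_numE ?integral_ge0//.
  apply: (@le_lt_trans _ _ (\int[@vol R n]_w 1)%E); last first.
    by rewrite integral_cst// mul1e ltey_eq fin_num_measure.
  apply: ge0_le_integral => // w _; rewrite lee_fin -(dotp_vec w) dotpE (bigD1 0)//= -expr2.
  by rewrite lerDl sumr_ge0// => j _; rewrite -expr2 sqr_ge0.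
rewrite -(fineK f0) sumEFin sumr_const card_ord => -[h].
by rewrite -h -[X in _ * X]mulr_natl mulrA mulVf ?mul1r// pnatr_eq0.
Qed.

End volume_laws.

(** * Trigonometric inequalities and the hinge comparison *)

Section trigonometric_inequalities.
Context (R : realType).
Implicit Types x y z t c : R.

Lemma derive_ge0_le (f df : R -> R) a b : a <= b ->
  (forall x, is_derive x (1 : R) f (df x)) ->
  (forall x, a <= x <= b -> 0 <= df x) -> f a <= f b.
Proof.
move=> ab fdf df0.
have cf : {within `[a, b], continuous f}.
  apply: continuous_subspaceT => x; apply: differentiable_continuous.
  by apply/derivable1_diffP; have [] := fdf x.
have [c + h] := @MVT_segment R f df a b ab (fun x _ => fdf x) cf.
rewrite in_itv /= => cab; rewrite -subr_ge0 h mulr_ge0 ?subr_ge0//.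
exact: df0.
Qed.

Lemma derive_le0_ge (f df : R -> R) a b : a <= b ->
  (forall x, is_derive x (1 : R) f (df x)) ->
  (forall x, a <= x <= b -> df x <= 0) -> f b <= f a.
Proof.
move=> ab fdf df0.
have dN x : is_derive x (1 : R) (fun x => - f x) (- df x) by exact: is_deriveN.
have := @derive_ge0_le (fun x => - f x) (fun x => - df x) a b ab dN.
by rewrite lerN2; apply => x xab; rewrite oppr_ge0; exact: df0.
Qed.

Lemma mul_cos_le_sin x : 0 <= x <= pi -> x * cos x <= sin x.
Proof.
move=> /andP[x0 xpi].
have dF y : is_derive y (1 : R) (fun x => sin x - x * cos x) (y * sin y).
  by apply: is_derive_eq; rewrite /GRing.scale /=; ring.
have := @derive_ge0_le (fun x => sin x - x * cos x) (fun x => x * sin x) 0 x x0 dF.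
rewrite sin0 mul0r subr0 subr_ge0; apply => y /andP[y0 yx].
by rewrite mulr_ge0// sin_ge0_pi// y0 (le_trans yx).
Qed.

Lemma le_cos x y : 0 <= x -> x <= y -> y <= pi -> cos y <= cos x.
Proof.
move=> x0 xy ypi.
apply: (@derive_le0_ge cos (fun z => - sin z)) => // z /andP[xz zy].
by rewrite oppr_le0 sin_ge0_pi// (le_trans x0 xz) (le_trans zy ypi).
Qed.

Lemma mul_sin_le x y : 0 <= x -> x <= y -> y <= pi -> x * sin y <= y * sin x.
Proof.
move=> x0 xy ypi; rewrite -subr_ge0.
apply: le_trans (_ : x * sin x - x * sin x <= _); first by rewrite subrr.
have dF z : is_derive z (1 : R) (fun z => z * sin x - x * sin z) (sin x - x * cos z).
  by apply: is_derive_eq; rewrite /GRing.scale /=; ring.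
apply: (@derive_ge0_le (fun z => z * sin x - x * sin z) _ _ _ xy dF) => z.
move=> /andP[xz zy]; rewrite subr_ge0.
apply: le_trans (mul_cos_le_sin _); last by rewrite x0 (le_trans xy).
by rewrite ler_wpM2l// le_cos// (le_trans zy).
Qed.

(* The tangent line inequality for the convex function [acos u ^ 2 / 2] at
   [u = cos t], with [u' = cos y]. *)
Lemma sqr_angle_tangent t y : 0 <= t <= pi -> 0 <= y <= pi ->
  t ^+ 2 / 2 * sin t + t * cos t <= y ^+ 2 / 2 * sin t + t * cos y.
Proof.
move=> /andP[t0 tpi] /andP[y0 ypi].
have dF z : is_derive z (1 : R) (fun z => z ^+ 2 / 2 * sin t + t * cos z)
    (z * sin t - t * sin z).
  by apply: is_derive_eq; rewrite /GRing.scale /=; field.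
have [ty|yt] := leP t y.
  apply: (@derive_ge0_le (fun z => z ^+ 2 / 2 * sin t + t * cos z) _ _ _ ty dF).
  by move=> z /andP[tz zy]; rewrite subr_ge0 mul_sin_le// (le_trans zy).
apply: (@derive_le0_ge (fun z => z ^+ 2 / 2 * sin t + t * cos z) _ _ _ (ltW yt) dF).
by move=> z /andP[yz zt]; rewrite subr_le0 mul_sin_le// (le_trans y0).
Qed.

Lemma sin_le x : 0 <= x -> sin x <= x.
Proof.
move=> x0; rewrite -subr_ge0.
have dF y : is_derive y (1 : R) (fun x => x - sin x) (1 - cos y) by exact: is_deriveB.
have := @derive_ge0_le (fun x => x - sin x) (fun x => 1 - cos x) 0 x x0 dF.
by rewrite sin0 subrr; apply => y; rewrite subr_ge0 cos_le1.
Qed.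

Lemma oneBcos_le x : 0 <= x -> 1 - cos x <= x ^+ 2 / 2.
Proof.
move=> x0; rewrite -subr_ge0.
have dF y : is_derive y (1 : R) (fun x => x ^+ 2 / 2 - (1 - cos x)) (y - sin y).
  by apply: is_derive_eq; rewrite /GRing.scale /=; field.
have := @derive_ge0_le (fun x => x ^+ 2 / 2 - (1 - cos x)) (fun x => x - sin x) 0 x x0 dF.
rewrite cos0 subrr subr0 expr0n mul0r; apply => y.
by move=> /andP[y0 _]; rewrite subr_ge0 sin_le.
Qed.

Lemma subr_sin_le x : 0 <= x <= pi -> x - sin x <= x ^+ 2.
Proof.
move=> xI; have /andP[x0 xpi] := xI.
have [x1|x1] := leP 1 x.
  by have := sin_ge0_pi xI; nra.
have := mul_cos_le_sin xI; have := oneBcos_le x0; nra.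
Qed.

Lemma chord_le_angle c : 0 <= c -> 2 - 2 * cos c <= c ^+ 2.
Proof. by move=> c0; have := oneBcos_le c0; lra. Qed.

Lemma angle_le_chord c : 0 <= c <= pi -> c ^+ 2 <= 4 * (2 - 2 * cos c).
Proof.
move=> /andP[c0 cpi].
have [h ch] : exists h, c = h + h by exists (c / 2); field.
have h0 : 0 <= h by lra.
have hpi : h <= pi / 2 by lra.
have pi0 := pi_ge0 R.
have hs : h <= pi / 2 * sin h.
  by have := mul_sin_le h0 hpi; rewrite sin_pihalf mulr1; apply; lra.
have p2 := pihalf_lt2 R.
have s0 : 0 <= sin h by apply: sin_ge0_pi; lra.
have -> : cos c = 1 - 2 * sin h ^+ 2 by rewrite ch cosD -!expr2 cos2sin2; ring.
have h2 : h <= 2 * sin h by nra.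
by rewrite ch; nra.
Qed.

Lemma pi_lt4 : pi < 4 :> R.
Proof. by have := pihalf_lt2 R; lra. Qed.

(* Convexity of [acos u ^ 2 / 2] on the segment with endpoints
   [cos (t - c)] and [cos (t + c)]. *)
Lemma hinge t c z y : 0 <= t <= pi -> 0 <= c <= pi -> -1 <= z <= 1 ->
  0 <= y <= pi -> cos y = cos t * cos c + sin t * sin c * z ->
  y ^+ 2 <= t ^+ 2 + c ^+ 2 - 2 * (t * c * z).
Proof.
move=> tI cI /andP[z1 z2] yI cy.
have s_ge0 (a : R) : 0 <= a <= pi -> 0 <= sin a by exact: sin_ge0_pi.
have /andP[t0 tpi] := tI; have /andP[c0 cpi] := cI; have /andP[y0 ypi] := yI.
pose a : R := `|t - c|.
have aI : 0 <= a <= pi by rewrite /a normr_ge0 ler_norml; apply/andP; split; lra.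
have ca : cos a = cos t * cos c + sin t * sin c by rewrite /a cos_norm cosB.
have a2 : a ^+ 2 = (t - c) ^+ 2 by rewrite real_normK// num_real.
(* If t + c exceeds pi, the angle 2 pi - (t + c) has the same cosine, lies in [0, pi] and is no
   larger. *)
have [b [bI cb bt]] : exists b : R, [/\ 0 <= b <= pi, cos b = cos t * cos c - sin t * sin c &
    b ^+ 2 <= (t + c) ^+ 2].
  have [tc|tc] := leP (t + c) pi.
    by exists (t + c); rewrite -cosD tc addr_ge0.
  exists (pi *+ 2 - (t + c)); split.
  - by rewrite mulr2n; apply/andP; split; lra.
  - by rewrite cosB cos2pi sin2pi mul0r addr0 mul1r cosD.
  - have h1 : 0 <= pi *+ 2 - (t + c) by rewrite mulr2n; lra.
    have h2 : pi *+ 2 - (t + c) <= t + c by rewrite mulr2n; lra.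
    by rewrite !expr2 ler_pM.
have ta := sqr_angle_tangent yI aI; have tb := sqr_angle_tangent yI bI.
have key : y ^+ 2 / 2 * sin y <= ((1 + z) / 2 * (a ^+ 2 / 2) + (1 - z) / 2 * (b ^+ 2 / 2)) * sin y.
  have e : cos y = (1 + z) / 2 * cos a + (1 - z) / 2 * cos b by rewrite cy ca cb; field.
  by have e' := congr1 (fun u => y * u) e; nra.
have fin : y ^+ 2 <= (1 + z) / 2 * a ^+ 2 + (1 - z) / 2 * b ^+ 2 ->
    y ^+ 2 <= t ^+ 2 + c ^+ 2 - 2 * (t * c * z).
  move=> h; apply: (le_trans h); rewrite a2.
  have := ler_wpM2l (_ : 0 <= (1 - z) / 2) bt; rewrite divr_ge0 ?subr_ge0// => /(_ isT).
  by nra.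
apply: fin.
have sy0 := s_ge0 _ yI.
(* The tangent inequality carries a factor sin y and is void when it vanishes. The case y = 0 is
   direct, and y = pi forces each endpoint of nonzero weight to equal pi. *)
have [sy|sy] := eqVneq (sin y) 0; last first.
  have syp : 0 < sin y by rewrite lt_neqAle eq_sym sy.
  by move: key; rewrite ler_pM2r//; lra.
have [->|y_neq0] := eqVneq y 0.
  have := mulr_ge0 (mulr_ge0 t0 c0) (_ : 0 <= 1 - z); rewrite subr_ge0 => /(_ z2).
  by rewrite expr0n /=; have := sqr_ge0 (t - c); nra.
have ypi' : y = pi.
  apply/eqP; rewrite eq_le ypi leNgt; apply/negP => yp.
  have : 0 < sin y by apply: sin_gt0_pi; rewrite yp lt_neqAle eq_sym y_neq0 y0.
  by rewrite sy ltxx.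
have injpi (u : R) : 0 <= u <= pi -> cos u = -1 -> u = y.
  move=> uI cu; rewrite ypi'; apply: cos_inj; rewrite ?in_itv//= ?pi_ge0 ?lexx//.
  by rewrite cospi.
have e : cos y = (1 + z) / 2 * cos a + (1 - z) / 2 * cos b by rewrite cy ca cb; field.
move: e; rewrite ypi' cospi => e.
have caN1 := cos_geN1 a; have cbN1 := cos_geN1 b.
have ea : (1 + z) * (1 + cos a) = 0 by nra.
have eb : (1 - z) * (1 + cos b) = 0 by nra.
have da : (1 + z) * a ^+ 2 = (1 + z) * y ^+ 2.
  move/eqP: ea; rewrite mulf_eq0 => /orP[/eqP ->|h]; first by rewrite !mul0r.
  by rewrite (injpi a)//; apply/eqP; rewrite -subr_eq0 opprK addrC.
have db : (1 - z) * b ^+ 2 = (1 - z) * y ^+ 2.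
  move/eqP: eb; rewrite mulf_eq0 => /orP[/eqP ->|h]; first by rewrite !mul0r.
  by rewrite (injpi b)//; apply/eqP; rewrite -subr_eq0 opprK addrC.
by rewrite -ypi'; lra.
Qed.

End trigonometric_inequalities.

(** * The Euclidean norm *)

Section euclidean_norm.
Context (R : realType) (n : nat).
Implicit Types u v w : 'rV[R]_n.

Lemma enorm_ge0 u : 0 <= enorm u.
Proof. exact: sqrtr_ge0. Qed.

Lemma sqr_enorm u : enorm u ^+ 2 = dotp u u.
Proof. by rewrite sqr_sqrtr// dotp_ge0. Qed.

Lemma enorm0 : enorm (0 : 'rV[R]_n) = 0.
Proof. by rewrite /enorm dotp0l sqrtr0. Qed.

Lemma enorm_eq0 u : (enorm u == 0) = (u == 0).
Proof. by rewrite -dotp_eq0 -sqr_enorm sqrf_eq0. Qed.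

Lemma enormZ a u : enorm (a *: u) = `|a| * enorm u.
Proof.
by rewrite /enorm dotpZl dotpZr mulrA -expr2 sqrtrM ?sqr_ge0// sqrtr_sqr.
Qed.

Lemma enormN u : enorm (- u) = enorm u.
Proof. by rewrite -scaleN1r enormZ normrN1 mul1r. Qed.

Lemma dotp_le u v : dotp u v <= enorm u * enorm v.
Proof.
have [u0|u0] := eqVneq (enorm u) 0.
  by move/eqP: u0; rewrite enorm_eq0 => /eqP ->; rewrite dotp0l enorm0 mul0r.
have [v0|v0] := eqVneq (enorm v) 0.
  by move/eqP: v0; rewrite enorm_eq0 => /eqP ->; rewrite dotp0r enorm0 mulr0.
have up : 0 < enorm u by rewrite lt_neqAle eq_sym u0 enorm_ge0.
have vp : 0 < enorm v by rewrite lt_neqAle eq_sym v0 enorm_ge0.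
have := dotp_ge0 (enorm v *: u - enorm u *: v).
rewrite !(dotpBl, dotpBr, dotpZl, dotpZr) -!sqr_enorm (dotpC v u).
have := mulr_gt0 up vp; set a := enorm u; set b := enorm v; set d := dotp u v => ab h.
rewrite -(ler_pM2l ab); have : 0 <= 2 * (a * b * (a * b) - a * b * d) by lra.
by rewrite pmulr_rge0// subr_ge0.
Qed.

Lemma normr_dotp_le u v : `|dotp u v| <= enorm u * enorm v.
Proof.
by rewrite ler_norml dotp_le andbT lerNl -dotpNl (le_trans (dotp_le _ _))// enormN.
Qed.

Lemma enormD u v : enorm (u + v) <= enorm u + enorm v.
Proof.
rewrite -ler_sqr ?nnegrE ?addr_ge0 ?enorm_ge0// sqr_enorm dotpDl !dotpDr (dotpC v u) sqrrD.
by rewrite -!sqr_enorm; have := dotp_le u v; rewrite mulr2n; lra.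
Qed.

Lemma enormB u v : enorm (u - v) <= enorm u + enorm v.
Proof. by rewrite (le_trans (enormD _ _))// enormN. Qed.

Lemma enorm_distC u v : enorm (u - v) = enorm (v - u).
Proof. by rewrite -enormN opprB. Qed.

Lemma enorm_triangle w u v : enorm (u - v) <= enorm (u - w) + enorm (w - v).
Proof. by rewrite -(subrKA w) enormD. Qed.

Lemma coord_le_enorm u j : `|u 0 j| <= enorm u.
Proof.
rewrite -ler_sqr ?nnegrE ?normr_ge0 ?enorm_ge0// sqr_enorm real_normK ?num_real//.
by rewrite dotpE (bigD1 j)//= -expr2 lerDl sumr_ge0// => i _; rewrite -expr2 sqr_ge0.
Qed.

End euclidean_norm.

(** * Logarithm, semiconcavity of the squared distance, and bounds on [dev] *)

Section sphere_geometry.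
Context (R : realType) (n : nat).
Implicit Types p q x y : sphere R n.

Lemma enorm_vec x : enorm (vec x) = 1.
Proof. by rewrite /enorm dotp_vec sqrtr1. Qed.

Lemma dotp_vec_itv x y : -1 <= dotp (vec x) (vec y) <= 1.
Proof. by rewrite -ler_norml (le_trans (normr_dotp_le _ _))// !enorm_vec mulr1. Qed.

Lemma sdistC x y : sdist x y = sdist y x.
Proof. by rewrite /sdist dotpC. Qed.

Lemma sdist_itv x y : 0 <= sdist x y <= pi.
Proof. by rewrite acos_ge0 ?acos_lepi// dotp_vec_itv. Qed.

Lemma cos_sdist x y : cos (sdist x y) = dotp (vec x) (vec y).
Proof. by rewrite acosK// in_itv/= dotp_vec_itv. Qed.

Lemma sin_sdist_ge0 x y : 0 <= sin (sdist x y).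
Proof. by rewrite sin_ge0_pi// sdist_itv. Qed.

Definition sphere_perp x y : 'rV[R]_n.+1 := vec y - cos (sdist x y) *: vec x.

Lemma dotp_sphere_perpl x y : dotp (vec x) (sphere_perp x y) = 0.
Proof. by rewrite dotpBr dotpZr dotp_vec cos_sdist mulr1 subrr. Qed.

Lemma dotp_sphere_perp x y q :
  dotp (sphere_perp x y) (sphere_perp x q) =
  dotp (vec y) (vec q) - cos (sdist x y) * cos (sdist x q).
Proof.
rewrite dotpBl dotpZl dotp_sphere_perpl mulr0 subr0 dotpBr dotpZr.
by rewrite (dotpC (vec y) (vec x)) -(cos_sdist x y) mulrC.
Qed.

Lemma enorm_sphere_perp x y : enorm (sphere_perp x y) = sin (sdist x y).
Proof.
rewrite /enorm dotp_sphere_perp dotp_vec -expr2 -sin2cos2 sqrtr_sqr ger0_norm//.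
exact: sin_sdist_ge0.
Qed.

Lemma sphere_exp_dotp p v : dotp (vec p) v = 0 -> dotp (vec p) (sphere_exp p v) = cos (enorm v).
Proof. by move=> pv; rewrite dotpDr !dotpZr pv mulr0 addr0 dotp_vec mulr1. Qed.

(* The formula holds at [q = p] and at the antipode too, thanks to [x / 0 = 0]. *)
Lemma sphere_logE p q :
  sphere_log p q = (sdist p q / sin (sdist p q)) *: sphere_perp p q.
Proof.
set t := sdist p q; rewrite /sphere_log.
set A := [set v | _].
have uniqA v : A v -> v = (t / sin t) *: sphere_perp p q.
  move=> [tv vpi ev]; have cv : cos (enorm v) = cos t.
    by rewrite -(sphere_exp_dotp tv) ev cos_sdist.
  have evt : enorm v = t.
    apply: cos_inj => //; rewrite in_itv/= ?sdist_itv//.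
    by rewrite enorm_ge0 ltW.
  have [t0|t0] := eqVneq t 0.
    rewrite t0 mul0r scale0r; apply/eqP; rewrite -enorm_eq0 evt t0 eqxx//.
  have st : 0 < sin t.
    apply: sin_gt0_pi; rewrite -evt vpi andbT evt lt_neqAle eq_sym t0.
    by case/andP: (sdist_itv p q).
  rewrite /sphere_perp -ev /sphere_exp evt addrAC subrr add0r scalerA.
  by rewrite mulrA divfK ?gt_eqF// divff// scale1r.
case: xgetP => [v _ Av|AN]; first exact: uniqA.
have [st0|st0] := eqVneq (sin t) 0; first by rewrite st0 invr0 mulr0 scale0r.
have /andP[t_ge0 t_pi] := sdist_itv p q.
have st : 0 < sin t by rewrite lt_neqAle eq_sym st0 sin_sdist_ge0.
have t0 : t != 0 by apply: contra st0 => /eqP ->; rewrite sin0.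
have evt : enorm ((t / sin t) *: sphere_perp p q) = t.
  by rewrite enormZ enorm_sphere_perp ger0_norm ?divfK// divr_ge0// ltW.
exfalso; apply: (AN ((t / sin t) *: sphere_perp p q)); split.
- by rewrite /tangent /= dotpZr dotp_sphere_perpl mulr0.
- rewrite evt lt_neqAle t_pi andbT; apply: contra st0 => /eqP ->.
  by rewrite sinpi.
- rewrite /sphere_exp evt scalerA mulrA divfK// divff// scale1r.
  by rewrite addrC subrK.
Qed.

Definition rho x q : R := 2^-1 * sdist q x ^+ 2.

Lemma dotp_sphere_log x y q :
  dotp (vec y) (sphere_log x q) =
  sdist x q / sin (sdist x q) * dotp (sphere_perp x y) (sphere_perp x q).
Proof.
rewrite sphere_logE dotpZr; congr (_ * _).
by rewrite [in RHS]dotpBl dotpZl dotp_sphere_perpl mulr0 subr0.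
Qed.

Lemma dotp_base_sphere_log x q : dotp (vec x) (sphere_log x q) = 0.
Proof. by rewrite sphere_logE dotpZr dotp_sphere_perpl mulr0. Qed.

(** Here [z] is the cosine of the angle at x between the directions of y and q: the second clause is
    the spherical law of cosines and the last one the comparison [hinge]. Division by zero makes z
    equal to 0 when a direction is undefined. *)
Lemma hinge_sphere x y q : exists z, [/\ -1 <= z <= 1,
  cos (sdist y q) = cos (sdist x q) * cos (sdist x y) +
    sin (sdist x q) * sin (sdist x y) * z,
  dotp (vec y) (sphere_log x q) = sdist x q * sin (sdist x y) * z &
  sdist y q ^+ 2 <= sdist x q ^+ 2 + sdist x y ^+ 2 -
    2 * (sdist x q * sdist x y * z)].
Proof.
set t := sdist x q; set c := sdist x y.
pose d := dotp (sphere_perp x y) (sphere_perp x q).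
have dle : `|d| <= sin t * sin c.
  by rewrite (le_trans (normr_dotp_le _ _))// !enorm_sphere_perp mulrC.
have st0 : 0 <= sin t := sin_sdist_ge0 x q.
have sc0 : 0 <= sin c := sin_sdist_ge0 x y.
pose z := d / (sin t * sin c).
have dz : d = sin t * sin c * z.
  have [s0|s0] := eqVneq (sin t * sin c) 0.
    by rewrite /z s0 mul0r; apply/eqP; rewrite -normr_le0 -s0.
  by rewrite /z mulrC divfK.
have z1 : -1 <= z <= 1.
  rewrite -ler_norml /z normrM normfV (ger0_norm (mulr_ge0 _ _))//.
  have [->|s0] := eqVneq (sin t * sin c) 0; first by rewrite invr0 mulr0 ler01.
  by rewrite ler_pdivrMr ?mul1r// lt_neqAle eq_sym s0 mulr_ge0.
have cE : cos (sdist y q) = cos t * cos c + sin t * sin c * z.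
  by rewrite -dz /d dotp_sphere_perp cos_sdist [cos t * _]mulrC addrC subrK.
exists z; split => //.
- rewrite dotp_sphere_log -/t -/d dz.
  have [s0|s0] := eqVneq (sin t) 0; last by field.
  by rewrite /z s0 invr0 mulr0 !mul0r invr0 !mulr0.
- by apply: hinge; rewrite ?sdist_itv.
Qed.

Lemma sdist_triangle x y q : sdist y q <= sdist x q + sdist x y.
Proof.
have [z [/andP[z1 z2] _ _ h]] := hinge_sphere x y q.
have /andP[t0 _] := sdist_itv x q; have /andP[c0 _] := sdist_itv x y.
have /andP[y0 _] := sdist_itv y q.
have tc := mulr_ge0 t0 c0.
rewrite -ler_sqr ?nnegrE ?addr_ge0//; apply: (le_trans h).
by move: tc; rewrite -/(sdist x q) -/(sdist x y); nra.
Qed.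

Lemma sqr_enorm_chord x y : enorm (vec x - vec y) ^+ 2 = 2 - 2 * cos (sdist x y).
Proof.
rewrite sqr_enorm dotpBl !dotpBr !dotp_vec (dotpC (vec y)) cos_sdist.
by ring.
Qed.

Lemma chord_le_sdist x y : enorm (vec x - vec y) <= sdist x y.
Proof.
have /andP[c0 _] := sdist_itv x y.
by rewrite -ler_sqr ?nnegrE ?enorm_ge0// sqr_enorm_chord chord_le_angle.
Qed.

Lemma sdist_le_chord x y : sdist x y <= 2 * enorm (vec x - vec y).
Proof.
have /andP[c0 _] := sdist_itv x y.
rewrite -ler_sqr ?nnegrE ?mulr_ge0 ?enorm_ge0// exprMn sqr_enorm_chord.
by rewrite (le_trans (angle_le_chord (sdist_itv x y)))// expr2 -natrM.
Qed.

Lemma sdist_chord_le2 x y : enorm (vec x - vec y) <= 2.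
Proof. by rewrite (le_trans (enormB _ _))// !enorm_vec. Qed.

Lemma normr_dotp_sphere_log x y q :
  `|dotp (vec y) (sphere_log x q)| <= 4 * sdist x y.
Proof.
have [z [/andP[z1 z2] _ -> _]] := hinge_sphere x y q.
have /andP[t0 tpi] := sdist_itv x q; have cI := sdist_itv x y.
have /andP[c0 _] := cI; have s0 := sin_ge0_pi cI; have sc := sin_le c0.
have p4 := pi_lt4 R.
rewrite !normrM (ger0_norm t0) (ger0_norm s0) -mulrA ler_pM ?mulr_ge0//.
  by rewrite (le_trans tpi)// ltW.
by rewrite (le_trans (ler_piMr _ _))// ler_norml z1.
Qed.

(** A one-sided Taylor bound valid across the cut locus. The hinge inequality gives the quadratic
    term 1/2 and replaces sin c by c in the linear term, at a cost of at most 4 c^2 because t <= pi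
    < 4; hence 9/2. *)
Lemma rho_le x y q :
  rho y q <= rho x q - dotp (vec y) (sphere_log x q) + 9 / 2 * sdist x y ^+ 2.
Proof.
have [z [/andP[z1 z2] _ -> h]] := hinge_sphere x y q.
rewrite /rho !(sdistC q).
have /andP[t0 tpi] := sdist_itv x q; have cI := sdist_itv x y.
have /andP[c0 _] := cI; have sc := sin_le c0; have scc := subr_sin_le cI.
have p4 := pi_lt4 R.
move: h t0 tpi c0 sc scc; set t := sdist x q; set c := sdist x y; set y' := sdist y q.
move=> h t0 tpi c0 sc scc.
have h1 : t * (c - sin c) * (- z) <= 4 * c ^+ 2.
  apply: (@le_trans _ _ (t * (c - sin c))).
    by rewrite ler_piMr ?mulr_ge0 ?subr_ge0//; lra.
  by rewrite ler_pM ?subr_ge0//; lra.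
by nra.
Qed.

Lemma rho_le_chord x y q :
  rho y q <= rho x q - dotp (vec y) (sphere_log x q) + 18 * enorm (vec y - vec x) ^+ 2.
Proof.
apply: (le_trans (rho_le x y q)); rewrite lerD2l.
have /andP[c0 _] := sdist_itv x y.
have := sdist_le_chord x y; rewrite (enorm_distC (vec y)).
by have := enorm_ge0 (vec x - vec y); nra.
Qed.

(* [log_x q] is orthogonal to [x], so that the linear terms of [rho_le_chord]
   cancel when a multiple of [x] is a convex combination of the [y k]. *)
Lemma rho_semiconcave (I : finType) (l : I -> R) (y : I -> sphere R n) (a : R) x q :
  (forall k, 0 <= l k) -> \sum_k l k = 1 -> \sum_k l k *: vec (y k) = a *: vec x ->
  \sum_k l k * rho (y k) q <=
    rho x q + 18 * \sum_k l k * enorm (vec (y k) - vec x) ^+ 2.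
Proof.
move=> l0 l1 lx.
apply: (@le_trans _ _ (\sum_k l k * (rho x q - dotp (vec (y k)) (sphere_log x q)
    + 18 * enorm (vec (y k) - vec x) ^+ 2))).
  by apply: ler_sum => k _; rewrite ler_wpM2l// rho_le_chord.
under eq_bigr do rewrite mulrDr mulrBr.
rewrite big_split/= sumrB -mulr_suml l1 mul1r mulr_sumr.
rewrite [X in _ - X](_ : _ = 0).
  by rewrite subr0 lerD2l; apply: ler_sum => k _; rewrite mulrCA.
transitivity (dotp (\sum_k l k *: vec (y k)) (sphere_log x q)).
  by rewrite dotp_suml; apply: eq_bigr => k _; rewrite dotpZl.
by rewrite lx dotpZl dotp_base_sphere_log mulr0.
Qed.

(** Pair the combination with x and use that a squared chord is 2 - 2 cos. This measures what is
    lost when a convex combination of points of the sphere is pushed back to the sphere. *)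
Lemma convex_combination_scale (I : finType) (l : I -> R) (y : I -> sphere R n) (a : R) x :
  \sum_k l k = 1 -> \sum_k l k *: vec (y k) = a *: vec x ->
  1 - a = 2^-1 * \sum_k l k * enorm (vec (y k) - vec x) ^+ 2.
Proof.
move=> l1 lx.
have -> : a = \sum_k l k * cos (sdist (y k) x).
  transitivity (dotp (\sum_k l k *: vec (y k)) (vec x)).
    by rewrite lx dotpZl dotp_vec mulr1.
  by rewrite dotp_suml; apply: eq_bigr => k _; rewrite dotpZl cos_sdist.
rewrite -{1}l1 -sumrB mulr_sumr; apply: eq_bigr => k _.
by rewrite sqr_enorm_chord; field.
Qed.

(* The deviation of [rho _ q] from its linearization at [p]. *)
Definition dev p x q := rho x q - rho p q + dotp (vec x) (sphere_log p q).

(** What [dev] adds to [rho] is affine in vec x, so only the rescaling by a costs anything: 1 - a is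
    half the spread and the inner product is at most 16, whence 26 = 18 + 8. *)
Lemma dev_semiconcave p (I : finType) (l : I -> R) (y : I -> sphere R n) (a : R) x q :
  (forall k, 0 <= l k) -> \sum_k l k = 1 -> \sum_k l k *: vec (y k) = a *: vec x ->
  \sum_k l k * dev p (y k) q <=
    dev p x q + 26 * \sum_k l k * enorm (vec (y k) - vec x) ^+ 2.
Proof.
move=> l0 l1 lx.
have h1 := rho_semiconcave q l0 l1 lx.
have h2 := convex_combination_scale l1 lx.
set S := \sum_k l k * enorm _ ^+ 2 in h1 h2 *.
have S0 : 0 <= S by apply: sumr_ge0 => k _; rewrite mulr_ge0// sqr_ge0.
have -> : \sum_k l k * dev p (y k) q =
    \sum_k l k * rho (y k) q - rho p q + a * dotp (vec x) (sphere_log p q).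
  rewrite -dotpZl -lx dotp_suml -[rho p q in RHS]mul1r -l1 mulr_suml -sumrB -big_split/=.
  by apply: eq_bigr => k _; rewrite dotpZl /dev; ring.
have := normr_dotp_sphere_log p x q; have /andP[_ cpi] := sdist_itv p x.
have p4 := pi_lt4 R; rewrite ler_norml => /andP[d1 d2].
rewrite /dev; nra.
Qed.

(** The first order bound, insensitive to the cut locus: each of the two parts of [dev] is at most 4
    times the distance from p to x, and the distance is at most twice the chord. *)
Lemma normr_dev_le p x q : `|dev p x q| <= 16 * enorm (vec x - vec p).
Proof.
have h1 := sdist_triangle p x q; have h2 := sdist_triangle x p q.
rewrite (sdistC x p) in h2.
have /andP[t0 tpi] := sdist_itv p q; have /andP[t0' tpi'] := sdist_itv x q.
have /andP[c0 _] := sdist_itv p x; have p4 := pi_lt4 R.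
have c2 := sdist_le_chord p x; rewrite (enorm_distC (vec p)) in c2.
apply: (@le_trans _ _ (8 * sdist p x)); last by lra.
have := normr_dotp_sphere_log p x q; rewrite !ler_norml => /andP[d1 d2].
rewrite /dev /rho !(sdistC q).
have e : `|sdist x q - sdist p q| <= sdist p x by rewrite ler_norml; lra.
have : `|2^-1 * sdist x q ^+ 2 - 2^-1 * sdist p q ^+ 2| <= 4 * sdist p x.
  rewrite (_ : _ - _ = (sdist x q - sdist p q) * (2^-1 * (sdist x q + sdist p q))); last by field.
  rewrite normrM mulrC ler_pM//.
  by rewrite ger0_norm ?mulr_ge0 ?addr_ge0//; lra.
by rewrite ler_norml => /andP[e1 e2]; lra.
Qed.

(** A bound for the second order coefficient of [dev] in terms of u = cos t, t being the distance
    from p to q. It grows like 1 / sin t towards the antipode only, which explains the test on the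
    sign of u. *)
Definition dev_dom (u : R) : R := 5 + 2 * (if u < 0 then (Num.sqrt (1 - u ^+ 2))^-1 else 0).

(** The upper bound is [rho_le]. The lower bound is the tangent inequality at t divided by sin t,
    which yields t cot t (1 - cos c): nonnegative for u >= 0, and at least - 2 c^2 / sin t
    otherwise. *)
Lemma normr_dev_le_sqr p x q : `|dotp (vec p) (vec q)| < 1 ->
  `|dev p x q| <= dev_dom (dotp (vec p) (vec q)) * sdist p x ^+ 2.
Proof.
move=> u1; set u := dotp _ _.
have /andP[c0 cpi] := sdist_itv p x; have p4 := pi_lt4 R.
have tI := sdist_itv p q; have /andP[t0 tpi] := tI.
have st0 : 0 < sin (sdist p q).
  rewrite /sdist sin_acos ?dotp_vec_itv// sqrtr_gt0 subr_gt0.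
  by rewrite -(real_normK (num_real _)) expr_lt1.
have gam0 : 0 <= dev_dom u - 5.
  rewrite /dev_dom addrAC subrr add0r mulr_ge0//; by case: ifP => // _; rewrite invr_ge0 sqrtr_ge0.
have c2 := sqr_ge0 (sdist p x).
rewrite ler_norml; apply/andP; split; last first.
  by have := rho_le p x q; rewrite /dev; nra.
have [z [z1 cE dE _]] := hinge_sphere p x q.
have tan := sqr_angle_tangent tI (sdist_itv x q).
have cc := oneBcos_le c0; have cc1 := cos_le1 (sdist p x).
rewrite /dev /rho !(sdistC q) dE.
set t := sdist p q in tI t0 tpi st0 cE dE tan *; set c := sdist p x in c0 cpi c2 cE dE cc cc1 *.
set y := sdist x q in cE tan *.
have ut : u = cos t by rewrite /t cos_sdist.
(* division of [tan] by [sin t] *)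
have h : t * cos t / sin t * (1 - cos c) <= 2^-1 * y ^+ 2 - 2^-1 * t ^+ 2 + t * sin c * z.
  rewrite -(ler_pM2l st0) mulrA [sin t * _]mulrC divfK ?gt_eqF//.
  by rewrite cE in tan; lra.
apply: le_trans h.
have [u0|u0] := leP 0 u.
  apply: (@le_trans _ _ 0); first by rewrite oppr_le0 mulr_ge0//; lra.
  have h0 : 0 <= t * cos t / sin t by rewrite divr_ge0 ?(ltW st0)// mulr_ge0// -ut.
  by rewrite mulr_ge0// subr_ge0.
have -> : dev_dom u = 5 + 2 / sin t.
  by rewrite /dev_dom u0 ut -sin2cos2 sqrtr_sqr ger0_norm// ltW.
have i0 : 0 < (sin t)^-1 by rewrite invr_gt0.
have h1 : - 4 <= t * cos t by have := cos_geN1 t; nra.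
have h2 : - 4 / sin t <= t * cos t / sin t by rewrite ler_pM2r.
have h3 : - 4 / sin t * (1 - cos c) <= t * cos t / sin t * (1 - cos c).
  by rewrite ler_wpM2r// subr_ge0.
apply: le_trans h3.
have := ler_wpM2l (ltW i0) cc; nra.
Qed.

End sphere_geometry.

(** * Second order expansion of [dev] along a geodesic *)

Section second_order_expansion.
Context (R : realType).

Definition half_sqr_acos (u : R) := 2^-1 * acos u ^+ 2.

(** The factor t / sin t of the logarithm, as a function of u = cos t. *)
Definition log_coef (u : R) := acos u / Num.sqrt (1 - u ^+ 2).

(** The value of [dev] at x = cos t p + sin t e, with u and w the components of q along p and e; see
    [dev_polar]. *)
Definition dev2 (t u w : R) :=
  half_sqr_acos (cos t * u + sin t * w) - half_sqr_acos u + sin t * (log_coef u * w).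

(** Half the Hessian of the half squared distance in the direction e. The ratio w^2 / (1 - u^2) is
    the squared cosine of the angle between e and the direction of q; the radial eigenvalue is 1 and
    the transversal one is u log_coef u = t cot t. *)
Definition dev2_limit (u w : R) :=
  2^-1 * (u * log_coef u + (1 - u * log_coef u) * (w ^+ 2 / (1 - u ^+ 2))).

Lemma is_derive_half_sqr_acos (u : R) : -1 < u < 1 ->
  is_derive u (1 : R) half_sqr_acos (- log_coef u).
Proof.
move=> u1; have dacos := is_derive1_acos u1.
apply: is_derive_eq. rewrite /GRing.scale /= /log_coef; lra.
Qed.

Lemma is_derive_log_coef (u : R) : -1 < u < 1 ->
  is_derive u (1 : R) log_coef ((u * log_coef u - 1) / (1 - u ^+ 2)).
Proof.
move=> /[dup] u1 /andP[ugt ult]; have dacos := is_derive1_acos u1.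
have p : 0 < 1 - u ^+ 2 by nra.
have sp : 0 < Num.sqrt (1 - u ^+ 2) by rewrite sqrtr_gt0.
have ds : is_derive u (1 : R) (fun x : R => Num.sqrt (1 - x ^+ 2))
    ((2 * Num.sqrt (1 - u ^+ 2))^-1 * - (2 * u)).
  apply: (@is_derive1_comp _ Num.sqrt (fun x : R => 1 - x ^+ 2)).
    exact: is_derive1_sqrt.
  by apply: is_derive_eq; rewrite /GRing.scale /=; ring.
have dv : is_derive u (1 : R) (fun x : R => (Num.sqrt (1 - x ^+ 2))^-1)
   (- (Num.sqrt (1 - u ^+ 2)) ^- 2 *: ((2 * Num.sqrt (1 - u ^+ 2))^-1 * - (2 * u))).
  by apply: is_deriveV => //; rewrite gt_eqF.
have := is_deriveM dacos dv; rewrite /log_coef.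
move=> /is_derive_eq; apply.
have ss : 1 - u ^+ 2 = Num.sqrt (1 - u ^+ 2) ^+ 2 by rewrite sqr_sqrtr// ltW.
rewrite /GRing.scale /=; move: ss sp; set s := Num.sqrt _ => ss sp.
by rewrite ss; field; rewrite gt_eqF.
Qed.

(** L'Hôpital's rule leaves df t / (2 t), and df 0 = 0, so the limit is half the derivative of df at
    0. *)
Lemma dev2_cvg (u w : R) : -1 < u < 1 ->
  dev2 t u w / t ^+ 2 @[t --> 0^'+] --> dev2_limit u w.
Proof.
move=> u1.
pose v t := cos t * u + sin t * w.
pose dv t := - sin t * u + cos t * w.
have v0 : v 0 = u by rewrite /v cos0 sin0; ring.
have isv t : is_derive t (1 : R) v (dv t).
  by apply: is_derive_eq; rewrite /GRing.scale /= /dv; ring.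
have isdv t : is_derive t (1 : R) dv (- v t).
  by apply: is_derive_eq; rewrite /GRing.scale /= /v; ring.
have [b /= b0 bv] : exists2 b, 0 < b & forall t, `|t| < b -> -1 < v t < 1.
  have cv : {for 0, continuous v}.
    by apply: differentiable_continuous; apply/derivable1_diffP; have [] := isv 0.
  have hn : nbhs (v 0) [set y | y \in `]-1, 1[].
    by rewrite v0; apply: near_in_itvoo; rewrite in_itv.
  have /nbhs_ballP[b /= b0 h] := cv _ hn; exists b => // t tb.
  have : v t \in `]-1, 1[ by apply: h; rewrite /ball /= sub0r normrN.
  by rewrite in_itv.
pose df t := - log_coef (v t) * dv t + cos t * (log_coef u * w).
have isdf t : `|t| < b -> is_derive t (1 : R) (fun t => dev2 t u w) (df t).
  move=> tb.
  have d1 : is_derive t (1 : R) (half_sqr_acos \o v) (- log_coef (v t) * dv t).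
    by apply: is_derive1_comp; exact: is_derive_half_sqr_acos (bv _ tb).
  rewrite (_ : (fun t => _) = fun t => (half_sqr_acos \o v) t - half_sqr_acos u + sin t * (log_coef u * w))//.
  by apply: is_derive_eq; rewrite /GRing.scale /= /df; ring.
have df0 : df 0 = 0 by rewrite /df v0 /dv sin0 cos0; ring.
have isdf0 : is_derive 0 (1 : R) df (2 * dev2_limit u w).
  have d1 : is_derive 0 (1 : R) (log_coef \o v) ((u * log_coef u - 1) / (1 - u ^+ 2) * dv 0).
    by apply: is_derive1_comp; rewrite v0; exact: is_derive_log_coef.
  rewrite (_ : df = fun t => - (log_coef \o v) t * dv t + cos t * (log_coef u * w))//.
  apply: is_derive_eq; rewrite /GRing.scale /= v0 /dv sin0 cos0 /dev2_limit.
  have p : 1 - u ^+ 2 != 0 by rewrite gt_eqF//; case/andP: u1 => *; nra.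
  by field.
apply: (@lhopital_at_right R (fun t => dev2 t u w) df (fun t => t ^+ 2) (fun t => 2 * t) 0 b _ b0).
- move=> t; rewrite in_itv/= => /andP[t0 tb]; apply: isdf.
  by rewrite gtr0_norm.
- by move=> t _; apply: is_derive_eq; rewrite /GRing.scale /=; ring.
- have d0 : 0 = dev2 0 u w :> R by rewrite /dev2 cos0 sin0 mul1r !mul0r !addr0 subrr.
  rewrite [X in _ --> X]d0.
  apply: cvg_at_right_filter.
  have c0 : {for 0, continuous (fun t => dev2 t u w)}.
    have z0 : `|0 : R| < b by rewrite normr0.
    by apply: differentiable_continuous; apply/derivable1_diffP; have [] := isdf _ z0.
  exact: c0.
- rewrite [X in _ --> X](_ : 0 = 0 ^+ 2); last by rewrite expr0n.
  by apply: cvg_at_right_filter; exact: exprn_continuous.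
- by move=> t; rewrite in_itv/= => /andP[t0 _]; rewrite mulf_neq0// gt_eqF.
have h : (fun h : R => h^-1 *: ((df \o shift 0) (h *: (1 : R)) - df 0)) @ 0^' --> 2 * dev2_limit u w.
  by have [+ <-] := isdf0.
rewrite (_ : dev2_limit u w = 2^-1 * (2 * dev2_limit u w)); last by field.
have : (fun h : R => 2^-1 * (h^-1 *: ((df \o shift 0) (h *: (1 : R)) - df 0))) @ 0^' --> 2^-1 * (2 * dev2_limit u w).
  by apply: cvgM => //; exact: cvg_cst.
move=> /cvg_dnbhs_at_right.
apply: cvg_trans; apply: near_eq_cvg; near=> t.
have t0 : t != 0 by [].
by rewrite df0 subr0 /= addr0 /GRing.scale /= mulr1; field.
Unshelve. all: by end_near. Qed.

End second_order_expansion.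

(** * Second moments of sample averages and Chebyshev's inequality *)

Section bounded_integration.
Context d (T : measurableType d) (R : realType).
Variable Q : {finite_measure set T -> \bar R}.
Implicit Types f g : T -> R.

Lemma bounded_integrable f (M : R) : measurable_fun setT f ->
  (forall x, `|f x| <= M) -> Q.-integrable setT (EFin \o f).
Proof.
move=> mf fM; apply: measurable_bounded_integrable => //.
  by rewrite ltey_eq fin_num_measure.
by exists M; split; [exact: num_real|move=> x Mx /= y _; exact: (le_trans (fM y) (ltW Mx))].
Qed.

Lemma integral_EFin_Rintegral f : Q.-integrable setT (EFin \o f) ->
  (\int[Q]_x (f x)%:E = (\int[Q]_x f x)%:E)%E.
Proof. by move=> fi; rewrite fineK//; exact: integrable_fin_num fi. Qed.

Lemma integrable_EFin_sum I (s : seq I) (F : I -> T -> R) :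
  (forall i, Q.-integrable setT (EFin \o F i)) ->
  Q.-integrable setT (EFin \o (fun x => \sum_(i <- s) F i x)).
Proof.
move=> iF; rewrite (_ : _ \o _ = fun x => (\sum_(i <- s) (F i x)%:E)%E); last first.
  by apply/funext => x /=; rewrite sumEFin.
exact: (@integrable_sum _ _ _ Q setT measurableT I s xpredT (fun i x => (F i x)%:E) (fun i _ => iF i)).
Qed.

Lemma Rintegral_sum I (s : seq I) (F : I -> T -> R) :
  (forall i, Q.-integrable setT (EFin \o F i)) ->
  \int[Q]_x (\sum_(i <- s) F i x) = \sum_(i <- s) \int[Q]_x F i x.
Proof.
move=> iF; apply: EFin_inj; rewrite -integral_EFin_Rintegral; last exact: integrable_EFin_sum.
under eq_integral do rewrite -sumEFin.
rewrite (@integral_sum _ _ _ Q setT measurableT _ (fun i x => (F i x)%:E) iF).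
by rewrite -sumEFin; apply: eq_bigr => i _; rewrite integral_EFin_Rintegral.
Qed.

End bounded_integration.

Section iid_moments.
Context d (Omega : measurableType d) (R : realType) (P : probability Omega R).
Context d' (T : measurableType d').
Variables (X : nat -> {RV P >-> T}) (mu : probability T R).
Hypothesis hX : iid X mu.
Variables (phi : T -> R) (M : R).
Hypotheses (mphi : measurable_fun setT phi) (phiM : forall x, `|phi x| <= M).

Let mX i : measurable_fun setT (X i). Proof. exact: measurable_funPT. Qed.

Let mphiX i : measurable_fun setT (phi \o X i). Proof. exact: measurableT_comp. Qed.

Let M0 : 0 <= M. Proof. by apply: (le_trans _ (phiM point)). Qed.

Lemma Rintegral_iid (g : T -> R) i (K : R) : measurable_fun setT g ->
  (forall x, `|g x| <= K) -> \int[P]_w g (X i w) = \int[mu]_x g x.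
Proof.
move=> mg gK; congr fine.
rewrite -(@integral_distribution _ _ _ _ _ P (X i) (EFin \o g)).
- by apply: eq_measure_integral => A mA _; exact: (hX.2 i A mA).
- exact/measurable_EFinP.
- apply: (@bounded_integrable _ _ _ P (g \o X i) K) => [|w]; last exact: gK.
  exact: measurableT_comp.
Qed.

Lemma pair_law_iid i j (A : set (T * T)) : i != j -> measurable A ->
  (mu \x mu)%E A = pushforward P (fun w => (X i w, X j w)) A.
Proof.
move=> ij mA; have mp : measurable_fun setT (fun w => (X i w, X j w)).
  exact: measurable_fun_pair.
pose m : {measure set (T * T) -> \bar R} := pushforward P (fun w => (X i w, X j w)).
apply: (@product_measure_unique _ _ _ _ R mu mu (m mp) _ A mA) => B C mB mC.
have := hX.1 [:: i; j] (fun k => if k == i then B else C).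
rewrite /= inE ij => /(_ isT).
have mBC k : measurable (if k == i then B else C) by case: ifP.
move=> /(_ mBC); rewrite big_cons big_seq1 eqxx eq_sym (negbTE ij) => h.
rewrite /m /= /pushforward -(hX.2 i B mB) -(hX.2 j C mC) -[RHS]h; congr (P _).
apply/seteqP; split => w /=.
  move=> [wB wC] k /=; rewrite !inE => /orP[] /eqP ->; first by rewrite eqxx.
  by rewrite eq_sym (negbTE ij).
move=> h'; have := h' i; have := h' j; rewrite /= !inE !eqxx orbT eq_sym (negbTE ij).
by move=> /(_ isT) wC /(_ isT) wB.
Qed.

Lemma Rintegral_iid_pair i j : i != j ->
  \int[P]_w (phi (X i w) * phi (X j w)) = (\int[mu]_x phi x) ^+ 2.
Proof.
move=> ij; have mp : measurable_fun setT (fun w => (X i w, X j w)).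
  exact: measurable_fun_pair.
pose g (z : T * T) := phi z.1 * phi z.2.
have mg : measurable_fun setT g.
  apply: measurable_funM.
    exact: (measurableT_comp mphi measurable_fst).
  exact: (measurableT_comp mphi measurable_snd).
have gM z : `|g z| <= M * M by rewrite normrM ler_pM.
have iphi : mu.-integrable setT (EFin \o phi) by exact: (@bounded_integrable _ _ _ mu phi M).
have ig' : P.-integrable setT ((EFin \o g) \o (fun w => (X i w, X j w))).
  apply: (@bounded_integrable _ _ _ P (fun w => g (X i w, X j w)) (M * M)) => [|w].
    exact: (measurableT_comp mg mp).
  exact: gM.
have mg' : measurable_fun setT (EFin \o g) by exact/measurable_EFinP.
have := @integral_pushforward _ _ _ _ R _ mp P setT _ mg' ig' measurableT.
rewrite preimage_setT => h.
transitivity (fine (\int[(mu \x mu)%E]_z (g z)%:E)%E).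
  congr fine; apply: (etrans (esym h)).
  by apply: eq_measure_integral => A mA _; exact/esym/pair_law_iid.
rewrite -[RHS]/(fine (_ ^+ 2)%:E); congr fine.
have ig : (mu \x mu)%E.-integrable setT (EFin \o g).
  apply: measurable_bounded_integrable => //.
    have := @product_measure1E _ _ _ _ R mu mu setT setT measurableT measurableT.
    rewrite setXTT => muT; apply: (eq_ind_r (fun z => (z < +oo)%E) _ muT).
    by rewrite ltey_eq fin_numM ?fin_num_measure.
  exists (M * M); split; [exact: num_real|move=> x Mx /= y _].
  exact: (le_trans (gM y) (ltW Mx)).
rewrite -(@integral12_prod_meas1 _ _ _ _ R mu mu (EFin \o g) ig).
transitivity (\int[mu]_x ((phi x)%:E * (\int[mu]_x phi x)%:E))%E.
  apply: eq_integral => x _; rewrite /fubini_F /g /=.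
  under eq_integral do rewrite EFinM.
  by rewrite integralZl// integral_EFin_Rintegral.
by rewrite integralZr// integral_EFin_Rintegral// -EFinM expr2.
Qed.

(** After expansion the off-diagonal terms vanish by pairwise independence and centering. *)
Lemma Rintegral_sum_sqr_iid n : \int[mu]_x phi x = 0 ->
  \int[P]_w ((\sum_(i < n) phi (X i w)) ^+ 2) = n%:R * \int[mu]_x (phi x ^+ 2).
Proof.
move=> e0.
have iphi2 i j : P.-integrable setT (EFin \o (fun w => phi (X i w) * phi (X j w))).
  apply: (@bounded_integrable _ _ _ P _ (M * M)).
    by apply: measurable_funM; exact: mphiX.
  by move=> w; rewrite normrM ler_pM.
transitivity (\int[P]_w (\sum_(i < n) \sum_(j < n) phi (X i w) * phi (X j w))).
  apply: eq_Rintegral => w _; rewrite expr2 mulr_suml.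
  by apply: eq_bigr => i _; rewrite mulr_sumr.
rewrite Rintegral_sum => [|i]; last exact: integrable_EFin_sum.
rewrite (eq_bigr (fun=> \int[mu]_x (phi x ^+ 2))) => [|i _].
  by rewrite sumr_const card_ord mulr_natl.
rewrite Rintegral_sum => [|j]; last exact: iphi2.
rewrite (bigD1 i)//= big1 ?addr0 => [|j ji]; last first.
  by rewrite Rintegral_iid_pair ?e0 ?expr0n// eq_sym.
apply: (@Rintegral_iid (fun x => phi x * phi x) i (M * M)).
  exact: measurable_funM.
by move=> x; rewrite normrM ler_pM.
Qed.

End iid_moments.

Section chebyshev_iid.
Context d (Omega : measurableType d) (R : realType) (P : probability Omega R).
Context d' (T : measurableType d').
Variables (X : nat -> {RV P >-> T}) (mu : probability T R).
Hypothesis hX : iid X mu.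
Variables (phi : T -> R) (M : R).
Hypotheses (mphi : measurable_fun setT phi) (phiM : forall x, `|phi x| <= M).

(** The raw second moment replaces the variance, which it dominates; this is the quantity that
    [Rintegral_sqr_dev] controls. *)
Lemma chebyshev_iid (n : nat) (a : R) : (0 < n)%N -> 0 < a ->
  (P [set w | a <= `|n%:R^-1 * \sum_(i < n) phi (X i w) - \int[mu]_x phi x|]%R <=
   (\int[mu]_x (phi x ^+ 2) / (n%:R * a ^+ 2))%:E)%E.
Proof.
move=> n0 a0; set e := \int[mu]_x phi x; set s := \int[mu]_x (phi x ^+ 2).
have n0' : 0 < n%:R :> R by rewrite ltr0n.
have M0 : 0 <= M by apply: (le_trans _ (phiM point)).
have iphi : mu.-integrable setT (EFin \o phi) by exact: (@bounded_integrable _ _ _ mu phi M).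
have icst (c : R) : mu.-integrable setT (EFin \o cst c).
  by apply: (@bounded_integrable _ _ _ mu _ `|c|).
have iphi2 : mu.-integrable setT (EFin \o (fun x => phi x ^+ 2)).
  apply: (@bounded_integrable _ _ _ mu _ (M ^+ 2)); first exact: measurable_funX.
  by move=> x; rewrite normrX lerXn2r ?nnegrE.
have mu1 : fine (mu setT) = 1 by rewrite probability_setT.
pose psi x := phi x - e.
have mpsi : measurable_fun setT psi by apply: measurable_funB.
have psiM x : `|psi x| <= M + `|e| by rewrite (le_trans (ler_normB _ _))// lerD2r.
have psi0 : \int[mu]_x psi x = 0.
  rewrite (@RintegralB _ _ _ mu setT phi (cst e))//.
  by rewrite Rintegral_cst// mu1 mulr1 subrr.
have psi2 : \int[mu]_x (psi x ^+ 2) <= s.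
  rewrite (_ : \int[mu]_x (psi x ^+ 2) = s - e ^+ 2); first by rewrite gerBl sqr_ge0.
  transitivity (\int[mu]_x ((phi x ^+ 2 - (2 * e) * phi x) + cst (e ^+ 2) x)).
    by apply: eq_Rintegral => x _; rewrite /psi /=; ring.
  have i2 : mu.-integrable setT (EFin \o (fun x => (2 * e) * phi x)).
    by have := integrableZl measurableT (2 * e) iphi; congr (integrable _ _ _).
  rewrite RintegralD//; last first.
    by have := integrableB measurableT iphi2 i2; congr (integrable _ _ _).
  rewrite RintegralB// RintegralZl// Rintegral_cst// mu1 mulr1 -/e -/s.
  by ring.
pose S w := \sum_(i < n) psi (X i w).
have mS : measurable_fun setT S.
  by apply: measurable_sum => i; apply: measurableT_comp.
have mS2 : measurable_fun setT (fun w => (S w ^+ 2)%:E).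
  by apply/measurable_EFinP; exact: measurable_funX.
have iS2 : P.-integrable setT (EFin \o (fun w => S w ^+ 2)).
  apply: (@bounded_integrable _ _ _ P _ ((n%:R * (M + `|e|)) ^+ 2)).
    exact: measurable_funX.
  move=> w; rewrite normrX lerXn2r ?nnegrE ?mulr_ge0 ?addr_ge0//.
  rewrite (le_trans (ler_norm_sum _ _ _))//.
  apply: (@le_trans _ _ (\sum_(i < n) (M + `|e|))); last by rewrite sumr_const card_ord mulr_natl.
  by apply: ler_sum => i _; exact: psiM.
have c0 : 0 < (n%:R * a) ^+ 2 by rewrite exprn_gt0// mulr_gt0.
have := le_integral_abse P measurableT mS2 c0.
rewrite (_ : (\int[P]_w `|(S w ^+ 2)%:E| = (n%:R * \int[mu]_x (psi x ^+ 2))%:E)%E); last first.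
  rewrite -(Rintegral_sum_sqr_iid hX mpsi psiM n psi0) -integral_EFin_Rintegral//.
  by apply: eq_integral => w _; rewrite /= ger0_norm// sqr_ge0.
rewrite setTI (_ : [set w | _ <= _]%E = [set w | a <= `|n%:R^-1 * \sum_(i < n) phi (X i w) - e|]); last first.
  have eqS w : n%:R^-1 * \sum_(i < n) phi (X i w) - e = n%:R^-1 * S w.
    rewrite /S /psi sumrB sumr_const card_ord mulrBr -[e *+ n]mulr_natl mulrA mulVf ?mul1r//.
    by rewrite gt_eqF.
  have eqw w : (((n%:R * a) ^+ 2)%:E <= `|(S w ^+ 2)%:E|)%E =
      (a <= `|n%:R^-1 * \sum_(i < n) phi (X i w) - e|).
    rewrite eqS lee_fin normrX ler_sqr ?nnegrE ?mulr_ge0 ?(ltW a0) ?normr_ge0//.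
    by rewrite normrM [`|n%:R^-1|]gtr0_norm ?invr_gt0// ler_pdivlMl.
  by apply/seteqP; split=> w /=; rewrite eqw.
rewrite -lee_pdivlMl// => /le_trans; apply; rewrite -EFinM lee_fin exprMn.
rewrite (_ : _ * _ = (\int[mu]_x (psi x ^+ 2)) / (n%:R * a ^+ 2)).
  by rewrite ler_pM2r// invr_gt0 mulr_gt0// exprn_gt0.
by field; rewrite !gt_eqF.
Qed.

End chebyshev_iid.

Section measurable_acos.
Context (R : realType).

(** The function is continuous on ]-1, 1[ and takes its default value outside [-1, 1], where no
    angle has the given cosine. *)
Lemma measurable_acos : measurable_fun setT (@acos R).
Proof.
have -> : @acos R = @acos R \_ `[-1, 1].
  apply/funext => x; rewrite patchE; case: ifPn => // /negP xN.
  rewrite unlock; apply: xgetPN => y [_ cy]; apply: xN.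
  by rewrite -cy; apply/mem_set; rewrite /= in_itv/= cos_geN1 cos_le1.
apply/(measurable_restrictT _ _).1; first exact: measurable_itv.
apply: (@measurable_fun_itv_cc _ _ _ false true).
apply: open_continuous_measurable_fun; first exact: itv_open.
by move=> x; rewrite inE/= in_itv => xI; exact: continuous_acos.
Qed.

End measurable_acos.

(** * Integration against the rotationally symmetric law *)

Section sphere_density.
Context (R : realType) (m : nat).
Local Notation leb := (@lebesgue_measure R).
Local Notation mR := (measurableTypeR R).
Variables (mu : probability (sphere R m.+2) R) (p : sphere R m.+2) (f : R -> R).
Hypothesis hfm : measurable_fun `[0, pi] f.
Hypothesis hf0 : forall t, 0 <= t <= pi -> 0 <= f t.
Hypothesis hmu : forall A : set (sphere R m.+2), measurable A ->
  mu A = (\int[@volume R m.+2]_(q in A) (f (sdist p q))%:E)%E.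

(** The density as a function of the cosine of the distance; f is assumed measurable on [0, pi],
    hence the restriction before composing. *)
Let fa (u : mR) : R := (f \_ `[0, pi]) (acos u).

Let measurable_fa : measurable_fun setT fa.
Proof.
have mf : measurable_fun setT (f \_ `[0, pi]).
  by apply/(measurable_restrictT _ _).1 => //; exact: measurable_itv.
exact: (measurableT_comp mf (@measurable_acos R)).
Qed.

Let fa_ge0 u : 0 <= fa u.
Proof.
rewrite /fa patchE; case: ifPn => // /set_mem; rewrite /= in_itv => h.
exact: hf0.
Qed.

Let fa_sdist q : fa (dotp (vec p) (vec q)) = f (sdist p q).
Proof. by rewrite /fa patchE mem_set//= in_itv/= sdist_itv. Qed.

Let fa_cos t : 0 <= t <= pi -> fa (cos t) = f t.
Proof. by move=> tI; rewrite /fa cosK ?in_itv// patchE mem_set//= in_itv. Qed.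

Lemma ge0_integral_mu (g : sphere R m.+2 -> \bar R) : measurable_fun setT g ->
  (forall q, (0 <= g q)%E) ->
  (\int[mu]_q g q = \int[vol R m.+2]_q ((fa (dotp (vec p) (vec q)))%:E * g q))%E.
Proof.
move=> mg g0.
have mw : measurable_fun setT (fun q : sphere R m.+2 => fa (dotp (vec p) (vec q))).
  exact: (measurableT_comp measurable_fa (measurable_dotp_vec (vec p))).
have w0 (q : sphere R m.+2) : 0 <= fa (dotp (vec p) (vec q)) by [].
have mid : measurable_fun setT (fun q : sphere R m.+2 => q) by exact: measurable_id.
have mE A : measurable A ->
    mu A = (\int[vol R m.+2]_q (fa (dotp (vec p) (vec q)) * \1_A q)%:E)%E.
  move=> mA; apply: (etrans (hmu mA)); rewrite (volE R m.+2).
  apply: (etrans (@integral_mkcond _ _ R (vol R m.+2) A _)); apply: eq_integral => q _.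
  by rewrite patchE indicE; case: ifP => _; rewrite ?mulr1 ?mulr0// fa_sdist.
exact: (ge0_integral_density mw w0 mid mE mg g0).
Qed.

Lemma ge0_integral_mu_pair (e : 'rV[R]_m.+3) (G : mR * mR -> \bar R) :
  dotp e e = 1 -> dotp (vec p) e = 0 ->
  measurable_fun setT G -> (forall z, (0 <= G z)%E) ->
  (\int[mu]_q G (dotp (vec p) (vec q), dotp e (vec q)) =
   \int[leb]_(t in `[0%R, pi]) ((sin t ^+ m.+1 * f t)%:E *
     \int[vol R m.+1]_w G (cos t, sin t * vec w 0 0)%R))%E.
Proof.
move=> ee pe mG G0.
have mp : measurable_fun setT (fun q : sphere R m.+2 => (dotp (vec p) (vec q), dotp e (vec q)) : mR * mR).
  by apply: measurable_fun_pair; exact: measurable_dotp_vec.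
rewrite (ge0_integral_mu (measurableT_comp mG mp) (fun q => G0 _)).
pose G' (z : mR * mR) := ((fa z.1)%:E * G z)%E.
have mG' : measurable_fun setT G'.
  apply: emeasurable_funM => //; apply/measurable_EFinP.
  exact: (measurableT_comp measurable_fa measurable_fst).
have G'0 z : (0 <= G' z)%E by rewrite mule_ge0// lee_fin.
apply: (etrans (ge0_integral_vol_pair (dotp_vec p) ee pe mG' G'0)).
apply: eq_integral => t /set_mem; rewrite /= in_itv/= => tI.
rewrite EFinM -muleA; congr (_ * _)%E; rewrite /G' /=.
rewrite ge0_integralZl//; first by rewrite fa_cos.
  have mc : measurable_fun setT (fun w : sphere R m.+1 => (cos t, sin t * vec w 0 0) : mR * mR).
    apply: measurable_fun_pair => //; apply: measurable_funM => //.
    exact: measurable_vec_coord.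
  exact: (measurableT_comp mG mc).
by rewrite lee_fin.
Qed.

End sphere_density.

(** * Measurability and boundedness of [dev] and of the logarithm *)

Section measurable_dev.
Context (R : realType).
Local Notation mR := (measurableTypeR R).

Lemma measurable_inv_sqrt1 :
  measurable_fun setT (fun u : mR => (Num.sqrt (1 - u ^+ 2))^-1 : mR).
Proof.
rewrite (_ : (fun _ => _) = fun u : mR => Num.sqrt (1 - u ^+ 2) `^ (-1)); last first.
  by apply/funext => u; rewrite powR_inv1// sqrtr_ge0.
have ms : measurable_fun setT (fun u : mR => Num.sqrt (1 - u ^+ 2) : mR).
  apply: (measurableT_comp (continuous_measurable_fun (@sqrt_continuous R))).
  by apply: measurable_funB => //; exact: measurable_funX.
have mp := @measurable_powR R (-1).
exact: (measurableT_comp mp ms).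
Qed.

Lemma measurable_log_coef : measurable_fun setT (@log_coef R : mR -> mR).
Proof.
by apply: measurable_funM; [exact: measurable_acos|exact: measurable_inv_sqrt1].
Qed.

Lemma measurable_dev_dom : measurable_fun setT (@dev_dom R : mR -> mR).
Proof.
apply: measurable_funD => //; apply: measurable_funM => //.
apply: measurable_fun_ifT => //; first exact: measurable_fun_ltr.
exact: measurable_inv_sqrt1.
Qed.

Lemma dev_dom_ge0 (u : R) : 0 <= dev_dom u.
Proof.
rewrite /dev_dom addr_ge0// mulr_ge0//.
by case: ifP => // _; rewrite invr_ge0 sqrtr_ge0.
Qed.

Lemma exists_perp n (p : 'rV[R]_n.+2) : exists2 e, dotp e e = 1 & dotp p e = 0.
Proof.
have [p0|p0] := eqVneq (p 0 0) 0.
  exists (delta_mx 0 0); last by rewrite dotp_delta.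
  by rewrite dotp_delta mxE !eqxx.
pose j : 'I_n.+2 := lift ord0 ord0.
pose v : 'rV[R]_n.+2 := p 0 j *: delta_mx 0 0 - p 0 0 *: delta_mx 0 j.
have v0 : v != 0.
  apply/negP => /eqP/rowP/(_ j); rewrite !mxE !eqxx /= mulr0 mulr1 sub0r => /eqP.
  by rewrite oppr_eq0 (negbTE p0).
have e0 : enorm v != 0 by rewrite enorm_eq0.
exists ((enorm v)^-1 *: v).
  by rewrite dotpZl dotpZr -sqr_enorm; field.
by rewrite dotpZr dotpBr !dotpZr !dotp_delta [p 0 j * _]mulrC subrr mulr0.
Qed.

Variable n : nat.
Implicit Types p q x : sphere R n.

Lemma dotp_sphere_log_coef p (v : 'rV[R]_n.+1) q :
  dotp v (sphere_log p q) = log_coef (dotp (vec p) (vec q)) *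
    (dotp v (vec q) - dotp (vec p) (vec q) * dotp v (vec p)).
Proof.
rewrite sphere_logE dotpZr /sphere_perp dotpBr dotpZr /log_coef /sdist.
by rewrite sin_acos ?dotp_vec_itv// acosK// in_itv/= dotp_vec_itv.
Qed.

Lemma measurable_dotp_sphere_log p (v : 'rV[R]_n.+1) :
  measurable_fun setT (fun q => dotp v (sphere_log p q)).
Proof.
under eq_fun do rewrite dotp_sphere_log_coef.
apply: measurable_funM.
  exact: (measurableT_comp measurable_log_coef (measurable_dotp_vec (vec p))).
apply: measurable_funB; first exact: measurable_dotp_vec.
by apply: measurable_funM => //; exact: measurable_dotp_vec.
Qed.

Lemma measurable_rho x : measurable_fun setT (rho x).
Proof.
rewrite (_ : rho x = fun q => 2^-1 * acos (dotp (vec x) (vec q)) ^+ 2); last first.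
  by apply/funext => q; rewrite /rho sdistC.
apply: measurable_funM => //; apply: measurable_funX.
exact: (measurableT_comp (@measurable_acos R) (measurable_dotp_vec (vec x))).
Qed.

Lemma measurable_dev p x : measurable_fun setT (dev p x).
Proof.
apply: measurable_funD; first by apply: measurable_funB; exact: measurable_rho.
exact: measurable_dotp_sphere_log.
Qed.

Lemma measurable_sphere_log p : measurable_fun setT (sphere_log p).
Proof.
apply: measurable_fun_row => j.
rewrite (_ : (fun _ => _) = fun q => dotp (delta_mx 0 j) (sphere_log p q)).
  exact: measurable_dotp_sphere_log.
by apply/funext => q; rewrite dotpC dotp_delta.
Qed.

Lemma dev_polar p x (e : 'rV[R]_n.+1) c q : dotp (vec p) e = 0 ->
  vec x = cos c *: vec p + sin c *: e ->
  dev p x q = dev2 c (dotp (vec p) (vec q)) (dotp e (vec q)).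
Proof.
move=> pe xE; rewrite /dev dotp_sphere_log_coef /dev2 /half_sqr_acos /rho !(sdistC q).
have xq v : dotp (vec x) v = cos c * dotp (vec p) v + sin c * dotp e v.
  by rewrite xE dotpDl !dotpZl.
rewrite /sdist !xq dotp_vec (dotpC e (vec p)) pe; ring.
Qed.

Lemma bounded_dotp_sphere_log p (v : 'rV[R]_n.+1) q :
  `|dotp v (sphere_log p q)| <= 4 * enorm v.
Proof.
apply: (le_trans (normr_dotp_le _ _)); rewrite mulrC ler_wpM2r ?enorm_ge0//.
rewrite sphere_logE enormZ enorm_sphere_perp.
have /andP[t0 tpi] := sdist_itv p q; have p4 := pi_lt4 R.
have s0 := sin_sdist_ge0 p q.
rewrite normrM normfV !ger0_norm//.
have [->|s1] := eqVneq (sin (sdist p q)) 0; first by rewrite mulr0.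
by rewrite divfK//; lra.
Qed.

Lemma normr_dev_le32 p x q : `|dev p x q| <= 32.
Proof.
have := normr_dev_le p x q; have := sdist_chord_le2 x p; lra.
Qed.

Lemma rho_itv x q : 0 <= rho x q <= 8.
Proof.
have /andP[t0 tpi] := sdist_itv q x; have p4 := pi_lt4 R.
by rewrite /rho; apply/andP; split; nra.
Qed.

Lemma normr_dev_sub p x y q : `|dev p x q - dev p y q| <= 8 * sdist x y.
Proof.
have h1 := sdist_triangle x y q; have h2 := sdist_triangle y x q.
rewrite (sdistC y x) in h2.
have /andP[t0 tpi] := sdist_itv y q; have /andP[t0' tpi'] := sdist_itv x q.
have /andP[c0 _] := sdist_itv x y; have p4 := pi_lt4 R.
have := bounded_dotp_sphere_log p (vec x - vec y) q.
rewrite dotpBl => h3.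
have h4 : `|rho x q - rho y q| <= 4 * sdist x y.
  rewrite /rho !(sdistC q).
  rewrite (_ : _ - _ = (sdist x q - sdist y q) * (2^-1 * (sdist x q + sdist y q))); last by field.
  rewrite normrM mulrC ler_pM//.
    by rewrite ger0_norm ?mulr_ge0 ?addr_ge0//; lra.
  by rewrite ler_norml; lra.
rewrite /dev (_ : _ - _ = (rho x q - rho y q) +
  (dotp (vec x) (sphere_log p q) - dotp (vec y) (sphere_log p q))); last by ring.
rewrite (le_trans (ler_normD _ _))//.
by have := chord_le_sdist x y; lra.
Qed.

Lemma chord_eq0 p x : (enorm (vec x - vec p) == 0) = (x == p).
Proof.
rewrite enorm_eq0 subr_eq0; apply/eqP/eqP => [|->//]; exact: vec_inj.
Qed.

End measurable_dev.

Section polar_decomposition.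
Context (R : realType) (n : nat).
Implicit Types p q x : sphere R n.+1.

Lemma polar_decomposition p x : exists e : 'rV[R]_n.+2,
  [/\ dotp e e = 1, dotp (vec p) e = 0 &
      vec x = cos (sdist p x) *: vec p + sin (sdist p x) *: e].
Proof.
have [s0|s0] := eqVneq (sin (sdist p x)) 0.
  have [e e1 pe] := exists_perp (vec p); exists e; split => //.
  rewrite s0 scale0r addr0; apply/eqP; rewrite -subr_eq0 -enorm_eq0.
  by rewrite -/(sphere_perp p x) enorm_sphere_perp s0.
exists ((sin (sdist p x))^-1 *: sphere_perp p x); split.
- by rewrite dotpZl dotpZr -sqr_enorm enorm_sphere_perp; field.
- by rewrite dotpZr dotp_sphere_perpl mulr0.
- by rewrite scalerA mulfV// scale1r addrC subrK.
Qed.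

Lemma dotp_cos_sin (p e : 'rV[R]_n.+2) c : dotp p p = 1 -> dotp e e = 1 ->
  dotp p e = 0 ->
  dotp (cos c *: p + sin c *: e) (cos c *: p + sin c *: e) = 1.
Proof.
move=> pp ee pe; rewrite !dotpDl !dotpDr !dotpZl !dotpZr (dotpC e p) pp ee pe.
by rewrite -[RHS](cos2Dsin2 c); ring.
Qed.

Lemma polar_point p (e : 'rV[R]_n.+2) c : dotp e e = 1 -> dotp (vec p) e = 0 ->
  0 <= c <= pi -> exists2 x, vec x = cos c *: vec p + sin c *: e & sdist p x = c.
Proof.
move=> ee pe cI.
exists (to_sphere (dotp_cos_sin c (dotp_vec p) ee pe)) => //.
by rewrite /sdist dotpDr !dotpZr dotp_vec pe mulr1 mulr0 addr0 cosK// in_itv.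
Qed.

End polar_decomposition.

(** * Law of the distance to the mean and integrability of [dev_dom] *)

Section population_marginal.
Context (R : realType) (m : nat).
Local Notation leb := (@lebesgue_measure R).
Local Notation mR := (measurableTypeR R).
Variables (mu : probability (sphere R m.+2) R) (p : sphere R m.+2) (f : R -> R).
Hypothesis hfm : measurable_fun `[0, pi] f.
Hypothesis hf0 : forall t, 0 <= t <= pi -> 0 <= f t.
Hypothesis hmu : forall A : set (sphere R m.+2), measurable A ->
  mu A = (\int[@volume R m.+2]_(q in A) (f (sdist p q))%:E)%E.

(** Up to the factor V, the density of the distance to p under mu. *)
Definition polar_weight (t : R) := sin t ^+ m.+1 * f t.
Local Notation W := polar_weight.
Local Notation V := (sphere_volume R m.+1).

Lemma measurable_polar_weight : measurable_fun (`[0, pi] : set mR) (W : mR -> mR).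
Proof. by apply: measurable_funM => //; exact: measurable_sinX. Qed.

Lemma polar_weight_ge0 t : 0 <= t <= pi -> 0 <= W t.
Proof. by move=> tI; rewrite mulr_ge0 ?hf0// exprn_ge0// sin_ge0_pi. Qed.

Lemma ge0_integral_mu_marginal (g : mR -> \bar R) : measurable_fun setT g ->
  (forall u, (0 <= g u)%E) ->
  (\int[mu]_q g (dotp (vec p) (vec q)) =
   \int[leb]_(t in `[0%R, pi]) ((V * W t)%:E * g (cos t)))%E.
Proof.
move=> mg g0; have [e e1 pe] := exists_perp (vec p).
pose G (z : mR * mR) := g z.1.
have mG : measurable_fun setT G by exact: (measurableT_comp mg measurable_fst).
apply: (etrans (ge0_integral_mu_pair hfm hf0 hmu e1 pe mG (fun z => g0 _))).
apply: eq_integral => t _; rewrite /G /= integral_cst//.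
rewrite [X in (_ * (_ * X))%E](vol_setT R m.+1).
by rewrite [(g _ * _)%E]muleC muleA -EFinM [_ * V]mulrC.
Qed.

Lemma integral_polar_weight : (\int[leb]_(t in `[0%R, pi]) (V * W t)%:E = 1)%E.
Proof.
have mu1 : (\int[mu]_q (cst 1 (dotp (vec p) (vec q))) = 1)%E.
  rewrite (@integral_cst _ _ R mu setT measurableT 1%E) mul1e.
  exact: probability_setT.
rewrite -[RHS]mu1.
apply/esym/(etrans (@ge0_integral_mu_marginal (cst 1%E) (@measurable_cst _ _ _ _ _ _) (fun=> lee01))).
by apply: eq_integral => t _; rewrite mule1.
Qed.

Lemma sphere_volume_gt0 : 0 < V.
Proof.
rewrite lt_neqAle -lee_fin -vol_setT measure_ge0 andbT; apply/eqP => V0.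
have := integral_polar_weight; rewrite -V0.
under eq_integral do rewrite mul0r.
by rewrite integral0 => /eqP; rewrite eqe eq_sym oner_eq0.
Qed.

Lemma integrable_polar_weight : leb.-integrable (`[0, pi] : set mR) (EFin \o W).
Proof.
have mW : measurable_fun (`[0, pi] : set mR) (EFin \o W).
  by apply/measurable_EFinP; exact: measurable_polar_weight.
apply/integrableP; split => //.
have W0 (t : mR) : [set` `[0 : R, pi]] t -> (0 <= (W t)%:E)%E.
  by rewrite /= in_itv/= lee_fin => /polar_weight_ge0.
rewrite (_ : integral _ _ _ = \int[leb]_(t in `[0%R, pi]) (W t)%:E)%E; last first.
  by apply: eq_integral => t /set_mem tI; rewrite gee0_abs// W0.
have := integral_polar_weight; have V0 := sphere_volume_gt0.
under eq_integral do rewrite EFinM.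
rewrite ge0_integralZl//; last by rewrite lee_fin ltW.
have := integral_ge0 _ W0; have := @ltey_eq.
move: (\int[_]_(_ in _) _)%E => -[r| |]//= _ _; rewrite ?ltry//.
by rewrite gt0_muley// lte_fin.
Qed.

Lemma mu_pole : (mu [set q | 1 <= `|dotp (vec p) (vec q)| ]%R = 0)%E.
Proof.
have mA : measurable [set u : mR | 1 <= `|u| ].
  rewrite (_ : [set _ | _] = [set` `]-oo, -1]] `|` [set` `[1, +oo[]).
    by apply: measurableU; exact: measurable_itv.
  by apply/seteqP; split => u /=; rewrite !in_itv/= andbT ler_normr lerNr; lra.
pose g (u : mR) : \bar R := (\1_[set u : mR | 1 <= `|u| ] u)%:E.
have mg : measurable_fun setT g by apply/measurable_EFinP; exact: measurable_indic.
have g0 u : (0 <= g u)%E by rewrite lee_fin.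
have mB : measurable ([set q | 1 <= `|dotp (vec p) (vec q)| ]%R : set (sphere R m.+2)).
  by have := measurable_dotp_vec (vec p) measurableT mA; rewrite setTI.
rewrite -[X in mu X]setIT -integral_indic//.
apply: (etrans (ge0_integral_mu_marginal mg g0)).
rewrite integral0_eq// => t; rewrite /= in_itv/= => tI; rewrite /g indicE.
have [s0|s0] := eqVneq (sin t) 0; first by rewrite /polar_weight s0 expr0n /= mul0r mulr0 mul0e.
rewrite [_ \in _](_ : _ = false) ?mule0//; apply/negbTE/negP; rewrite inE /= => h.
have : 0 < sin t ^+ 2 by rewrite exprn_even_gt0.
rewrite sin2cos2 subr_gt0 -(real_normK (num_real (cos t))) ltNge.
by rewrite exprn_ege1.
Qed.

Hypothesis hbounded : exists (U : set (sphere R m.+2)) (M : R),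
  [/\ open U, cut_locus p `<=` U & forall q, U q -> f (sdist p q) <= M].

(** Every t in [0, pi] is the distance from p to some point, so the bound near the cut locus becomes
    a bound on f near pi. *)
Lemma density_bounded_near_pi : exists e M : R, [/\ 0 < e, 0 <= M &
  forall t, 0 <= t <= pi -> cos t < -1 + e -> f t <= M].
Proof.
have [U [M [oU aU fM]]] := hbounded.
have [e e0 eU] : exists2 e : R, 0 < e & forall q, enorm (vec q - vec (antipode p)) < e -> U q.
  have : nbhs (antipode p) U by apply: open_nbhs_nbhs; split => //; exact: aU.
  rewrite nbhsE => -[B [[U' oU' <-] pU'] BU].
  have := oU'; rewrite openE => /(_ _ pU') /nbhs_ballP[e /= e0 eU]; exists e => // q qe.
  apply: BU; apply: eU; split=> // i j; rewrite ord1 /ball /=.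
  apply: le_lt_trans qe; rewrite enorm_distC.
  have := coord_le_enorm (vec (antipode p) - vec q) j; rewrite !mxE.
  exact: le_trans.
have [v v1 pv] := exists_perp (vec p).
(* The squared chord from q to the antipode is 2 + 2 cos t. *)
exists (2^-1 * e ^+ 2), (Num.max M 0); split; rewrite ?le_max ?lexx ?orbT//.
  by rewrite mulr_gt0// exprn_gt0.
move=> t tI ct; have [q qE <-] := polar_point v1 pv tI.
rewrite le_max fM//; apply: eU.
rewrite -ltr_sqr ?nnegrE ?enorm_ge0 ?(ltW e0)// sqr_enorm opprK.
have := dotp_vec p; have := dotp_vec q; rewrite !dotpDl !dotpDr => -> ->.
rewrite (dotpC _ (vec p)) qE dotpDr !dotpZr dotp_vec pv; lra.
Qed.

(** Near the antipode, 1 / sin t uses up one of the m + 1 sine factors of the polar weight, and the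
    remaining sin^m f is bounded by assumption. This is where the bounded density is used and where
    the dimension must be at least 2. *)
Lemma integral_dev_dom : (\int[mu]_q (dev_dom (dotp (vec p) (vec q)))%:E < +oo)%E.
Proof.
have [e [M [e0 M0 fM]]] := density_bounded_near_pi.
have m1 : measurable_fun setT (fun u : mR => (dev_dom (u : R))%:E).
  by apply/measurable_EFinP; exact: measurable_dev_dom.
have g0 (u : mR) : (0 <= (dev_dom (u : R))%:E)%E by rewrite lee_fin dev_dom_ge0.
rewrite (ge0_integral_mu_marginal m1 g0).
(* A bound for 1 / sin t on the obtuse angles with cos t >= -1 + e. *)
pose C := Num.max 1 ((Num.sqrt (1 - (-1 + e) ^+ 2))^-1).
have C1 : 1 <= C by rewrite le_max lexx.
have V0 := sphere_volume_gt0.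
pose B (t : mR) : mR := V * (5 + 2 * C) * W t + 2 * V * M.
have iB : leb.-integrable (`[0, pi] : set mR) (EFin \o B).
  have mI : measurable (`[0, pi] : set mR) by exact: measurable_itv.
  have iM : leb.-integrable (`[0, pi] : set mR) (EFin \o cst (2 * V * M)).
    apply: measurable_bounded_integrable => //.
      by rewrite [X in (X < _)%E](lebesgue_measure_itv `[0 : R, pi])/=; case: ifP => _; rewrite ltry.
    by exists (`|2 * V * M|); split=> // x Mx y _; exact: ltW.
  have iW := integrableZl mI (V * (5 + 2 * C)) integrable_polar_weight.
  by have := integrableD mI iW iM; congr (integrable _ _ _).
have mB : measurable_fun (`[0, pi] : set mR) (EFin \o B) by exact: measurable_int iB.
apply: (@le_lt_trans _ _ (\int[leb]_(t in `[0%R, pi]) (B t)%:E)%E); last first.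
  exact: integral_fune_lt_pinfty iB.
have W0 t : 0 <= t <= pi -> 0 <= V * W t.
  by move=> tI; rewrite mulr_ge0 ?(ltW V0)// polar_weight_ge0.
apply: ge0_le_integral => //.
- by move=> t; rewrite /= in_itv/= => tI; rewrite mule_ge0// lee_fin W0.
- apply: emeasurable_funM.
    by apply/measurable_EFinP; apply: measurable_funM => //; exact: measurable_polar_weight.
  apply: measurable_funTS; apply: (measurableT_comp m1).
  exact: (continuous_measurable_fun (@continuous_cos R)).
move=> t; rewrite /= in_itv/= => tI; rewrite -EFinM lee_fin /B.
have Wt := W0 _ tI; have C0 : 0 <= C by lra.
have VM : 0 <= 2 * V * M by rewrite !mulr_ge0// ltW.
rewrite /dev_dom; case: ifPn => [c0|_]; last by nra.
rewrite -sin2cos2 sqrtr_sqr ger0_norm ?sin_ge0_pi//.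
have [s0|s0] := eqVneq (sin t) 0.
  by rewrite /polar_weight s0 expr0n/= mul0r !mulr0 mul0r add0r.
have sgt : 0 < sin t by rewrite lt_neqAle eq_sym s0 sin_ge0_pi.
have [ct|ct] := ltP (cos t) (-1 + e).
  have -> : V * W t * (5 + 2 / sin t) = 5 * (V * W t) + 2 * V * (sin t ^+ m * f t).
    by rewrite /polar_weight exprS; field.
  have : sin t ^+ m * f t <= M.
    apply: le_trans (fM t tI ct); rewrite ler_piMl ?hf0// exprn_ile1 ?sin_le1//.
  by move=> h; have := ler_wpM2l (ltW V0) h; nra.
have : (sin t)^-1 <= C.
  rewrite le_max orbC -(ger0_norm (ltW sgt)) -sqrtr_sqr sin2cos2 lef_pV2 ?posrE ?sqrtr_gt0.
  - by rewrite ler_wsqrtr//; nra.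
  - by nra.
  - by nra.
by nra.
Qed.

End population_marginal.

(** * Consequences of rotational symmetry for the population *)

Section population_laws.
Context (R : realType) (m : nat).
Local Notation leb := (@lebesgue_measure R).
Local Notation mR := (measurableTypeR R).
Variables (mu : probability (sphere R m.+2) R) (p : sphere R m.+2) (f : R -> R).
Hypothesis hfm : measurable_fun `[0, pi] f.
Hypothesis hf0 : forall t, 0 <= t <= pi -> 0 <= f t.
Hypothesis hmu : forall A : set (sphere R m.+2), measurable A ->
  mu A = (\int[@volume R m.+2]_(q in A) (f (sdist p q))%:E)%E.
Local Notation W := (polar_weight m f).
Local Notation V := (sphere_volume R m.+1).

(** Rotational symmetry about p: the positive parts of both sides reduce to one polar integral that
    does not involve e, and so do the negative parts. *)
Lemma integral_mu_perp (e e' : 'rV[R]_m.+3) (F : mR * mR -> R) :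
  dotp e e = 1 -> dotp (vec p) e = 0 -> dotp e' e' = 1 -> dotp (vec p) e' = 0 ->
  measurable_fun setT F ->
  (\int[mu]_q (F (dotp (vec p) (vec q), dotp e (vec q)))%:E =
   \int[mu]_q (F (dotp (vec p) (vec q), dotp e' (vec q)))%:E)%E.
Proof.
move=> ee pe ee' pe' mF; rewrite [LHS]integralE [RHS]integralE.
pose Fp := (fun z => (F z)%:E)^\+%E; pose Fn := (fun z => (F z)%:E)^\-%E.
have mFE : measurable_fun setT (fun z => (F z)%:E) by exact/measurable_EFinP.
have mFp : measurable_fun setT Fp by exact: measurable_funepos.
have mFn : measurable_fun setT Fn by exact: measurable_funeneg.
have eqG G : measurable_fun setT G -> (forall z, (0 <= G z)%E) ->
   (\int[mu]_q G (dotp (vec p) (vec q), dotp e (vec q)) =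
    \int[mu]_q G (dotp (vec p) (vec q), dotp e' (vec q)))%E.
  move=> mG G0; apply: (etrans (ge0_integral_mu_pair hfm hf0 hmu ee pe mG G0)).
  exact: (esym (ge0_integral_mu_pair hfm hf0 hmu ee' pe' mG G0)).
have hp := eqG Fp mFp (funepos_ge0 _).
have hn := eqG Fn mFn (funeneg_ge0 _).
by move: hp hn; rewrite /Fp /Fn !unlock => -> ->.
Qed.

Lemma measurable_dev2 c : measurable_fun setT (fun z : mR * mR => dev2 c z.1 z.2).
Proof.
have mh : measurable_fun setT (@half_sqr_acos R : mR -> mR).
  by apply: measurable_funM => //; apply: measurable_funX; exact: measurable_acos.
have mv : measurable_fun setT (fun z : mR * mR => cos c * z.1 + sin c * z.2 : mR).
  by apply: measurable_funD; apply: measurable_funM.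
apply: measurable_funD.
  apply: measurable_funB; first exact: (measurableT_comp mh mv).
  exact: (measurableT_comp mh measurable_fst).
apply: measurable_funM => //; apply: measurable_funM => //.
exact: (measurableT_comp (@measurable_log_coef R) measurable_fst).
Qed.

Lemma Rintegral_dev_sdist x y : sdist p x = sdist p y ->
  \int[mu]_q dev p x q = \int[mu]_q dev p y q.
Proof.
move=> xy; have [e [e1 pe xE]] := polar_decomposition p x.
have [e' [e1' pe' yE]] := polar_decomposition p y.
have h := integral_mu_perp e1 pe e1' pe' (measurable_dev2 (sdist p x)).
congr fine; apply: (etrans _ (etrans h _)); apply: eq_integral => q _ /=.
  by rewrite (dev_polar _ pe xE).
by rewrite xy (dev_polar _ pe' yE).
Qed.

Lemma integrable_dotp_sphere_log (v : 'rV[R]_m.+3) :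
  mu.-integrable setT (EFin \o (fun q => dotp v (sphere_log p q))).
Proof.
apply: (@bounded_integrable _ _ _ mu _ (4 * enorm v)).
  exact: measurable_dotp_sphere_log.
exact: bounded_dotp_sphere_log.
Qed.

(** Exchanging e and -e changes the sign of the integral for a unit vector e orthogonal to p, so it
    vanishes; the component of v along p does not contribute as the logarithm is tangent. *)
Lemma Rintegral_dotp_sphere_log (v : 'rV[R]_m.+3) :
  \int[mu]_q dotp v (sphere_log p q) = 0.
Proof.
have unit (e : 'rV[R]_m.+3) : dotp e e = 1 -> dotp (vec p) e = 0 ->
    \int[mu]_q dotp e (sphere_log p q) = 0.
  move=> ee pe.
  have ee' : dotp (- e) (- e) = 1 by rewrite dotpNl dotpNr opprK.
  have pe' : dotp (vec p) (- e) = 0 by rewrite dotpNr pe oppr0.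
  pose F (z : mR * mR) : R := log_coef (z.1 : R) * z.2.
  have mF : measurable_fun setT F.
    apply: measurable_funM => //.
    exact: (measurableT_comp (@measurable_log_coef R) measurable_fst).
  have FE u : dotp (vec p) u = 0 -> forall q, F (dotp (vec p) (vec q), dotp u (vec q)) =
      dotp u (sphere_log p q).
    by move=> pu q; rewrite dotp_sphere_log_coef (dotpC u (vec p)) pu mulr0 subr0.
  have := integral_mu_perp ee pe ee' pe' mF.
  under eq_integral do rewrite FE//.
  under [X in _ = X -> _]eq_integral do rewrite FE//.
  move=> h; have : \int[mu]_q dotp e (sphere_log p q) = - \int[mu]_q dotp e (sphere_log p q).
    rewrite -mulN1r -RintegralZl//; last exact: integrable_dotp_sphere_log.
    rewrite /Rintegral h; congr fine; apply: eq_integral => q _.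
    by rewrite dotpNl mulN1r.
  by lra.
pose w := v - dotp (vec p) v *: vec p.
have pw : dotp (vec p) w = 0 by rewrite dotpBr dotpZr dotp_vec mulr1 subrr.
transitivity (\int[mu]_q dotp w (sphere_log p q)).
  apply: eq_Rintegral => q _.
  by rewrite dotpBl dotpZl dotp_base_sphere_log mulr0 subr0.
have [w0|w0] := eqVneq w 0.
  transitivity (\int[mu]_q (cst 0 q : R)); last by rewrite Rintegral_cst// mul0r.
  by apply: eq_Rintegral => q _; rewrite w0 dotp0l.
have e0 : enorm w != 0 by rewrite enorm_eq0.
have wE : w = enorm w *: ((enorm w)^-1 *: w) by rewrite scalerA mulfV// scale1r.
transitivity (enorm w * \int[mu]_q dotp ((enorm w)^-1 *: w) (sphere_log p q)).
  rewrite -RintegralZl//; last exact: integrable_dotp_sphere_log.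
  by apply: eq_Rintegral => q _; rewrite dotpZl mulrA mulfV// mul1r.
rewrite unit ?mulr0//; last by rewrite dotpZr pw mulr0.
by rewrite dotpZl dotpZr -sqr_enorm; field.
Qed.

End population_laws.

(** * The Hessian of the Fréchet function at the mean is alpha *)

Section population_curvature.
Context (R : realType) (m : nat).
Local Notation leb := (@lebesgue_measure R).
Local Notation mR := (measurableTypeR R).
Variables (mu : probability (sphere R m.+2) R) (p : sphere R m.+2) (f : R -> R).
Hypothesis hfm : measurable_fun `[0, pi] f.
Hypothesis hf0 : forall t, 0 <= t <= pi -> 0 <= f t.
Hypothesis hmu : forall A : set (sphere R m.+2), measurable A ->
  mu A = (\int[@volume R m.+2]_(q in A) (f (sdist p q))%:E)%E.
Hypothesis hbounded : exists (U : set (sphere R m.+2)) (M : R),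
  [/\ open U, cut_locus p `<=` U & forall q, U q -> f (sdist p q) <= M].
Local Notation W := (polar_weight m f).
Local Notation V := (sphere_volume R m.+1).

Let dom (q : sphere R m.+2) := dev_dom (dotp (vec p) (vec q)).

Lemma integrable_dev_dom : mu.-integrable setT (EFin \o dom).
Proof.
apply/integrableP; split.
  apply/measurable_EFinP.
  exact: (measurableT_comp (@measurable_dev_dom R) (measurable_dotp_vec (vec p))).
have := integral_dev_dom hfm hf0 hmu hbounded.
congr (_ < _)%E; apply: eq_integral => q _.
by rewrite gee0_abs// lee_fin dev_dom_ge0.
Qed.

Lemma ae_not_pole (Q : sphere R m.+2 -> Prop) :
  (forall q, `|dotp (vec p) (vec q)| < 1 -> Q q) -> {ae mu, forall q, Q q}.
Proof.
move=> hQ; exists [set q | 1 <= `|dotp (vec p) (vec q)| ]; split.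
- have mA : measurable [set u : mR | 1 <= `|u : R| ].
    rewrite (_ : [set _ | _] = [set` `]-oo, -1]] `|` [set` `[1, +oo[]).
      by apply: measurableU; exact: measurable_itv.
    by apply/seteqP; split => u /=; rewrite !in_itv/= andbT ler_normr lerNr; lra.
  by have := measurable_dotp_vec (vec p) measurableT mA; rewrite setTI.
- exact: mu_pole hfm hf0 hmu.
- by move=> q /= nQ; rewrite leNgt; apply/negP => /hQ.
Qed.

Lemma measurable_invr : measurable_fun setT (fun x : mR => x^-1 : mR).
Proof.
rewrite (_ : (fun _ => _) = fun x : mR => x * (x ^+ 2) `^ (-1)); last first.
  apply/funext => x; rewrite powR_inv1 ?sqr_ge0//.
  by have [->|x0] := eqVneq x 0; [rewrite invr0 mul0r|field].
apply: measurable_funM => //.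
have m2 : measurable_fun setT (fun x : mR => x ^+ 2 : mR) by exact: measurable_funX.
have mp := @measurable_powR R (-1).
exact: (measurableT_comp mp m2).
Qed.

Let measurable_mul_log_coef :
  measurable_fun setT (fun z : mR * mR => z.1 * log_coef (z.1 : R)).
Proof.
apply: measurable_funM => //.
exact: (measurableT_comp (@measurable_log_coef R) measurable_fst).
Qed.

Let measurable_sqr_ratio :
  measurable_fun setT (fun z : mR * mR => z.2 ^+ 2 / (1 - z.1 ^+ 2) : mR).
Proof.
apply: measurable_funM; first exact: measurable_funX.
apply: (measurableT_comp measurable_invr).
by apply: measurable_funB => //; apply: measurable_funX.
Qed.

Lemma measurable_dev2_limit :
  measurable_fun setT (fun z : mR * mR => dev2_limit (z.1 : R) z.2).
Proof.
apply: measurable_funM => //; apply: measurable_funD => //.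
by apply: measurable_funM => //; exact: measurable_funB.
Qed.

Let lim e q := dev2_limit (dotp (vec p) (vec q)) (dotp e (vec q)).

(** Dominated convergence along the geodesic leaving p in the direction e: [dev2_cvg] gives the
    pointwise limit and [normr_dev_le_sqr] the integrable majorant, both off the null set of the two
    poles. *)
Lemma dev_dominated (e : 'rV[R]_m.+3) (x : nat -> sphere R m.+2) (c : nat -> R) :
  dotp e e = 1 -> dotp (vec p) e = 0 ->
  (forall n, 0 < c n <= pi) -> c @ \oo --> (0 : R) ->
  (forall n, sdist p (x n) = c n) ->
  (forall n, vec (x n) = cos (c n) *: vec p + sin (c n) *: e) ->
  mu.-integrable setT (EFin \o lim e) /\
  (\int[mu]_q (dev p (x n) q / c n ^+ 2)) @[n --> \oo] --> \int[mu]_q lim e q.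
Proof.
move=> ee pe c0 cc xc xE.
pose F n q := (dev p (x n) q / c n ^+ 2)%:E.
have mF n : measurable_fun setT (F n).
  by apply/measurable_EFinP; apply: measurable_funM => //; exact: measurable_dev.
have mp : measurable_fun setT (fun q : sphere R m.+2 =>
    (dotp (vec p) (vec q), dotp e (vec q)) : mR * mR).
  by apply: measurable_fun_pair; exact: measurable_dotp_vec.
have ml : measurable_fun setT (EFin \o lim e).
  by apply/measurable_EFinP; exact: (measurableT_comp measurable_dev2_limit mp).
have Fl : {ae mu, forall q, setT q -> F ^~ q @ \oo --> (lim e q)%:E}.
  apply: ae_not_pole => q; rewrite ltr_norml => u1 _.
  apply: cvg_EFin; first exact: nearW.
  have /cvg_at_rightP h := @dev2_cvg R _ (dotp e (vec q)) u1.
  have := h c (conj (fun n => (andP (c0 n)).1) cc).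
  by under eq_fun do rewrite -(dev_polar _ pe (xE _)).
have Fd : {ae mu, forall q n, setT q -> (`|F n q| <= (dom q)%:E)%E}.
  apply: ae_not_pole => q u1 n _; rewrite /F abse_EFin lee_fin normrM normfV.
  have /andP[cn _] := c0 n.
  rewrite [`|c n ^+ 2|]ger0_norm ?sqr_ge0// ler_pdivrMr ?exprn_gt0//.
  by rewrite -xc normr_dev_le_sqr.
have [il _ cl] := dominated_convergence measurableT mF ml Fl integrable_dev_dom Fd.
split => //.
have iF n : mu.-integrable setT (F n).
  apply: (@bounded_integrable _ _ _ mu _ (16 * 2 / c n ^+ 2)).
    by apply/measurable_EFinP; exact: mF.
  move=> q; have /andP[cn _] := c0 n.
  rewrite normrM normfV [`|c n ^+ 2|]ger0_norm ?sqr_ge0// ler_wpM2r ?invr_ge0 ?sqr_ge0//.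
  rewrite (le_trans (normr_dev_le _ _ _))// ler_wpM2l//.
  exact: sdist_chord_le2.
have : (\int[mu]_q F n q)%E @[n --> \oo] --> (\int[mu]_q lim e q)%:E.
  by rewrite -integral_EFin_Rintegral.
move=> /fine_cvgP[_]; apply: cvg_trans; apply: near_eq_cvg; exact: nearW.
Qed.

Lemma Rintegral_one_sub_vol_coord2 :
  \int[vol R m.+1]_w (1 - vec w 0 0 ^+ 2) = V * (m.+1%:R / m.+2%:R).
Proof.
have b2 (w : sphere R m.+1) : `|vec w 0 0 ^+ 2| <= 1.
  rewrite normrX expr_le1// (le_trans (coord_le_enorm _ _))// enorm_vec//.
have i2 : (vol R m.+1).-integrable setT (EFin \o (fun w => vec w 0 0 ^+ 2)).
  apply: (@bounded_integrable _ _ _ (vol R m.+1) _ 1) => //.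
  by apply: measurable_funX; exact: measurable_vec_coord.
have i1 : (vol R m.+1).-integrable setT (EFin \o cst (1 : R)).
  by apply: (@bounded_integrable _ _ _ (vol R m.+1) _ 1) => // w; rewrite normr1.
rewrite (@RintegralB _ _ _ (vol R m.+1) setT (cst 1) (fun w => vec w 0 0 ^+ 2))//.
rewrite {2}/Rintegral integral_vol_coord2 Rintegral_cst//=.
rewrite (_ : fine (vol R m.+1 setT) = V); last by rewrite vol_setT.
have m0 : m.+1%:R + 1 != 0 :> R by rewrite natr1 pnatr_eq0.
have m2 : m.+2%:R = m.+1%:R + 1 :> R by rewrite natr1.
by rewrite m2; field.
Qed.

(** The defect 1 - t cot t times the polar weight, with the denominator sin t cancelled. *)
Let K (t : mR) : mR := sin t ^+ m * f t * (sin t - t * cos t).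

Let K_ge0 t : 0 <= t <= pi -> 0 <= K t.
Proof.
move=> tI; rewrite !mulr_ge0 ?exprn_ge0 ?sin_ge0_pi ?hf0// subr_ge0.
exact: mul_cos_le_sin.
Qed.

Let measurable_K : measurable_fun (`[0, pi] : set mR) K.
Proof.
apply: measurable_funM.
  by apply: measurable_funM => //; exact: measurable_sinX.
apply: measurable_funTS; apply: measurable_funB.
  exact: (continuous_measurable_fun (@continuous_sin R)).
apply: measurable_funM => //.
exact: (continuous_measurable_fun (@continuous_cos R)).
Qed.

(** Off the poles this is 1 - 2 [dev2_limit], factored; the absolute value makes it nonnegative
    everywhere, as the polar integration formula requires. *)
Let G (z : mR * mR) : \bar R :=
  `|(1 - z.1 * log_coef (z.1 : R)) * (1 - z.2 ^+ 2 / (1 - z.1 ^+ 2))|%:E.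

Let measurable_G : measurable_fun setT G.
Proof.
apply/measurable_EFinP; apply: measurableT_comp => //.
by apply: measurable_funM; exact: measurable_funB.
Qed.

Let k0 := V * (m.+1%:R / m.+2%:R).

Let slice t : 0 <= t < pi ->
  ((sin t ^+ m.+1 * f t)%:E * \int[vol R m.+1]_w G (cos t, sin t * vec w 0 0)%R =
   (k0 * K t)%:E)%E.
Proof.
move=> /andP[t0 tpi].
have [->|tn0] := eqVneq t 0.
  by rewrite /K sin0 expr0n/= mul0r !mul0r subrr !mulr0 mul0e.
have tI : 0 <= t <= pi by rewrite t0 ltW.
have sgt : 0 < sin t by apply: sin_gt0_pi; rewrite lt_neqAle eq_sym tn0 t0.
have Kt : 0 <= 1 - cos t * (t / sin t).
  by rewrite subr_ge0 mulrA ler_pdivrMr// mul1r mulrC mul_cos_le_sin.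
have GE (w : sphere R m.+1) : G (cos t, sin t * vec w 0 0) =
    ((1 - cos t * (t / sin t)) * (1 - vec w 0 0 ^+ 2))%:E.
  rewrite /G /= /log_coef cosK ?in_itv// -sin2cos2 sqrtr_sqr (gtr0_norm sgt) exprMn.
  rewrite [sin t ^+ 2 * _]mulrC mulfK ?expf_neq0 ?gt_eqF// ger0_norm// mulr_ge0//.
  rewrite subr_ge0 -[leLHS]ger0_norm ?sqr_ge0// normrX expr_le1//.
  by rewrite (le_trans (coord_le_enorm _ _))// enorm_vec.
under eq_integral do rewrite GE EFinM.
have i1 : (vol R m.+1).-integrable setT (EFin \o (fun w => 1 - vec w 0 0 ^+ 2)).
  apply: (@bounded_integrable _ _ _ (vol R m.+1) _ 2).
    apply: measurable_funB => //.
    by apply: measurable_funX; exact: measurable_vec_coord.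
  move=> w; rewrite (le_trans (ler_normB _ _))// normr1 -[leRHS]/(1 + 1) lerD2l normrX expr_le1//.
  by rewrite (le_trans (coord_le_enorm _ _))// enorm_vec.
rewrite integralZl// integral_EFin_Rintegral// Rintegral_one_sub_vol_coord2 -!EFinM.
congr EFin; rewrite /K exprS -/k0; field.
by rewrite gt_eqF.
Qed.

(** Put d = m + 2. The mean of 1 - cos^2 theta over directions is (d - 1) / d, so 1 - 2 lim
    integrates to V (d - 1) / d times the integral of K. On the other side, the derivative of t
    sin^(d-1) t is d sin^(d-1) t - (d - 1) sin^(d-2) t (sin t - t cos t). With V times the integral
    of W equal to 1, alpha is 1 minus the same quantity. *)
Lemma Rintegral_dev2_limit (e : 'rV[R]_m.+3) :
  dotp e e = 1 -> dotp (vec p) e = 0 ->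
  mu.-integrable setT (EFin \o lim e) ->
  \int[mu]_q lim e q = 2^-1 * alpha m.+2 f.
Proof.
move=> ee pe il.
have mI : measurable (`[0, pi] : set mR) by exact: measurable_itv.
have i1 : mu.-integrable setT (EFin \o (fun q => 1 - 2 * lim e q)).
  have icst : mu.-integrable setT (EFin \o cst (1 : R)).
    by apply: (@bounded_integrable _ _ _ mu _ 1) => // w; rewrite normr1.
  have := integrableB measurableT icst (integrableZl measurableT 2 il).
  by congr (integrable _ _ _).
have mp : measurable_fun setT (fun q : sphere R m.+2 =>
    (dotp (vec p) (vec q), dotp e (vec q)) : mR * mR).
  by apply: measurable_fun_pair; exact: measurable_dotp_vec.
have IG : (\int[mu]_q G (dotp (vec p) (vec q), dotp e (vec q)) =
    \int[mu]_q (1 - 2 * lim e q)%:E)%E.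
  apply: ae_eq_integral => //.
  - exact: (measurableT_comp measurable_G mp).
  - exact: measurable_int i1.
  apply: ae_not_pole => q u1 _; rewrite /G /lim /dev2_limit /=; congr EFin.
  set u := dotp _ _ in u1 *; set w := dotp _ _.
  have u2 : 0 < 1 - u ^+ 2 by rewrite subr_gt0 -(real_normK (num_real _)) expr_lt1.
  have bessel : w ^+ 2 <= 1 - u ^+ 2.
    have := dotp_ge0 (vec q - (u *: vec p + w *: e)).
    rewrite !(dotpDl, dotpDr, dotpNl, dotpNr, dotpZl, dotpZr) !dotp_vec ee.
    by rewrite (dotpC e (vec p)) pe (dotpC _ (vec p)) (dotpC _ e) -/u -/w; lra.
  have ku : 0 <= 1 - u * log_coef u.
    rewrite subr_ge0 /log_coef mulrA ler_pdivrMr ?sqrtr_gt0// mul1r.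
    rewrite -sin_acos ?dotp_vec_itv// mulrC.
    rewrite -[X in _ * X <= _]acosK ?in_itv/= ?dotp_vec_itv//.
    exact: mul_cos_le_sin (sdist_itv p q).
  rewrite ger0_norm; first by field; rewrite gt_eqF.
  by rewrite mulr_ge0// subr_ge0 ler_pdivrMr// mul1r.
have IK : (\int[leb]_(t in `[0%R, pi]) (k0 * K t)%:E = \int[mu]_q (1 - 2 * lim e q)%:E)%E.
  have G0 z : (0 <= G z)%E by rewrite lee_fin.
  rewrite -IG; apply/esym.
  apply: (etrans (ge0_integral_mu_pair hfm hf0 hmu ee pe measurable_G G0)).
  have mK0 : measurable_fun (`[0, pi] : set mR) (fun t => (k0 * K t)%:E).
    by apply/measurable_EFinP; exact: measurable_funM.
  (* The endpoint pi is dropped: for m = 0 the weight vanishes there while K need not. *)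
  have mK1 : measurable_fun (`[0, pi[ : set mR) (fun t => (k0 * K t)%:E).
    apply: measurable_funS mK0 => //.
    by move=> t /=; rewrite !in_itv/= => /andP[-> /ltW].
  have sl (t : mR) : t \in [set` `[0 : R, pi[] ->
     ((sin t ^+ m.+1 * f t)%:E * \int[vol R m.+1]_w G (cos t, sin t * vec w 0 0)%R =
     (k0 * K t)%:E)%E.
    by rewrite inE /= in_itv/= => /slice.
  rewrite -(integral_itv_bndo_bndc mK1) -integral_itv_bndo_bndc.
    exact: eq_integral.
  by apply: eq_measurable_fun mK1 => t tI; rewrite sl.
have m0 : m.+2%:R != 0 :> R by rewrite pnatr_eq0.
have V0 : 0 < V := sphere_volume_gt0 hfm hf0 hmu.
have k00 : 0 < k0 by rewrite mulr_gt0// divr_gt0.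
have iK : leb.-integrable (`[0, pi] : set mR) (EFin \o K).
  have iK0 : leb.-integrable (`[0, pi] : set mR) (fun t => (k0 * K t)%:E).
    apply/integrableP; split.
      by apply/measurable_EFinP; exact: measurable_funM.
    rewrite (_ : integral _ _ _ = \int[mu]_q (1 - 2 * lim e q)%:E)%E.
      exact: integral_fune_lt_pinfty i1.
    rewrite -IK; apply: eq_integral => t; rewrite inE /= in_itv/= => tI.
    by rewrite ger0_norm// mulr_ge0 ?K_ge0// ltW.
  have := integrableZl mI k0^-1 iK0; congr (integrable _ _ _).
  by apply/funext => t /=; rewrite -EFinM mulKf ?gt_eqF.
have iW := integrable_polar_weight hfm hf0 hmu.
have VW : V * \int[leb]_(t in `[0, pi]) W t = 1.
  by rewrite -RintegralZl// /Rintegral (integral_polar_weight hfm hf0 hmu).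
have kK : k0 * \int[leb]_(t in `[0, pi]) K t = 1 - 2 * \int[mu]_q lim e q.
  rewrite -RintegralZl// /Rintegral IK -/(Rintegral _ _ _).
  rewrite -/(Rintegral mu setT (fun q => 1 - 2 * lim e q)).
  have icst : mu.-integrable setT (EFin \o cst (1 : R)).
    by apply: (@bounded_integrable _ _ _ mu _ 1) => // w; rewrite normr1.
  have i2 : mu.-integrable setT (EFin \o (fun q => 2 * lim e q)).
    by have := integrableZl measurableT 2 il; congr (integrable _ _ _).
  rewrite (@RintegralB _ _ _ mu setT (cst 1) (fun q => 2 * lim e q))//.
  rewrite RintegralZl// Rintegral_cst// mul1r.
  by congr (_ - _); exact: (congr1 fine (probability_setT mu)).
rewrite /alpha.
have -> : \int[leb]_(t in `[0, pi]) (f t * derive1 (fun s : R => s * sin s ^+ m.+1) t) =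
   m.+2%:R * \int[leb]_(t in `[0, pi]) W t - m.+1%:R * \int[leb]_(t in `[0, pi]) K t.
  have iW2 : leb.-integrable (`[0, pi] : set mR) (EFin \o (fun t => m.+2%:R * W t)).
    by have := integrableZl mI m.+2%:R iW; congr (integrable _ _ _).
  have iK1 : leb.-integrable (`[0, pi] : set mR) (EFin \o (fun t => m.+1%:R * K t)).
    by have := integrableZl mI m.+1%:R iK; congr (integrable _ _ _).
  have is1 (t : R) : is_derive t (1 : R) (fun s : R => s * sin s ^+ m.+1)
      (sin t ^+ m * (sin t + m.+1%:R * t * cos t)).
    have isX : is_derive t (1 : R) (fun s : R => sin s ^+ m.+1) (m.+1%:R * sin t ^+ m * cos t).
      by have := is_deriveX m.+1 (is_derive_sin t); rewrite exprfctE.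
    apply: (is_derive_eq (is_deriveM _ isX)).
    by rewrite /GRing.scale /= exprS; ring.
  rewrite -RintegralZl// -[X in _ - X]RintegralZl// -RintegralB//.
  apply: eq_Rintegral => t _.
  rewrite derive1E; have [_ ->] := is1 t.
  rewrite /polar_weight /K exprS.
  have m2 : m.+2%:R = m.+1%:R + 1 :> R by rewrite natr1.
  by rewrite m2; ring.
rewrite -[m.+2.-1]/(m.+1).
have -> : V / m.+2%:R * (m.+2%:R * \int[leb]_(t in `[0, pi]) W t - m.+1%:R * \int[leb]_(t in `[0, pi]) K t)
   = V * \int[leb]_(t in `[0, pi]) W t - k0 * \int[leb]_(t in `[0, pi]) K t.
  by rewrite /k0; field.
by rewrite VW kK; field.
Qed.

End population_curvature.

(** * Growth of the population Fréchet function and second moment of [dev] *)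

Section population_growth.
Context (R : realType) (m : nat).
Local Notation mR := (measurableTypeR R).
Variables (mu : probability (sphere R m.+2) R) (p : sphere R m.+2) (f : R -> R).
Hypothesis hmean : frechet_mean_set mu = [set p].
Hypothesis hfm : measurable_fun `[0, pi] f.
Hypothesis hf0 : forall t, 0 <= t <= pi -> 0 <= f t.
Hypothesis hmu : forall A : set (sphere R m.+2), measurable A ->
  mu A = (\int[@volume R m.+2]_(q in A) (f (sdist p q))%:E)%E.
Hypothesis hbounded : exists (U : set (sphere R m.+2)) (M : R),
  [/\ open U, cut_locus p `<=` U & forall q, U q -> f (sdist p q) <= M].
Hypothesis halpha : 0 < alpha m.+2 f.
Local Notation a := (alpha m.+2 f).
Local Notation chord x := (enorm (vec x - vec p)).
Implicit Types x y q : sphere R m.+2.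

Definition popdev x := \int[mu]_q dev p x q.
Local Notation D := popdev.

Lemma integrable_dev x : mu.-integrable setT (EFin \o dev p x).
Proof.
apply: (@bounded_integrable _ _ _ mu _ 32); last exact: normr_dev_le32.
exact: measurable_dev.
Qed.

Lemma integrable_rho x : mu.-integrable setT (EFin \o rho x).
Proof.
apply: (@bounded_integrable _ _ _ mu _ 8); first exact: measurable_rho.
by move=> q; have /andP[r0 r8] := rho_itv x q; rewrite ger0_norm.
Qed.

(** The linear term of [dev] integrates to 0, so D is the increase of the Fréchet function from its
    value at p. *)
Lemma popdevE x : D x = \int[mu]_q rho x q - \int[mu]_q rho p q.
Proof.
have i1 : mu.-integrable setT (EFin \o (fun q => rho x q - rho p q)).
  have := integrableB measurableT (integrable_rho x) (integrable_rho p).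
  by congr (integrable _ _ _).
rewrite /popdev (@RintegralD _ _ _ mu setT (fun q => rho x q - rho p q)
  (fun q => dotp (vec x) (sphere_log p q)))//; last exact: integrable_dotp_sphere_log.
rewrite (Rintegral_dotp_sphere_log hfm hf0 hmu) addr0.
by rewrite (@RintegralB _ _ _ mu setT (rho x) (rho p))//; exact: integrable_rho.
Qed.

Lemma popdev_gt0 x : x <> p -> 0 < D x.
Proof.
move=> xp; rewrite ltNge; apply/negP => Dx; apply: xp.
have fE y : frechet_fun mu y = (\int[mu]_q rho y q)%:E.
  by rewrite -integral_EFin_Rintegral//; exact: integrable_rho.
have : frechet_mean_set mu p by rewrite hmean.
move=> pm; have : frechet_mean_set mu x; last by rewrite hmean.
move=> y; apply: le_trans (pm y); rewrite !fE lee_fin.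
by move: Dx; rewrite popdevE; lra.
Qed.

Let sqr_chord x : chord x ^+ 2 = 2 - 2 * cos (sdist p x).
Proof. by rewrite sqr_enorm_chord sdistC. Qed.

Let sdist_chord x : sdist p x <= 2 * chord x.
Proof. by rewrite enorm_distC sdist_le_chord. Qed.

Let chord_sdist x : chord x <= sdist p x.
Proof. by rewrite enorm_distC chord_le_sdist. Qed.

Lemma sqr_sdist_le_chord x : sdist p x <= 1 ->
  sdist p x ^+ 2 <= chord x ^+ 2 + 2 * sdist p x ^+ 3.
Proof.
have cI := sdist_itv p x; have /andP[c0 cpi] := cI => c1.
have h1 := subr_sin_le cI; have h2 := sin2cos2 (sdist p x).
have h3 : sin (sdist p x) ^+ 2 <= chord x ^+ 2.
  by rewrite sqr_chord h2; have := sqr_ge0 (1 - cos (sdist p x)); lra.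
have h4 : sdist p x * (1 - sdist p x) <= sin (sdist p x) by lra.
have h5 : 0 <= sdist p x * (1 - sdist p x) by rewrite mulr_ge0// subr_ge0.
have h6 : (sdist p x * (1 - sdist p x)) ^+ 2 <= sin (sdist p x) ^+ 2.
  by rewrite ler_sqr ?nnegrE// (le_trans h5).
nra.
Qed.

(** D depends on the distance to p only, so the expansion along one geodesic is automatically
    uniform in the direction. *)
Lemma popdev_sdist_cvg e : 0 < e -> exists2 delta, 0 < delta &
  forall x, sdist p x <= delta ->
    `|D x - a / 2 * sdist p x ^+ 2| <= e * sdist p x ^+ 2.
Proof.
move=> e0; have [v v1 pv] := exists_perp (vec p).
(* Clamping to [0, pi] gives a point of the geodesic for every real parameter. *)
pose cc (c : R) : R := Num.max 0 (Num.min c pi).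
have ccI c : 0 <= cc c <= pi.
  by rewrite /cc le_max lexx/= ge_max pi_ge0 ge_min lexx orbT.
have ccE c : 0 <= c <= pi -> cc c = c.
  by move=> /andP[c0 cpi]; rewrite /cc (min_idPl cpi) (max_idPr c0).
have /choice[x xE] : forall c, exists x,
   vec x = cos (cc c) *: vec p + sin (cc c) *: v /\ sdist p x = cc c.
  by move=> c; have [x ? ?] := polar_point v1 pv (ccI c); exists x.
have cv : D (x c) / (cc c) ^+ 2 @[c --> 0^'+] --> a / 2.
  apply/cvg_at_rightP => u [u0 uc].
  have cu : cc \o u @ \oo --> (0 : R).
    apply: (squeeze_cvgr _ (cvg_cst _) uc); apply: nearW => n /=.
    by have /andP[-> _] := ccI (u n); rewrite /cc ge_max (ltW (u0 n)) ge_min lexx.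
  have c0 n : 0 < (cc \o u) n <= pi.
    have /andP[_ ->] := ccI (u n); rewrite andbT /= /cc lt_max lt_min u0 pi_gt0.
    by rewrite orbT.
  have [il] := dev_dominated hfm hf0 hmu hbounded v1 pv c0 cu
    (fun n => (xE (u n)).2) (fun n => (xE (u n)).1).
  rewrite (Rintegral_dev2_limit hfm hf0 hmu v1 pv il) mulrC.
  apply: cvg_trans; apply: near_eq_cvg; apply: nearW => n /=.
  by rewrite RintegralZr//; exact: integrable_dev.
have /cvgrPdist_le/(_ _ e0) := cv.
rewrite near_withinE => /nbhs_ballP[d /= d0 hd].
exists (Num.min (d / 2) pi); first by rewrite lt_min pi_gt0 divr_gt0.
move=> y; rewrite le_min => /andP[yd ypi]; have /andP[y0 _] := sdist_itv p y.
have [y00|yn0] := eqVneq (sdist p y) 0.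
  rewrite y00 expr0n/= !mulr0 subr0.
  have -> : y = p; last first.
    by rewrite popdevE subrr normr0.
  by apply/eqP; rewrite -chord_eq0 eq_le enorm_ge0 andbT -y00 chord_sdist.
have ygt : 0 < sdist p y by rewrite lt_neqAle eq_sym yn0.
have yy := ccE _ (sdist_itv p y).
have := hd (sdist p y); rewrite /ball /= sub0r normrN (ger0_norm y0) => h.
have yd2 : sdist p y < d by apply: (le_lt_trans yd); lra.
move: (h yd2 ygt) => {h}; rewrite yy /popdev.
rewrite (@Rintegral_dev_sdist _ _ _ _ _ hfm hf0 hmu (x (sdist p y)) y); last first.
  by have [_ ->] := xE (sdist p y).
have s0 : 0 < sdist p y ^+ 2 by rewrite exprn_gt0.
rewrite -/(popdev y) => h; have -> : D y - a / 2 * sdist p y ^+ 2 =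
    - ((a / 2 - D y / sdist p y ^+ 2) * sdist p y ^+ 2).
  by rewrite [in RHS]mulrBl divfK ?gt_eqF// opprB.
by rewrite normrN normrM (gtr0_norm s0) ler_pM2r.
Qed.

Lemma popdev_chord_cvg e : 0 < e -> exists2 delta, 0 < delta &
  forall x, chord x <= delta -> `|D x - a / 2 * chord x ^+ 2| <= e * chord x ^+ 2.
Proof.
move=> e0; have e8 : 0 < e / 8 by rewrite divr_gt0.
have [d d0 hd] := popdev_sdist_cvg e8.
(* The angle is at most twice the chord: the thresholds keep it below d and below 1, and make alpha
   times the angle at most e / 16, which absorbs the cubic error of replacing angle by chord. *)
exists (Num.min (d / 2) (Num.min (1 / 2) (e / (32 * a)))).
  by rewrite !lt_min !divr_gt0// mulr_gt0.
move=> x; rewrite !le_min => /and3P[xd x1 xe].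
have sc := sdist_chord x; have := hd x; have cs := chord_sdist x.
have c0 : 0 <= chord x by exact: enorm_ge0.
have sd : sdist p x <= d by lra.
have s1 : sdist p x <= 1 by lra.
move=> /(_ sd); have := sqr_sdist_le_chord s1.
set s := sdist p x in sc cs sd s1 *; set c := enorm _ in xd x1 xe sc cs c0 *.
move=> h1 h2.
have s0 : 0 <= s by lra.
have ss : s ^+ 2 <= 4 * c ^+ 2 by nra.
have cs2 : c ^+ 2 <= s ^+ 2 by rewrite ler_sqr.
have sa : a * s <= e / 16.
  have a32 : 0 < 32 * a by rewrite mulr_gt0.
  have : 32 * a * c <= e by move: xe; rewrite (ler_pdivlMr _ _ a32) [c * _]mulrC.
  by have := ler_wpM2l (ltW halpha) sc; lra.
have h3 : a * s ^+ 3 <= e / 16 * s ^+ 2.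
  by rewrite exprS mulrA ler_wpM2r ?sqr_ge0.
rewrite (_ : D x - a / 2 * c ^+ 2 = (D x - a / 2 * s ^+ 2) + a / 2 * (s ^+ 2 - c ^+ 2)); last by ring.
rewrite (le_trans (ler_normD _ _))// [`|a / 2 * _|]ger0_norm; last first.
  by rewrite mulr_ge0 ?subr_ge0// divr_ge0// ltW.
have h4 : a / 2 * (s ^+ 2 - c ^+ 2) <= a * s ^+ 3.
  by have := ler_wpM2l (ltW halpha) h1; lra.
have h5 := ler_wpM2l (ltW e0) ss; have h6 := mulr_ge0 (ltW e0) (sqr_ge0 c).
by lra.
Qed.

Lemma normr_popdev_sub x y : `|D x - D y| <= 8 * sdist x y.
Proof.
rewrite /popdev -(@RintegralB _ _ _ mu setT (dev p x) (dev p y))//; [|exact: integrable_dev..].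
have icst : mu.-integrable setT (EFin \o cst (8 * sdist x y)).
  by apply: (@bounded_integrable _ _ _ mu _ `|8 * sdist x y|).
have id : mu.-integrable setT (EFin \o (fun q => dev p x q - dev p y q)).
  have := integrableB measurableT (integrable_dev x) (integrable_dev y).
  by congr (integrable _ _ _).
apply: (le_trans (le_normr_Rintegral measurableT id)).
have -> : 8 * sdist x y = \int[mu]_q (cst (8 * sdist x y) q).
  by rewrite Rintegral_cst// (_ : fine _ = 1) ?mulr1//; exact: (congr1 fine (probability_setT mu)).
apply: le_Rintegral => //; last by move=> q _; exact: normr_dev_sub.
have := integrable_norm id; congr (integrable _ _ _).
Qed.

(** Near p the expansion with error alpha / 4 suffices. Farther away D, a continuous function of the
    distance alone, has a positive minimum on a compact interval by uniqueness of the mean, and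
    squared chords are at most 4. *)
Lemma popdev_ge : exists2 c0, 0 < c0 & forall x, c0 * chord x ^+ 2 <= D x.
Proof.
have a4 : 0 < a / 4 by rewrite divr_gt0.
have [d d0 hd] := popdev_chord_cvg a4.
have near x : chord x <= d -> a / 4 * chord x ^+ 2 <= D x.
  by move=> /hd; rewrite ler_norml => /andP[h _]; lra.
pose d' := Num.min d pi.
have d'0 : 0 < d' by rewrite lt_min d0 pi_gt0.
have d'pi : d' <= pi by rewrite ge_min lexx orbT.
have [v v1 pv] := exists_perp (vec p).
pose cc (c : R) : R := Num.max 0 (Num.min c pi).
have ccI c : 0 <= cc c <= pi.
  by rewrite /cc le_max lexx/= ge_max pi_ge0 ge_min lexx orbT.
have ccE c : 0 <= c <= pi -> cc c = c.
  by move=> /andP[c0 cpi]; rewrite /cc (min_idPl cpi) (max_idPr c0).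
have /choice[x xE] : forall c, exists x,
   vec x = cos (cc c) *: vec p + sin (cc c) *: v /\ sdist p x = cc c.
  by move=> c; have [x ? ?] := polar_point v1 pv (ccI c); exists x.
have xd c c' : 0 <= c <= pi -> 0 <= c' <= pi -> sdist (x c) (x c') = `|c - c'|.
  move=> cI cI'; rewrite /sdist (xE c).1 (xE c').1 !ccE//.
  rewrite !(dotpDl, dotpDr, dotpZl, dotpZr) dotp_vec v1 (dotpC v) pv.
  rewrite !mulr0 !mulr1 addr0 add0r -cosB.
  have -> : cos (c - c') = cos `|c - c'|.
    by case: (ger0P (c - c')) => _; rewrite ?cosN.
  rewrite cosK// in_itv/= normr_ge0 ler_norml; lra.
have cont : {within `[d', pi], continuous (D \o x)}.
  have lip c c' : `|D (x c) - D (x c')| <= 8 * `|cc c - cc c'|.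
    have xcc b : x (cc b) = x b.
      by apply: vec_inj; rewrite (xE b).1 (xE (cc b)).1 (ccE _ (ccI b)).
    by rewrite -(xd _ _ (ccI c) (ccI c')) !xcc normr_popdev_sub.
  have ccl c c' : `|cc c - cc c'| <= `|c - c'|.
    have : - `|c - c'| <= c - c' <= `|c - c'| by rewrite -ler_norml.
    move: `|c - c'| (pi_gt0 R) => N pi0 /andP[n1 n2]; rewrite /cc ler_norml.
    case: (leP c pi) => ?; case: (leP c' pi) => ?;
      case: (leP 0 c) => ?; case: (leP 0 c') => ?; case: (leP 0 (@pi R)) => ?; lra.
  apply: continuous_subspaceT => c; apply/cvgrPdist_le => e e0.
  apply/nbhs_ballP; exists (e / 8) => /=; first by rewrite divr_gt0.
  move=> c' /= cc'; apply: (le_trans (lip _ _)).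
  have := ccl c c'; have : `|c - c'| < e / 8 by exact: cc'.
  by lra.
have [c cI cmin] := EVT_min d'pi cont.
have /andP[dc cpi] : d' <= c <= pi by move: cI; rewrite in_itv.
have c0 : 0 < c by exact: lt_le_trans dc.
have Dc : 0 < D (x c).
  apply: popdev_gt0 => xp; have := (xE c).2.
  rewrite xp ccE ?(ltW c0)// => cE.
  by have := chord_sdist p; have := sdist_chord p; rewrite cE subrr enorm0; lra.
exists (Num.min (a / 4) (D (x c) / 4)); first by rewrite lt_min a4 divr_gt0.
move=> y; have cy0 := sqr_ge0 (chord y).
have [yd|yd] := leP (chord y) d.
  apply: le_trans (near _ yd); rewrite ler_wpM2r// ge_min lexx//.
apply: (@le_trans _ _ (D (x c) / 4 * chord y ^+ 2)).
  by rewrite ler_wpM2r// ge_min lexx orbT.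
have yI := sdist_itv p y; have /andP[y0 ypi] := yI.
have -> : D y = D (x (sdist p y)).
  by apply: (Rintegral_dev_sdist hfm hf0 hmu); rewrite (xE _).2 ccE.
apply: (@le_trans _ _ (D (x c))); last first.
  apply: cmin; rewrite in_itv/= ypi andbT ge_min.
  by rewrite (le_trans (ltW yd) (chord_sdist y)).
have := sdist_chord_le2 y p; have := enorm_ge0 (vec y - vec p) => h1 h2.
have h4 : chord y ^+ 2 <= 4 by nra.
by nra.
Qed.

(** One factor of dev^2 gets the first order bound and the other the second order bound, so
    [dev_dom] enters to the first power; its square need not be integrable for m = 0. Any exponent
    above 2 would beat the Chebyshev denominator at scale 1 / sqrt k. *)
Lemma Rintegral_sqr_dev : exists2 C, 0 < C &
  forall x, \int[mu]_q (dev p x q ^+ 2) <= C * chord x ^+ 3.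
Proof.
have idom := integrable_dev_dom hfm hf0 hmu hbounded.
pose dom q := dev_dom (dotp (vec p) (vec q)).
have J0 : 0 <= \int[mu]_q dom q by apply: Rintegral_ge0 => q _; exact: dev_dom_ge0.
exists (1 + 64 * \int[mu]_q dom q) => [|x]; first by rewrite ltr_pwDl// mulr_ge0.
have c0 : 0 <= chord x := enorm_ge0 _.
have s2 : sdist p x ^+ 2 <= 4 * chord x ^+ 2.
  have /andP[s0 _] := sdist_itv p x; have := sdist_chord x; nra.
apply: (@le_trans _ _ (\int[mu]_q (64 * chord x ^+ 3 * dom q))); last first.
  rewrite RintegralZl//; have := exprn_ge0 3 c0; lra.
have i2 : mu.-integrable setT (EFin \o (fun q => dev p x q ^+ 2)).
  apply: (@bounded_integrable _ _ _ mu _ (32 ^+ 2)).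
    by apply: measurable_funX; exact: measurable_dev.
  by move=> q; rewrite normrX ler_sqr ?nnegrE// normr_dev_le32.
have id : mu.-integrable setT (EFin \o (fun q => 64 * chord x ^+ 3 * dom q)).
  have := integrableZl measurableT (64 * chord x ^+ 3) idom.
  by congr (integrable _ _ _).
apply: fine_le; [exact: integrable_fin_num i2|exact: integrable_fin_num id|].
apply: ae_ge0_le_integral => //.
- by move=> q _; rewrite lee_fin sqr_ge0.
- exact: measurable_int i2.
- by move=> q _; rewrite lee_fin !mulr_ge0 ?exprn_ge0 ?dev_dom_ge0.
- exact: measurable_int id.
apply: (ae_not_pole hfm hf0 hmu) => q u1 _; rewrite lee_fin.
have h1 := normr_dev_le p x q; have h2 := normr_dev_le_sqr x u1.
have d0 : 0 <= dom q by exact: dev_dom_ge0.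
rewrite -(real_normK (num_real _)) expr2.
apply: (le_trans (ler_pM _ _ h1 h2)) => //.
rewrite (_ : 64 * chord x ^+ 3 * dom q = 16 * chord x * (dom q * (4 * chord x ^+ 2))); last by ring.
by rewrite ler_wpM2l ?mulr_ge0// ler_wpM2l.
Qed.

End population_growth.

(** * Statements holding outside an event of small probability *)

Section with_high_probability.
Context d (Omega : measurableType d) (R : realType) (P : probability Omega R).
Implicit Types Q : Omega -> Prop.

(* [Q] itself need not be measurable. *)
Definition whp (eta : R) Q := exists B : set Omega,
  [/\ measurable B, (P B <= eta%:E)%E & forall w, ~ B w -> Q w].

Lemma whp_imp eta Q Q' : (forall w, Q w -> Q' w) -> whp eta Q -> whp eta Q'.
Proof. by move=> QQ' [B [mB PB BQ]]; exists B; split => // w /BQ /QQ'. Qed.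

Lemma whp_le eta eta' Q : eta <= eta' -> whp eta Q -> whp eta' Q.
Proof.
by move=> ee [B [mB PB BQ]]; exists B; split => //; apply: (le_trans PB); rewrite lee_fin.
Qed.

Lemma whpT Q : (forall w, Q w) -> whp 0 Q.
Proof. by move=> hQ; exists set0; split => //; rewrite measure0. Qed.

Lemma whp_and eta eta' Q Q' : whp eta Q -> whp eta' Q' ->
  whp (eta + eta') (fun w => Q w /\ Q' w).
Proof.
move=> [B [mB PB BQ]] [B' [mB' PB' BQ']]; exists (B `|` B'); split.
- exact: measurableU.
- by rewrite EFinD; apply: (le_trans (measureU2 _ _ _)) => //; exact: leeD.
- by move=> w /not_orP[/BQ ? /BQ' ?].
Qed.

Lemma whp_seq (I : eqType) (s : seq I) (eta : I -> R) (Q : I -> Omega -> Prop) :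
  (forall i, i \in s -> whp (eta i) (Q i)) ->
  whp (\sum_(i <- s) eta i) (fun w => forall i, i \in s -> Q i w).
Proof.
elim: s => [_|i s ih h].
  by rewrite big_nil; exact: whpT.
rewrite big_cons; have hi : whp (eta i) (Q i) by apply: h; rewrite mem_head.
have hs : whp (\sum_(j <- s) eta j) (fun w => forall j, j \in s -> Q j w).
  by apply: ih => j js; apply: h; rewrite inE js orbT.
apply: whp_imp (whp_and hi hs) => w [Qi Qs] j; rewrite inE => /orP[/eqP->//|].
exact: Qs.
Qed.

Lemma whp_forall (I : finType) (eta : I -> R) (Q : I -> Omega -> Prop) :
  (forall i, whp (eta i) (Q i)) -> whp (\sum_i eta i) (fun w => forall i, Q i w).
Proof.
move=> h; apply: whp_imp (whp_seq (s := index_enum I) (fun i _ => h i)).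
  by move=> w + i; apply; exact: mem_index_enum.
Qed.

End with_high_probability.

Section chebyshev_whp.
Context d (Omega : measurableType d) (R : realType) (P : probability Omega R).
Context d' (T : measurableType d').
Variables (X : nat -> {RV P >-> T}) (mu : probability T R).
Hypothesis hX : iid X mu.

Lemma chebyshev_whp (phi : T -> R) (M : R) (k : nat) (a V : R) :
  measurable_fun setT phi -> (forall x, `|phi x| <= M) -> (0 < k)%N -> 0 < a ->
  \int[mu]_x (phi x ^+ 2) <= V ->
  whp P (V / (k%:R * a ^+ 2))
    (fun w => `|k%:R^-1 * \sum_(i < k) phi (X i w) - \int[mu]_x phi x| < a).
Proof.
move=> mphi phiM k0 a0 hV.
exists [set w | a <= `|k%:R^-1 * \sum_(i < k) phi (X i w) - \int[mu]_x phi x| ]; split.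
- have mS : measurable_fun setT (fun w => `|k%:R^-1 * \sum_(i < k) phi (X i w) - \int[mu]_x phi x|).
    apply: measurableT_comp => //; apply: measurable_funB => //.
    apply: measurable_funM => //; apply: measurable_sum => i.
    exact: (measurableT_comp mphi (measurable_funPT (X i))).
  have := mS measurableT _ (measurable_itv `[a, +oo[); rewrite setTI.
  congr measurable; apply/seteqP; split => w /=; by rewrite in_itv/= andbT.
- apply: (le_trans (chebyshev_iid hX mphi phiM k0 a0)); rewrite lee_fin ler_wpM2r//.
  by rewrite invr_ge0 mulr_ge0// sqr_ge0.
- by move=> w /= /negP; rewrite -ltNge.
Qed.

End chebyshev_whp.

(** * A finite net on the sphere with convex interpolation *)

Section grid.
Context (R : realType).

(** Linear interpolation between the two consecutive nodes of mesh s / M that enclose v. *)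
Lemma interval_weights (M : nat) (v s : R) : (0 < M)%N -> 0 < s -> `|v| <= s ->
  exists t : 'I_M.*2.+1 -> R, [/\ forall i, 0 <= t i, \sum_i t i = 1,
    \sum_i t i * (s / M%:R * (i%:R - M%:R)) = v &
    forall i, t i != 0 -> `|s / M%:R * (i%:R - M%:R) - v| <= s / M%:R].
Proof.
move=> M0 s0 vs; have M0' : 0 < M%:R :> R by rewrite ltr0n.
set h := s / M%:R; have h0 : 0 < h by rewrite divr_gt0.
pose y := v / h + M%:R; have vE : v = h * (y - M%:R).
  by rewrite /y addrK mulrC divfK// gt_eqF.
have /andP[vh1 vh2] : - M%:R <= v / h <= M%:R.
  rewrite -ler_norml normrM normfV (gtr0_norm h0) ler_pdivrMr//.
  by rewrite /h mulrC divfK// gt_eqF.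
have y0 : 0 <= y by rewrite /y; lra.
have y2 : y <= M.*2%:R by rewrite -muln2 natrM /y; lra.
pose j := Num.truncn y.
have /andP[jy yj] : j%:R <= y < j.+1%:R by apply: truncn_itv.
(* The last node has no right neighbour. *)
have [y2'|yM] := eqVneq y M.*2%:R.
  exists (fun i => (i == ord_max)%:R); split.
  - by move=> i.
  - rewrite (bigD1 ord_max)//= eqxx big1 => [|i ne]; first by rewrite addr0.
    by rewrite (negbTE ne).
  - rewrite (bigD1 ord_max)//= eqxx big1 => [|i ne]; last by rewrite (negbTE ne) mul0r.
    by rewrite mul1r addr0 vE y2'.
  - move=> i; have [-> _|_] := eqVneq i ord_max; last by rewrite eqxx.
    by rewrite vE y2' /= subrr normr0 ltW.
have jM : (j < M.*2)%N.
  by rewrite -(ltr_nat R); apply: (le_lt_trans jy); rewrite lt_neqAle yM.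
pose j0 : 'I_M.*2.+1 := Ordinal (ltnW jM : (j < M.*2.+1)%N).
pose j1 : 'I_M.*2.+1 := Ordinal (jM : (j.+1 < M.*2.+1)%N).
have j10 : j1 != j0 by rewrite -val_eqE /= neq_ltn ltnSn orbT.
pose r := y - j%:R.
have r0 : 0 <= r by rewrite subr_ge0.
have r1 : r < 1 by move: yj; rewrite /r -natr1; lra.
exists (fun i => if i == j0 then 1 - r else if i == j1 then r else 0); split.
- by move=> i; case: ifP => _; [rewrite subr_ge0 ltW|case: ifP].
- rewrite (bigD1 j0)//= eqxx (bigD1 j1)//= (negbTE j10) eqxx big1 => [|i /andP[/negbTE -> /negbTE ->]//].
  by rewrite addr0 subrK.
- rewrite (bigD1 j0)//= eqxx (bigD1 j1)//= (negbTE j10) eqxx big1 => [|i /andP[/negbTE -> /negbTE ->]]; last by rewrite mul0r.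
  by rewrite addr0 vE /r -natr1; ring.
- move=> i; have [-> _|_] := eqVneq i j0.
    rewrite vE -mulrBr normrM (gtr0_norm h0) -[leRHS]mulr1 ler_pM2l// ler_norml /=.
    by move: r0 r1; rewrite /r; lra.
  have [-> _|_] := eqVneq i j1; last by rewrite eqxx.
  rewrite vE -mulrBr normrM (gtr0_norm h0) -[leRHS]mulr1 ler_pM2l// ler_norml /= -natr1.
  by move: r0 r1; rewrite /r; lra.
Qed.

End grid.

Section net.
Context (R : realType).

Lemma enorm_le_coord n (u : 'rV[R]_n) c : 0 <= c -> (forall j, `|u 0 j| <= c) ->
  enorm u <= n%:R * c.
Proof.
move=> c0 uc; rewrite -ler_sqr ?nnegrE ?enorm_ge0 ?mulr_ge0// sqr_enorm dotpE.
apply: (@le_trans _ _ (n%:R * c ^+ 2)).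
  rewrite mulr_natl -[X in _ *+ X](card_ord n) -sumr_const.
  by apply: ler_sum => j _; rewrite -expr2 -(real_normK (num_real _)) ler_sqr ?nnegrE.
rewrite exprMn ler_wpM2r ?sqr_ge0// -natrX ler_nat.
by case: n {u uc} => // n; rewrite expnS expn1 leq_pmulr.
Qed.

Definition grid_point n (M : nat) (s : R) (k : {ffun 'I_n -> 'I_M.*2.+1}) : 'rV[R]_n :=
  \row_j (s / M%:R * ((k j)%:R - M%:R)).

(** Multilinear interpolation: the weights are products of one-dimensional ones. Sums over all index
    functions factor by distributivity, and coordinate [j0] sees only its own barycenter, the other
    factors summing to 1. *)
Lemma grid_weights n (M : nat) (v : 'rV[R]_n) (s : R) : (0 < M)%N -> 0 < s ->
  (forall j, `|v 0 j| <= s) ->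
  exists l : {ffun 'I_n -> 'I_M.*2.+1} -> R, [/\ forall k, 0 <= l k, \sum_k l k = 1,
    \sum_k l k *: grid_point s k = v &
    forall k, l k != 0 -> enorm (grid_point s k - v) <= n%:R * (s / M%:R)].
Proof.
move=> M0 s0 vs.
have /choice[t tP] := fun j => interval_weights M0 s0 (vs j).
exists (fun k => \prod_j t j (k j)); split.
- by move=> k; apply: prodr_ge0 => j _; have [t0 _ _ _] := tP j.
- rewrite -(bigA_distr_bigA (fun j i => t j i))/= big1// => j _.
  by have [_ t1 _ _] := tP j.
- apply/rowP => j0; rewrite summxE.
  transitivity (\sum_(k : {ffun 'I_n -> 'I_M.*2.+1}) \prod_j (t j (k j) *
      (if j == j0 then s / M%:R * ((k j)%:R - M%:R) else 1))).
    apply: eq_bigr => k _; rewrite !mxE big_split/=; congr (_ * _).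
    rewrite (bigD1 j0)//= eqxx big1 ?mulr1// => j jj0.
    by rewrite (negbTE jj0).
  rewrite -(bigA_distr_bigA (fun j i => t j i *
      (if j == j0 then s / M%:R * ((i : 'I_M.*2.+1)%:R - M%:R) else 1)))/=.
  rewrite (bigD1 j0)//= [X in _ * X]big1 ?mulr1 => [|j jj0].
    by under eq_bigr do rewrite eqxx; have [_ _ -> _] := tP j0.
  by rewrite (negbTE jj0); under eq_bigr do rewrite mulr1; have [_ -> _ _] := tP j.
- move=> k lk; apply: enorm_le_coord; first by rewrite divr_ge0// ltW.
  move=> j; rewrite !mxE; have [_ _ _] := tP j; apply.
  by move/prodf_neq0: lk; apply.
Qed.

(** Radial projection moves u by | |u| - 1 |, which is at most |u - x| for x on the sphere; hence
    the factor 2. At u = 0 the direction is chosen to be p, hence the side condition. *)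
Lemma normalize_sphere n (p : sphere R n) (u : 'rV[R]_n.+1) : exists y : sphere R n,
  u = enorm u *: vec y /\
  forall x : sphere R n, (u = 0 -> x = p) -> enorm (vec y - vec x) <= 2 * enorm (u - vec x).
Proof.
have [->|u0] := eqVneq u 0.
  exists p; split; first by rewrite enorm0 scale0r.
  by move=> x /(_ erefl) ->; rewrite subrr enorm0 mulr_ge0 ?enorm_ge0.
have e0 : enorm u != 0 by rewrite enorm_eq0.
have v1 : dotp ((enorm u)^-1 *: u) ((enorm u)^-1 *: u) = 1.
  by rewrite dotpZl dotpZr -sqr_enorm; field.
exists (to_sphere v1); split; first by rewrite scalerA mulfV// scale1r.
move=> x _; rewrite -[vec (to_sphere v1)]/((enorm u)^-1 *: u).
apply: (le_trans (enorm_triangle u _ _)); rewrite mulr_natl mulr2n lerD2r.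
have -> : (enorm u)^-1 *: u - u = ((enorm u)^-1 - 1) *: u by rewrite scalerBl scale1r.
rewrite enormZ -{2}(ger0_norm (enorm_ge0 u)) -normrM mulrBl mulVf// mul1r.
rewrite ler_norml.
have := enormD (u - vec x) (vec x); have := enormD (vec x - u) u.
by rewrite !subrK enorm_vec (enorm_distC (vec x)); lra.
Qed.

(** A cubic grid around p is projected radially; its cardinality depends on n and M but not on s.
    Projection multiplies the weight of each node by its norm, and renormalizing the total weight
    produces the factor a. *)
Lemma sphere_net n (p : sphere R n) (M : nat) (s : R) : (0 < M)%N -> 0 < s ->
  exists y : {ffun 'I_n.+1 -> 'I_M.*2.+1} -> sphere R n,
    (forall k, enorm (vec (y k) - vec p) <= 2 * n.+1%:R * s) /\
    forall x, enorm (vec x - vec p) <= s ->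
    exists l : {ffun 'I_n.+1 -> 'I_M.*2.+1} -> R, exists a : R,
      [/\ forall k, 0 <= l k, \sum_k l k = 1, \sum_k l k *: vec (y k) = a *: vec x &
      forall k, l k != 0 -> enorm (vec (y k) - vec x) <= 2 * n.+1%:R * s / M%:R].
Proof.
move=> M0 s0; have M0' : 0 < M%:R :> R by rewrite ltr0n.
have /choice[y yP] := fun k : {ffun 'I_n.+1 -> 'I_M.*2.+1} =>
  normalize_sphere p (vec p + grid_point s k).
exists y; split => [k|x xs].
  have [_ /(_ p (fun=> erefl)) h] := yP k; apply: (le_trans h).
  rewrite addrAC subrr add0r -mulrA ler_pM2l//.
  apply: enorm_le_coord; first exact: ltW.
  move=> j; rewrite mxE normrM gtr0_norm ?divr_gt0// -mulrA ler_piMr ?(ltW s0)//.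
  rewrite ler_pdivrMl// mulr1 ler_norml.
  have : (k j)%:R <= M%:R * 2 :> R by rewrite -natrM muln2 ler_nat -ltnS.
  have : 0 <= (k j)%:R :> R by rewrite ler0n.
  by lra.
have xs' j : `|(vec x - vec p) 0 j| <= s by rewrite (le_trans (coord_le_enorm _ _)).
have [l [l0 l1 lx ln]] := grid_weights M0 s0 xs'.
pose u (k : {ffun 'I_n.+1 -> 'I_M.*2.+1}) := vec p + grid_point s k.
have ux : \sum_k l k *: u k = vec x.
  rewrite /u; under eq_bigr do rewrite scalerDr.
  by rewrite big_split/= -scaler_suml l1 scale1r lx addrC subrK.
pose S := \sum_k l k * enorm (u k).
have S0 : 0 < S.
  apply: (@lt_le_trans _ _ (enorm (vec x))); first by rewrite enorm_vec.
  rewrite -ux /S; elim/big_rec2: _ => [|k a b _ ab]; first by rewrite enorm0.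
  by rewrite (le_trans (enormD _ _))// enormZ ger0_norm// lerD2l.
exists (fun k => l k * enorm (u k) / S), S^-1; split.
- by move=> k; rewrite divr_ge0 ?(ltW S0)// mulr_ge0 ?enorm_ge0.
- by rewrite -mulr_suml mulfV// gt_eqF.
- rewrite -ux scaler_sumr; apply: eq_bigr => k _.
  by rewrite mulrC -!scalerA -(yP k).1.
- move=> k; rewrite !mulf_eq0 !negb_or => /andP[/andP[lk uk] _].
  have [_ /(_ x) h] := yP k; apply: (le_trans (h _)).
    by move=> u0; move: uk; rewrite /u u0 enorm0 eqxx.
  rewrite -!mulrA ler_pM2l// (_ : _ - vec x = grid_point s k - (vec x - vec p)).
    exact: ln.
  by rewrite opprB addrCA addrA.
Qed.

End net.

(** * Uniform control of the empirical deviation *)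

Section empirical_process.
Context d (Omega : measurableType d) (R : realType) (P : probability Omega R).
Context (n : nat).
Variables (mu : probability (sphere R n) R) (p : sphere R n).
Variables (X : nat -> {RV P >-> sphere R n}).
Hypothesis hX : iid X mu.
Implicit Types (x y q : sphere R n) (k : nat) (w : Omega).
Local Notation chord x := (enorm (vec x - vec p)).

(** Up to a constant in x, the sample Fréchet function at x is
    [edev k w x - dotp (vec x) (emean k w)]; see [edevE]. *)
Definition edev k w x := k%:R^-1 * \sum_(i < k) dev p x (X i w).
Definition emean k w := k%:R^-1 *: \sum_(i < k) sphere_log p (X i w).

Lemma frechet_fun_empirical k w x : (0 < k)%N ->
  frechet_fun (empirical X k w) x = (k%:R^-1 * \sum_(i < k) rho x (X i w))%:E.
Proof.
move=> k0; rewrite /frechet_fun /empirical.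
have mr : measurable_fun setT (fun q => (rho x q)%:E).
  by apply/measurable_EFinP; exact: measurable_rho.
have r0 q : (0 <= (rho x q)%:E)%E by rewrite lee_fin; have /andP[] := rho_itv x q.
have h := @ge0_integral_measure_sum _ _ R (fun i => \d_(X i w)) setT measurableT
  (fun q => (rho x q)%:E) (fun q _ => r0 q) mr k.
rewrite ge0_integral_mscale//; last by move=> q _; exact: r0.
rewrite EFinM -sumEFin; congr (_ * _)%E; apply: (etrans h).
by apply: eq_bigr => i _; rewrite integral_dirac// diracT mul1e.
Qed.

Lemma dotp_emean k w (v : 'rV[R]_n.+1) :
  dotp v (emean k w) = k%:R^-1 * \sum_(i < k) dotp v (sphere_log p (X i w)).
Proof. by rewrite /emean dotpZr dotp_sumr. Qed.

Lemma edevE k w x : edev k w x = k%:R^-1 * (\sum_(i < k) rho x (X i w)) -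
  k%:R^-1 * (\sum_(i < k) rho p (X i w)) + dotp (vec x) (emean k w).
Proof. by rewrite dotp_emean -mulrBr -mulrDr -sumrB -big_split. Qed.

Lemma dotp_base_emean k w : dotp (vec p) (emean k w) = 0.
Proof.
rewrite dotp_emean big1 ?mulr0// => i _; exact: dotp_base_sphere_log.
Qed.

Lemma edev_base k w : edev k w p = 0.
Proof. by rewrite edevE subrr dotp_base_emean addr0. Qed.

Lemma frechet_mean_edev k w y x : (0 < k)%N ->
  frechet_mean_set (empirical X k w) y ->
  edev k w y - dotp (vec y) (emean k w) <= edev k w x - dotp (vec x) (emean k w).
Proof.
move=> k0 /(_ x); rewrite !frechet_fun_empirical// lee_fin !edevE !addrK.
by rewrite lerD2r.
Qed.

Lemma edev_semiconcave k w (I : finType) (l : I -> R) (y : I -> sphere R n) (a : R) x :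
  (0 < k)%N ->
  (forall j, 0 <= l j) -> \sum_j l j = 1 -> \sum_j l j *: vec (y j) = a *: vec x ->
  \sum_j l j * edev k w (y j) <=
    edev k w x + 26 * \sum_j l j * enorm (vec (y j) - vec x) ^+ 2.
Proof.
move=> k0 l0 l1 lx; have k0' : 0 < k%:R :> R by rewrite ltr0n.
set S := 26 * _; rewrite -(ler_pM2l k0') mulrDr /edev mulVKf ?gt_eqF//.
rewrite mulr_sumr mulr_natl -[X in _ + _ *+ X](card_ord k) -sumr_const -big_split/=.
apply: (@le_trans _ _ (\sum_(i < k) \sum_j l j * dev p (y j) (X i w))).
  rewrite exchange_big/=; apply: ler_sum => j _.
  by rewrite mulrCA mulVKf ?gt_eqF// mulr_sumr.
by apply: ler_sum => i _; exact: (dev_semiconcave p (X i w) l0 l1 lx).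
Qed.

Variable C2 : R.
Hypothesis C20 : 0 < C2.
Hypothesis HC2 : forall x, \int[mu]_q (dev p x q ^+ 2) <= C2 * chord x ^+ 3.
Local Notation D x := (\int[mu]_q dev p x q).

(* The net has boundedly many points, of chordal distance O(s) from [p], so that
   by [HC2] each is controlled outside an event of probability O(s^3/(k s^4)). *)
Lemma uniform_edev (eta : R) : 0 < eta -> exists2 C, 0 < C &
  forall k s, (0 < k)%N -> 0 < s ->
  whp P (C / (k%:R * s)) (fun w => forall x, chord x <= s ->
    (forall b, (forall y, enorm (vec y - vec x) <= eta * s -> b <= D y) ->
       b - eta * s ^+ 2 <= edev k w x) /\
    exists2 y, enorm (vec y - vec x) <= eta * s & edev k w y <= D y + eta * s ^+ 2).
Proof.
move=> eta0; pose kap : R := 2 * n.+1%:R; have kap0 : 0 < kap by rewrite mulr_gt0.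
(* The two thresholds make the mesh kap s / M at most eta s and, as M <= M^2, the semiconcavity
   error 26 (kap s / M)^2 at most eta s^2 / 2. *)
pose M := (Num.truncn (Num.max (kap / eta) (52 * kap ^+ 2 / eta))).+1.
have M0 : 0 < M%:R :> R by rewrite ltr0n.
have [M1 M2] : kap / eta <= M%:R /\ 52 * kap ^+ 2 / eta <= M%:R.
  have := ltW (truncnS_gt (Num.max (kap / eta) (52 * kap ^+ 2 / eta))).
  by rewrite ge_max => /andP.
have hM1 : kap / M%:R <= eta by rewrite ler_pdivrMr// mulrC -ler_pdivrMr.
have hM2 : 26 * (kap / M%:R) ^+ 2 <= eta / 2.
  have M2' : M%:R <= M%:R ^+ 2 :> R by rewrite -natrX ler_nat expnS expn1 leq_pmulr.
  rewrite expr_div_n mulrA ler_pdivrMr ?exprn_gt0//.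
  apply: (@le_trans _ _ (eta / 2 * M%:R)); last by rewrite ler_wpM2l// divr_ge0// ltW.
  by move: M2; rewrite ler_pdivrMr//; lra.
pose N := #|{ffun 'I_n.+1 -> 'I_M.*2.+1}|.
exists (1 + N%:R * (C2 * kap ^+ 3 / (eta / 2) ^+ 2)).
  by rewrite ltr_pwDl// mulr_ge0// divr_ge0 ?sqr_ge0// mulr_ge0 ?exprn_ge0 ?ltW.
move=> k s k0 s0; have k0' : 0 < k%:R :> R by rewrite ltr0n.
have [y [yp net]] := sphere_net p (isT : (0 < M)%N) s0.
have es0 : 0 < eta / 2 * s ^+ 2 by rewrite mulr_gt0 ?exprn_gt0// divr_gt0.
have hy j : whp P (C2 * (kap * s) ^+ 3 / (k%:R * (eta / 2 * s ^+ 2) ^+ 2))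
    (fun w => `|edev k w (y j) - D (y j)| < eta / 2 * s ^+ 2).
  apply: (chebyshev_whp hX (measurable_dev p (y j)) (normr_dev_le32 p (y j)) k0 es0).
  apply: (le_trans (HC2 _)); rewrite ler_wpM2l ?(ltW C20)//.
  by rewrite lerXn2r ?nnegrE ?enorm_ge0 ?yp// mulr_ge0// ltW.
apply: (whp_le _ (whp_imp _ (whp_forall hy))).
  rewrite sumr_const -/N.
  have -> : C2 * (kap * s) ^+ 3 / (k%:R * (eta / 2 * s ^+ 2) ^+ 2) =
     (C2 * kap ^+ 3 / (eta / 2) ^+ 2) / (k%:R * s).
    by field; rewrite !gt_eqF.
  rewrite -[_ *+ N]mulr_natl [leLHS]mulrA ler_pM2r ?invr_gt0 ?mulr_gt0//.
  by rewrite lerDr.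
move=> w good x xs; have [l [a [l0 l1 lx ln]]] := net x xs.
have near j : l j != 0 -> enorm (vec (y j) - vec x) <= eta * s.
  move=> /ln /le_trans; apply; rewrite mulrAC ler_wpM2r// ltW//.
split.
(* By semiconcavity [edev] at x is bounded below by its average over the nodes interpolating x, all
   within eta s of x, where Chebyshev compares it with D. *)
- move=> b hb.
  have h1 := edev_semiconcave w k0 l0 l1 lx.
  have h2 : \sum_j l j * enorm (vec (y j) - vec x) ^+ 2 <= (kap / M%:R * s) ^+ 2.
    rewrite -[leRHS]mul1r -[X in X * _]l1 mulr_suml; apply: ler_sum => j _.
    have [->|lj] := eqVneq (l j) 0; first by rewrite !mul0r.
    have ks0 : 0 <= kap / M%:R * s by rewrite mulr_ge0 ?(ltW s0)// divr_ge0// ltW.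
    rewrite ler_wpM2l// lerXn2r ?nnegrE ?enorm_ge0//.
    by apply: (le_trans (ln j lj)); rewrite [leRHS]mulrAC.
  have h3 : b - eta / 2 * s ^+ 2 <= \sum_j l j * edev k w (y j).
    rewrite -[leLHS]mul1r -[X in X * _]l1 mulr_suml; apply: ler_sum => j _.
    have [->|lj] := eqVneq (l j) 0; first by rewrite !mul0r.
    rewrite ler_wpM2l//; have := good j; rewrite ltr_norml => /andP[g _].
    by have := hb _ (near j lj); lra.
  have h4 : 26 * (kap / M%:R * s) ^+ 2 <= eta / 2 * s ^+ 2.
    by rewrite exprMn mulrA ler_wpM2r ?sqr_ge0.
  by lra.
(* Semiconcavity gives no upper bound at x itself, so a node of nonzero weight stands in for it. *)
- have [j lj] : exists j, l j != 0.
    apply: contrapT => /forallNP nl; have := oner_neq0 R; rewrite -l1 big1 ?eqxx// => j _.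
    by apply/eqP; have /negP := nl j; rewrite negbK.
  exists (y j); first exact: near.
  by have := good j; rewrite ltr_norml => /andP[_ g]; nra.
Qed.

End empirical_process.

(** * The rate of convergence of sample means *)

Section rate.
Context d (Omega : measurableType d) (R : realType) (P : probability Omega R).
Context (n : nat).
Variables (mu : probability (sphere R n) R) (p : sphere R n).
Variables (X : nat -> {RV P >-> sphere R n}).
Hypothesis hX : iid X mu.
Implicit Types (x y q : sphere R n) (k : nat) (w : Omega).
Local Notation chord x := (enorm (vec x - vec p)).
Local Notation D x := (\int[mu]_q dev p x q).
Local Notation g := (emean p X).
Variable C2 : R.
Hypothesis C20 : 0 < C2.
Hypothesis HC2 : forall x, \int[mu]_q (dev p x q ^+ 2) <= C2 * chord x ^+ 3.
Variable c0 : R.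
Hypothesis c00 : 0 < c0.
Hypothesis Hc0 : forall x, c0 * chord x ^+ 2 <= D x.
Hypothesis Hlog : forall v, \int[mu]_q dotp v (sphere_log p q) = 0.

Lemma dotp_emean_le k w x : dotp (vec x) (g k w) <= chord x * enorm (g k w).
Proof.
rewrite -[leLHS]subr0 -(dotp_base_emean p X k w) -dotpBl.
exact: dotp_le.
Qed.

(** At a minimizer, comparison with p bounds [edev] by the inner product with g, hence by s |g|; in
    the shell of radius s, quadratic growth forces [edev] to be at least c0 s^2 / 32. *)
Lemma minimizer_scale_bound : exists2 C, 0 < C & forall k s, (0 < k)%N -> 0 < s ->
  whp P (C / (k%:R * s)) (fun w => forall x,
    frechet_mean_set (empirical X k w) x -> s / 2 < chord x <= s ->
    c0 / 32 * s <= enorm (g k w)).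
Proof.
(* Points within s / 4 of the shell still have chord at least s / 4, so that D >= c0 s^2 / 16 there;
   the error eta s^2 then uses up at most half of this. *)
pose eta := Num.min (1 / 4) (c0 / 32).
have eta0 : 0 < eta by rewrite lt_min !divr_gt0.
have [e4 e32] : eta <= 1 / 4 /\ eta <= c0 / 32.
  by rewrite !ge_min !lexx orbT.
have [C C0 h] := uniform_edev hX C20 HC2 eta0.
exists C => // k s k0 s0; apply: whp_imp (h k s k0 s0) => w hw x xm /andP[sx xs].
have [hb _] := hw x xs.
have s2 : 0 < s ^+ 2 by rewrite exprn_gt0.
have lo : c0 / 16 * s ^+ 2 - eta * s ^+ 2 <= edev p X k w x.
  apply: hb => y yx; apply: le_trans (Hc0 y).
  have := enorm_triangle (vec y) (vec x) (vec p); rewrite (enorm_distC (vec x) (vec y)) => t.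
  have es : eta * s <= s / 4 by have := ler_wpM2r (ltW s0) e4; lra.
  have ys : s / 4 <= chord y by lra.
  have : (s / 4) ^+ 2 <= chord y ^+ 2.
    by rewrite ler_sqr ?nnegrE ?enorm_ge0// divr_ge0// ltW.
  move=> /(ler_wpM2l (ltW c00)); apply: le_trans.
  by rewrite le_eqVlt; apply/orP; left; apply/eqP; field.
have := frechet_mean_edev p p k0 xm; rewrite edev_base dotp_base_emean subr0 => up.
have dl := dotp_emean_le k w x.
have es2 : eta * s ^+ 2 <= c0 / 32 * s ^+ 2 by rewrite ler_wpM2r// ltW.
have sg : chord x * enorm (g k w) <= s * enorm (g k w).
  by rewrite ler_wpM2r// enorm_ge0.
rewrite -(ler_pM2l s0); apply: le_trans sg.
have -> : s * (c0 / 32 * s) = c0 / 32 * s ^+ 2 by ring.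
lra.
Qed.

Lemma dyadic_scale (J : nat) (c : R) : c <= 2 ->
  c <= 2 / 2 ^+ J \/ exists2 j, (j < J)%N & 2 / 2 ^+ j / 2 < c <= 2 / 2 ^+ j.
Proof.
move=> c2; elim: J => [|J [cJ|[j jJ h]]].
- by left; rewrite expr0 divr1.
- have [cJ'|cJ'] := leP c (2 / 2 ^+ J.+1); first by left.
  right; exists J => //; rewrite cJ andbT; move: cJ'.
  by rewrite exprS invfM mulrA [2 / 2 / _]mulrAC mulrC mulrA.
- by right; exists j => //; exact: (leq_trans jJ).
Qed.

(** Peeling: chords are at most 2, and the radii 2 / 2^j are followed down to the order 1 / sqrt k.
    The failure probabilities C / (k s) form a geometric series dominated by the smallest radius, of
    total at most C / sqrt k. *)
Lemma minimizer_rate : exists2 C, 0 < C & forall k, (0 < k)%N ->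
  whp P (C / Num.sqrt k%:R) (fun w => forall x,
    frechet_mean_set (empirical X k w) x ->
    Num.sqrt k%:R * chord x <= Num.max 2 (32 / c0 * enorm (Num.sqrt k%:R *: g k w))).
Proof.
have [C C0 h] := minimizer_scale_bound; exists C => // k k0.
have k0' : 0 < k%:R :> R by rewrite ltr0n.
set r := Num.sqrt k%:R; have r0 : 0 < r by rewrite sqrtr_gt0.
have rr : r ^+ 2 = k%:R by rewrite sqr_sqrtr// ltW.
(* The base is 4 because 2^J has to approximate the square root of k. *)
have /andP[J1 J2] := trunc_log_bounds (isT : (1 < 4)%N) k0.
set J := trunc_log 4 k in J1 J2.
have J1' : 2 ^+ J <= r.
  rewrite -ler_sqr ?nnegrE ?exprn_ge0 ?(ltW r0)// rr -exprM mulnC exprM -!natrX.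
  by rewrite ler_nat.
have J2' : r <= 2 ^+ J.+1.
  rewrite -ler_sqr ?nnegrE ?exprn_ge0 ?(ltW r0)// rr -exprM mulnC exprM -!natrX.
  by rewrite ler_nat ltnW.
have sj0 j : 0 < 2 / 2 ^+ j :> R by rewrite divr_gt0// exprn_gt0.
have hs := whp_seq (s := iota 0 J.+1) (fun j _ => h k (2 / 2 ^+ j) k0 (sj0 j)).
apply: (whp_le _ (whp_imp _ hs)).
  have -> : C / r = C / k%:R * r by rewrite -rr; field; rewrite gt_eqF.
  have geo m : \sum_(j <- iota 0 m) C / (k%:R * (2 / 2 ^+ j)) <= C / k%:R * (2 ^+ m / 2).
    elim: m => [|m ih].
      by rewrite big_nil expr0 mulr_ge0// divr_ge0// ltW.
    rewrite -addn1 iotaD big_cat/= big_seq1 add0n.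
    rewrite addn1 exprS.
    have -> : C / (k%:R * (2 / 2 ^+ m)) = C / k%:R * (2 ^+ m / 2).
      by field; rewrite gt_eqF//= gt_eqF// exprn_gt0.
    lra.
  have ck : 0 <= C / k%:R by rewrite divr_ge0// ltW.
  apply: (le_trans (geo _)); rewrite (ler_wpM2l ck)//.
  by rewrite (_ : _ / 2 = 2 ^+ J)//; rewrite exprS; field.
move=> w hw x xm; rewrite le_max.
have [c2|[j jJ hj]] := dyadic_scale J.+1 (sdist_chord_le2 x p).
  apply/orP; left; rewrite mulrC -ler_pdivlMr//; apply: (le_trans c2).
  by rewrite ler_pM2l// lef_pV2 ?posrE ?exprn_gt0.
apply/orP; right; have jI : j \in iota 0 J.+1 by rewrite mem_iota.
have := hw j jI x xm hj; have /andP[_ xj] := hj.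
rewrite (enormZ r) (gtr0_norm r0) => h1; rewrite [leRHS]mulrCA (ler_pM2l r0).
apply: (le_trans xj).
have c320 : 0 <= 32 / c0 by rewrite divr_ge0// ltW.
apply: le_trans (ler_wpM2l c320 h1).
by rewrite mulrA (_ : 32 / c0 * (c0 / 32) = 1) ?mul1r//; field; rewrite gt_eqF.
Qed.

(** Chebyshev in each coordinate, 16 bounding the second moment as the logarithm has norm at most pi
    < 4. The cube counts the coordinates once and the squared comparison of norms twice. *)
Lemma emean_tight (B : R) k : 0 < B -> (0 < k)%N ->
  whp P (16 * n.+1%:R ^+ 3 / B ^+ 2) (fun w => enorm (Num.sqrt k%:R *: g k w) <= B).
Proof.
move=> B0 k0; have k0' : 0 < k%:R :> R by rewrite ltr0n.
set r := Num.sqrt k%:R; have r0 : 0 < r by rewrite sqrtr_gt0.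
have rr : r ^+ 2 = k%:R by rewrite sqr_sqrtr// ltW.
pose a := B / (n.+1%:R * r); have a0 : 0 < a by rewrite divr_gt0// mulr_gt0.
have hc (j : 'I_n.+1) : whp P (16 / (k%:R * a ^+ 2)) (fun w => `|g k w 0 j| < a).
  have b4 q : `|dotp (delta_mx 0 j) (sphere_log p q)| <= 4.
    apply: (le_trans (bounded_dotp_sphere_log p _ q)).
    rewrite (_ : enorm _ = 1) ?mulr1// /enorm dotp_delta mxE !eqxx.
    by rewrite sqrtr1.
  have md := measurable_dotp_sphere_log p (delta_mx 0 j).
  have s16 : \int[mu]_q (dotp (delta_mx 0 j) (sphere_log p q) ^+ 2) <= 16.
    apply: (@le_trans _ _ (\int[mu]_q (cst 16 q))).
      apply: le_Rintegral => //.
      - apply: (@bounded_integrable _ _ _ mu _ (4 ^+ 2)); first exact: measurable_funX.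
        by move=> q; rewrite normrX ler_sqr ?nnegrE.
      - by apply: (@bounded_integrable _ _ _ mu _ `|16|).
      - move=> q _; rewrite -(real_normK (num_real _)) (_ : cst 16 q = 4 ^+ 2).
          by rewrite ler_sqr ?nnegrE.
        by rewrite /= expr2 -natrM.
    by rewrite Rintegral_cst// (_ : fine _ = 1) ?mulr1//; exact: (congr1 fine (probability_setT mu)).
  have := chebyshev_whp hX md b4 k0 a0 s16.
  rewrite Hlog; apply: whp_imp => w; rewrite subr0 -dotp_emean dotpC dotp_delta.
  exact.
apply: (whp_le _ (whp_imp _ (whp_forall hc))).
  rewrite sumr_const card_ord -[_ *+ _]mulr_natl -rr /a.
  rewrite le_eqVlt; apply/orP; left; apply/eqP; field.
  by rewrite !gt_eqF//= ltr0n.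
move=> w hw; rewrite (enormZ r) (gtr0_norm r0).
have := enorm_le_coord (ltW a0) (fun j => ltW (hw j)).
move=> /(ler_wpM2l (ltW r0)) /le_trans; apply.
rewrite le_eqVlt; apply/orP; left; apply/eqP; rewrite /a; field.
by rewrite !gt_eqF//= ltr0n.
Qed.

End rate.

(** * Local expansion of the sample mean *)

Section sphere_log_expansion.
Context (R : realType) (n : nat).
Implicit Types p x : sphere R n.

Lemma sphere_log_chord p x :
  enorm (sphere_log p x - (vec x - vec p)) <= 24 * enorm (vec x - vec p) ^+ 2.
Proof.
set t := sdist p x; set c := enorm _ ^+ 2.
have tI : 0 <= t <= pi := sdist_itv p x; have /andP[t0 tpi] := tI.
have t2 : t ^+ 2 <= 4 * c.
  have := sdist_le_chord p x; rewrite enorm_distC -/t => h.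
  rewrite (_ : 4 * c = (2 * enorm (vec x - vec p)) ^+ 2); last by rewrite /c; ring.
  by rewrite ler_sqr ?nnegrE ?mulr_ge0 ?enorm_ge0.
have -> : sphere_log p x - (vec x - vec p) =
    (t / sin t - 1) *: sphere_perp p x + (1 - cos t) *: vec p.
  rewrite sphere_logE -/t /sphere_perp -/t.
  by apply/rowP => j; rewrite !mxE; ring.
rewrite (le_trans (enormD _ _))// !enormZ enorm_vec mulr1 enorm_sphere_perp -/t.
have s0 := sin_ge0_pi tI; have sl := sin_le t0; have sb := subr_sin_le tI.
have c1 : `|1 - cos t| <= t ^+ 2.
  rewrite ger0_norm ?subr_ge0 ?cos_le1//.
  by apply: (le_trans (oneBcos_le t0)); have := sqr_ge0 t; lra.
suff : `|t / sin t - 1| * sin t <= t ^+ 2 by have := sqr_ge0 t; lra.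
have [->|s1] := eqVneq (sin t) 0; first by rewrite mulr0 sqr_ge0.
rewrite -{2}(ger0_norm s0) -normrM mulrBl divfK// mul1r ger0_norm//.
by rewrite subr_ge0.
Qed.

End sphere_log_expansion.

Section local_expansion.
Context d (Omega : measurableType d) (R : realType) (P : probability Omega R).
Context (n : nat).
Variables (mu : probability (sphere R n) R) (p : sphere R n).
Variables (X : nat -> {RV P >-> sphere R n}).
Hypothesis hX : iid X mu.
Implicit Types (x y q : sphere R n) (k : nat) (w : Omega).
Local Notation chord x := (enorm (vec x - vec p)).
Local Notation D x := (\int[mu]_q dev p x q).
Local Notation g := (emean p X).
Variable C2 : R.
Hypothesis C20 : 0 < C2.
Hypothesis HC2 : forall x, \int[mu]_q (dev p x q ^+ 2) <= C2 * chord x ^+ 3.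
Variable c0 : R.
Hypothesis c00 : 0 < c0.
Hypothesis Hc0 : forall x, c0 * chord x ^+ 2 <= D x.
Hypothesis Hlog : forall v, \int[mu]_q dotp v (sphere_log p q) = 0.
Variable a : R.
Hypothesis a0 : 0 < a.
Hypothesis Hloc : forall e, 0 < e -> exists2 delta, 0 < delta &
  forall x, chord x <= delta -> `|D x - a / 2 * chord x ^+ 2| <= e * chord x ^+ 2.

Lemma sqrt_nat_large (c : R) : exists k0, forall k, (k0 <= k)%N ->
  (0 < k)%N /\ c <= Num.sqrt k%:R.
Proof.
exists (Num.truncn (c ^+ 2)).+1 => k ck; split; first exact: leq_trans ck.
rewrite (le_trans (ler_norm c))// -sqrtr_sqr ler_wsqrtr// ltW//.
by apply: (lt_le_trans (truncnS_gt _)); rewrite ler_nat.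
Qed.

Lemma minimizer_tight (eta : R) : 0 < eta -> exists2 B, 0 < B & exists k0, forall k,
  (k0 <= k)%N -> whp P eta (fun w => enorm (Num.sqrt k%:R *: g k w) <= B /\
    forall x, frechet_mean_set (empirical X k w) x -> Num.sqrt k%:R * chord x <= B).
Proof.
move=> eta0; have [C C0 hr] := minimizer_rate hX C20 HC2 c00 Hc0.
pose B0 := Num.max 1 (16 * n.+1%:R ^+ 3 / (eta / 2)).
have B01 : 1 <= B0 by rewrite le_max lexx.
have B00 : 0 < B0 by lra.
pose B := Num.max B0 (Num.max 2 (32 / c0 * B0)).
have [k0 hk] := sqrt_nat_large (2 * C / eta).
exists B; first by rewrite lt_max B00.
exists k0 => k /hk[k1 kC].
have r0 : 0 < Num.sqrt k%:R :> R by rewrite sqrtr_gt0 ltr0n.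
have := whp_and (emean_tight hX Hlog B00 k1) (hr k k1).
move=> h; apply: (whp_le _ (whp_imp _ h)).
  have : C / Num.sqrt k%:R <= eta / 2.
    by rewrite ler_pdivrMr// mulrC; move: kC; rewrite ler_pdivrMr//; lra.
  have : 16 * n.+1%:R ^+ 3 / B0 ^+ 2 <= eta / 2.
    have e2 : 0 < eta / 2 by rewrite divr_gt0.
    have : 16 * n.+1%:R ^+ 3 / (eta / 2) <= B0 by rewrite /B0 le_max lexx orbT.
    rewrite ler_pdivrMr// => hB; rewrite ler_pdivrMr ?exprn_gt0//.
    apply: (le_trans hB); rewrite mulrC ler_pM2l// expr2.
    by rewrite ler_peMl// ltW.
  by lra.
move=> w [gB hx]; split; first by rewrite /B le_max gB.
move=> x /hx /le_trans; apply; rewrite /B ge_max; apply/andP; split.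
  by rewrite !le_max lexx !orbT.
rewrite !le_max; apply/orP; right; apply/orP; right.
by rewrite ler_wpM2l// divr_ge0// ltW.
Qed.

(** Completing the square: with z = a v, the quadratic a/2 |u|^2 - <u, z> is a/2 |u - v|^2 up to a
    constant. *)
Lemma quadratic_comparison (u y v z : 'rV[R]_n.+1) (t : R) : z = a *: v ->
  a / 2 * enorm u ^+ 2 - dotp u z <= a / 2 * enorm y ^+ 2 - dotp y z + t ->
  a / 2 * enorm (u - v) ^+ 2 <= a / 2 * enorm (y - v) ^+ 2 + t.
Proof.
move=> ->; rewrite !sqr_enorm !(dotpBl, dotpBr) !dotpZr (dotpC v u) (dotpC v y).
lra.
Qed.

(** At the scale s = K / sqrt k the criterion is, up to errors of order th s^2, the quadratic a/2 |x
    - p|^2 - <x - p, g>, minimized at v = g / a. Comparing the sample mean with a point near p + v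
    gives |x - p - v|^2 <= th L s^2, and sqrt k s = K is fixed while th is as small as desired. *)
Lemma minimizer_expansion (eps eta : R) : 0 < eps -> 0 < eta ->
  exists k0, forall k, (k0 <= k)%N -> whp P eta (fun w => forall x,
    frechet_mean_set (empirical X k w) x ->
    enorm (Num.sqrt k%:R *: (vec x - vec p) - a^-1 *: (Num.sqrt k%:R *: g k w)) <= eps).
Proof.
move=> eps0 eta0; have eta2 : 0 < eta / 2 by rewrite divr_gt0.
have [B B0 [k1 hB]] := minimizer_tight eta2.
(* On the good event sqrt k times the chord of x is at most B and sqrt k |v| at most B / a; the 2
   pays for the radial projection of p + v. Thus both points lie within s of p. *)
pose K := B + 2 * (B / a).
have Ba0 : 0 < B / a by rewrite divr_gt0.
have K0 : 0 < K by rewrite /K; lra.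
(* Chosen so that a/2 L = 9 a/2 + 10, the sum of all coefficients of th s^2 collected at the end. *)
pose L := 9 + 20 / a; have L0 : 0 < L by rewrite addr_gt0// divr_gt0.
pose th := Num.min 1 (eps ^+ 2 / (K ^+ 2 * L)).
have th0 : 0 < th by rewrite lt_min ltr01 divr_gt0 ?exprn_gt0// mulr_gt0// exprn_gt0.
have th1 : th <= 1 by rewrite ge_min lexx.
have thL : th * (K ^+ 2 * L) <= eps ^+ 2.
  by rewrite -ler_pdivlMr ?mulr_gt0 ?exprn_gt0// ge_min lexx orbT.
have [C C0 hu] := uniform_edev hX C20 HC2 th0.
have [de de0 hde] := Hloc th0.
(* The three thresholds ensure, in order, that C / (k s) <= eta / 2, that 2 s <= de, and that s <=
   th. *)
have [k2 hk2] := sqrt_nat_large (Num.max (C / K / (eta / 2)) (Num.max (2 * K / de) (K / th))).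
exists (maxn k1 k2) => k; rewrite geq_max => /andP[/hB tight /hk2[k0]].
rewrite !ge_max => /and3P[kC kde kth].
have k0' : 0 < k%:R :> R by rewrite ltr0n.
set r := Num.sqrt k%:R in tight kC kde kth *.
have r0 : 0 < r by rewrite sqrtr_gt0.
have rr : r ^+ 2 = k%:R by rewrite sqr_sqrtr// ltW.
pose s := K / r; have s0 : 0 < s by rewrite divr_gt0.
have rs : r * s = K by rewrite mulrC divfK// gt_eqF.
have s2 : 0 < s ^+ 2 by rewrite exprn_gt0.
have sde : 2 * s <= de.
  by rewrite /s mulrA ler_pdivrMr// [de * r]mulrC -ler_pdivrMr//.
have sth : s <= th by rewrite /s ler_pdivrMr// [th * r]mulrC -ler_pdivrMr//.
apply: (whp_le _ (whp_imp _ (whp_and tight (hu k s k0 s0)))).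
  suff : C / (k%:R * s) <= eta / 2 by lra.
  have -> : C / (k%:R * s) = C / K / r.
    by rewrite -rr /s; field; rewrite !gt_eqF.
  by rewrite ler_pdivrMr// [_ * r]mulrC -ler_pdivrMr//.
move=> w [[gB hx] hw] x xm.
pose v := a^-1 *: g k w.
have rv : r * enorm v <= B / a.
  rewrite /v enormZ gtr0_norm ?invr_gt0// mulrCA mulrC ler_pM2r ?invr_gt0//.
  by move: gB; rewrite (enormZ r) (gtr0_norm r0).
have v0 := enorm_ge0 v.
have vs : 2 * enorm v <= s.
  rewrite -(ler_pM2l r0) rs /K mulrCA; lra.
have xs : chord x <= s.
  by rewrite -(ler_pM2l r0) rs (le_trans (hx x xm))// /K; lra.
(* the comparison point is the projection to the sphere of p + v *)
have [x' [x'E x'd]] := normalize_sphere p (vec p + v).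
have pv : dotp (vec p) v = 0 by rewrite dotpZr dotp_base_emean mulr0.
have x's : chord x' <= s.
  have := x'd p (fun=> erefl); rewrite addrAC subrr add0r.
  by move=> /le_trans; apply.
have x'v : enorm (vec x' - vec p - v) <= th * s.
  set u := vec p + v in x'E.
  have u2 : enorm u ^+ 2 = 1 + enorm v ^+ 2.
    by rewrite !sqr_enorm dotpDl !dotpDr dotp_vec (dotpC v) pv; ring.
  have u1 : 1 <= enorm u.
    rewrite -ler_sqr ?nnegrE ?enorm_ge0// u2 expr1n lerDl sqr_ge0//.
  have -> : vec x' - vec p - v = (1 - enorm u) *: vec x'.
    by rewrite scalerBl scale1r -x'E /u opprD addrA.
  rewrite enormZ enorm_vec mulr1 ler0_norm ?subr_le0// opprB.
  have v2 : enorm v ^+ 2 <= th * s.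
    have := ler_wpM2r (ltW s0) sth; nra.
  by have := sqr_ge0 (enorm u - 1); nra.
(* The upper bound is available only at some y within th s of the projected point, so y is the
   actual competitor of x. *)
have [hlo _] := hw x xs; have [_ [y yx' hy]] := hw x' x's.
have ths : th * s <= s by rewrite ler_piMl// ltW.
have ch2 z : chord z <= 2 * s -> chord z ^+ 2 <= 4 * s ^+ 2.
  have := enorm_ge0 (vec z - vec p); nra.
have lower : a / 2 * chord x ^+ 2 - th * (5 * a / 2 + 5) * s ^+ 2 <= edev p X k w x.
  have b1 : a / 2 * chord x ^+ 2 - th * (5 * a / 2 + 4) * s ^+ 2 - th * s ^+ 2 <= edev p X k w x.
    apply: hlo => z zx.
    have xz : chord x <= chord z + th * s.
      have := enorm_triangle (vec z) (vec x) (vec p).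
      by rewrite (enorm_distC (vec x) (vec z)); lra.
    have zs : chord z <= 2 * s by have := enorm_triangle (vec x) (vec z) (vec p); lra.
    have := hde z (le_trans zs sde); rewrite ler_norml => /andP[h1 _].
    have h2 := ler_wpM2l (ltW th0) (ch2 z zs).
    have h3 : chord x ^+ 2 <= chord z ^+ 2 + 5 * th * s ^+ 2.
      have z0 := enorm_ge0 (vec z - vec p); have x0 := enorm_ge0 (vec x - vec p).
      have h4 : chord x ^+ 2 <= (chord z + th * s) ^+ 2.
        by rewrite ler_sqr ?nnegrE ?addr_ge0// mulr_ge0// ltW.
      have h5 := ler_wpM2l (mulr_ge0 (ltW th0) (ltW s0)) zs.
      have h6 := ler_wpM2l (mulr_ge0 (ltW th0) (ltW s0)) ths.
      by lra.
    have h7 := ler_wpM2l (ltW a0) h3; lra.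
  by lra.
have ys : chord y <= 2 * s.
  by have := enorm_triangle (vec x') (vec y) (vec p); lra.
have upper : edev p X k w y <= a / 2 * chord y ^+ 2 + 5 * th * s ^+ 2.
  have := hde y (le_trans ys sde); rewrite ler_norml => /andP[_ h1].
  have := ler_wpM2l (ltW th0) (ch2 y ys); lra.
have opt := frechet_mean_edev p y k0 xm.
have sq : a / 2 * enorm ((vec x - vec p) - v) ^+ 2 <=
    a / 2 * enorm ((vec y - vec p) - v) ^+ 2 + th * (5 * a / 2 + 10) * s ^+ 2.
  apply: (@quadratic_comparison _ _ _ (g k w)).
    by rewrite /v scalerA mulfV ?scale1r// gt_eqF.
  by rewrite !dotpBl !dotp_base_emean !subr0; lra.
have yv : enorm ((vec y - vec p) - v) ^+ 2 <= 4 * th * s ^+ 2.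
  have : enorm ((vec y - vec p) - v) <= 2 * (th * s).
    have := enormD (vec y - vec x') (vec x' - vec p - v).
    by rewrite !addrA subrK; lra.
  move=> h; have ts0 : 0 <= th * s := mulr_ge0 (ltW th0) (ltW s0).
  apply: (@le_trans _ _ ((2 * (th * s)) ^+ 2)).
    by rewrite ler_sqr ?nnegrE ?enorm_ge0// mulr_ge0.
  have := ler_wpM2l (mulr_ge0 (ltW th0) (ltW s0)) ths; lra.
have fin : enorm ((vec x - vec p) - v) ^+ 2 <= th * L * s ^+ 2.
  rewrite -(ler_pM2l (divr_gt0 a0 (ltr0n R 2))); apply: (le_trans sq).
  have h1 := ler_wpM2l (ltW a0) yv.
  have -> : a / 2 * (th * L * s ^+ 2) = (9 * a / 2 + 10) * th * s ^+ 2.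
    by rewrite /L; field; rewrite gt_eqF.
  lra.
rewrite -ler_sqr ?nnegrE ?enorm_ge0 ?(ltW eps0)//.
rewrite scalerA mulrC -scalerA -/v -scalerBr (enormZ r) (gtr0_norm r0) exprMn.
apply: le_trans thL; rewrite -rs.
have -> : th * ((r * s) ^+ 2 * L) = r ^+ 2 * (th * L * s ^+ 2) by ring.
by rewrite ler_wpM2l// sqr_ge0.
Qed.

End local_expansion.

(** * Transfer of limits in distribution *)

Section slutsky.
Context (R : realType) (m : nat).

Lemma norm_le_enorm (u : 'rV[R]_m) : `|u| <= enorm u.
Proof.
rewrite /Num.norm /= mx_normrE; apply: bigmax_le => [|[i j] _]; first exact: enorm_ge0.
by rewrite ord1; exact: coord_le_enorm.
Qed.

(** Compactness of the closed sup-norm ball yields one modulus for all its points; only u is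
    confined to the ball, the nearby v may leave it. *)
Lemma uniform_continuity_bounded (h : 'rV[R]_m -> R) (B e : R) : continuous h -> 0 < e ->
  exists2 de, 0 < de & forall u v, enorm u <= B -> enorm (u - v) <= de ->
    `|h u - h v| <= e.
Proof.
move=> ch e0.
pose A := [set u : 'rV[R]_m | `|u| <= B].
have cA : compact A.
  apply: bounded_closed_compact.
    by exists B; split; [exact: num_real|move=> M BM u /= uB; exact: le_trans (ltW BM)].
  have -> : A = (fun u : 'rV[R]_m => `|u|) @^-1` [set x | x <= B] by [].
  by apply: closed_comp; [move=> u _; exact: norm_continuous|exact: closed_le].
pose Q (de : R) (u : 'rV[R]_m) := forall v, `|u - v| <= de -> `|h u - h v| <= e.
have near x : A x -> \forall x' \near x & de \near (0 : R)^'+, Q de x'.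
  move=> _; have e2 : 0 < e / 2 by rewrite divr_gt0.
  have /cvgrPdist_lt/(_ _ e2)/nbhs_ballP[r /= r0 hr] := ch x.
  exists (ball x (r / 2), [set de | de < r / 2]) => /=.
    split; first by apply: nbhsx_ballx; rewrite divr_gt0.
    by apply: nbhs_right_lt; rewrite divr_gt0.
  move=> [u de] /= [xu der] v uv.
  have xu' : `|x - u| < r / 2 by move: xu; rewrite -ball_normE.
  have hu := hr u; have hv := hr v; move: hu hv; rewrite -!ball_normE /=.
  have xv : `|x - v| < r.
    have -> : x - v = (x - u) + (u - v) by rewrite addrA subrK.
    by rewrite (le_lt_trans (ler_normD _ _))//; lra.
  have xur : `|x - u| < r by lra.
  move=> /(_ xur) + /(_ xv).
  rewrite !ltr_norml !ler_norml => /andP[h1 h2] /andP[h3 h4].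
  by apply/andP; split; lra.
have /compact_near_coveringP/(_ _ _ Q) := cA.
move=> /(_ _ _ near) => cov.
have [de [de0 hde]] : exists de : R, 0 < de /\ A `<=` Q de.
  near (0 : R)^'+ => de; exists de; split; first by near: de; exact: nbhs_right_gt.
  by near: de; exact: cov.
exists de => // u v uB uv; apply: hde; apply: le_trans (norm_le_enorm _) _ => //.
Unshelve. all: by end_near. Qed.

Context d (Omega : measurableType d) (P : probability Omega R).
Variables Y Y' : nat -> Omega -> 'rV[R]_m.
Hypothesis mY : forall k, measurable_fun setT (Y k).
Hypothesis mY' : forall k, measurable_fun setT (Y' k).
Hypothesis YY' : forall eps eta : R, 0 < eps -> 0 < eta -> exists k0, forall k,
  (k0 <= k)%N -> whp P eta (fun w => enorm (Y k w - Y' k w) <= eps).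
Hypothesis tightY' : forall eta : R, 0 < eta -> exists B, exists k0, forall k,
  (k0 <= k)%N -> whp P eta (fun w => enorm (Y' k w) <= B).

(** Outside a small event Y' is bounded and Y is close to it, so uniform continuity makes the two
    values of h close; on that event they differ by at most 2 M. *)
Lemma slutsky (h : 'rV[R]_m -> R) (M l : R) : continuous h -> (forall v, `|h v| <= M) ->
  (\int[P]_w (h (Y' k w))%:E)%E @[k --> \oo] --> l%:E ->
  (\int[P]_w (h (Y k w))%:E)%E @[k --> \oo] --> l%:E.
Proof.
move=> ch hM.
have mh (Z : Omega -> 'rV[R]_m) : measurable_fun setT Z -> measurable_fun setT (h \o Z).
  exact: continuous_measurable_row.
have ih (Z : Omega -> 'rV[R]_m) : measurable_fun setT Z ->
    P.-integrable setT (EFin \o (fun w => h (Z w))).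
  by move=> mZ; apply: (@bounded_integrable _ _ _ P _ M); [exact: mh|move=> w; exact: hM].
have iE (Z : Omega -> 'rV[R]_m) : measurable_fun setT Z ->
    (\int[P]_w (h (Z w))%:E = (\int[P]_w h (Z w))%:E)%E.
  by move=> mZ; rewrite integral_EFin_Rintegral//; exact: ih.
have M0 : 0 <= M by apply: le_trans (hM 0).
under eq_fun do rewrite iE//.
under [X in _ -> X @ _ --> _]eq_fun do rewrite iE//.
move=> /fine_cvgP[_ /= c]; apply: cvg_EFin; first exact: nearW.
apply/cvgrPdist_le => e e0.
have e4 : 0 < e / 4 by rewrite divr_gt0.
(* Two events of probability eta contribute at most 4 M eta <= e / 2; adding 1 to M keeps the
   denominator positive. *)
pose eta := e / (8 * (M + 1)); have eta0 : 0 < eta by rewrite divr_gt0// mulr_gt0// ltr_wpDl.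
have [B [k1 hB]] := tightY' eta0.
have [de de0 hde] := uniform_continuity_bounded B ch e4.
have [k2 hk2] := YY' de0 eta0.
have close : \forall k \near \oo, `|\int[P]_w h (Y k w) - \int[P]_w h (Y' k w)| <= e / 2 + e / 4.
  exists (maxn k1 k2) => // k /=; rewrite geq_max => /andP[/hB b1 /hk2 b2].
  have [A [mA PA hA]] := whp_and b1 b2.
  have id : P.-integrable setT (EFin \o (fun w => h (Y k w) - h (Y' k w))).
    have := integrableB measurableT (ih _ (mY k)) (ih _ (mY' k)).
    by congr (integrable _ _ _).
  rewrite -(@RintegralB _ _ _ P setT (fun w => h (Y k w)) (fun w => h (Y' k w)))//; try exact: ih.
  apply: (le_trans (le_normr_Rintegral measurableT id)).
  have iA : P.-integrable setT (EFin \o (fun w => e / 4 + 2 * M * \1_A w)).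
    apply: (@bounded_integrable _ _ _ P _ (e / 4 + 2 * M)).
      by apply: measurable_funD => //; apply: measurable_funM => //; exact: measurable_indic.
    move=> w; rewrite indicE; case: (w \in A) => /=.
      by rewrite mulr1 ger0_norm// addr_ge0 ?mulr_ge0// ltW.
    by rewrite mulr0 addr0 ger0_norm ?(ltW e4)// lerDl mulr_ge0.
  have i1 : P.-integrable setT (EFin \o \1_A).
    apply: (@bounded_integrable _ _ _ P \1_A 1); first exact: measurable_indic.
    by move=> w; rewrite indicE; case: (w \in A); rewrite /= ?normr1 ?normr0.
  have i2 : P.-integrable setT (EFin \o (fun w => 2 * M * \1_A w)).
    have := integrableZl measurableT (2 * M) i1.
    by congr (integrable _ _ _).
  have i3 : P.-integrable setT (EFin \o cst (e / 4)).
    by apply: (@bounded_integrable _ _ _ P _ `|e / 4|).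
  apply: (@le_trans _ _ (\int[P]_w (e / 4 + 2 * M * \1_A w))).
    apply: le_Rintegral => //.
      by have := integrable_norm id; congr (integrable _ _ _).
    move=> w _; rewrite indicE; have [wA|/negP wA] := boolP (w \in A).
      rewrite mulr1; have := hM (Y k w); have := hM (Y' k w).
      by rewrite !ler_norml => /andP[? ?] /andP[? ?]; apply/andP; split; lra.
    have [yB yd] := hA w (fun wA' => wA (mem_set wA')).
    rewrite mulr0 addr0 distrC; apply: hde => //.
    by rewrite enorm_distC.
  rewrite (@RintegralD _ _ _ P setT (cst (e / 4)) (fun w => 2 * M * \1_A w))//.
  rewrite RintegralZl// Rintegral_cst//.
  rewrite (_ : fine _ = 1); last exact: (congr1 fine (probability_setT P)).
  have : \int[P]_w \1_A w <= eta + eta.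
    by rewrite /Rintegral integral_indic// setIT -lee_fin fineK// fin_num_measure.
  move=> /(ler_wpM2l (mulr_ge0 (ler0n R 2) M0)).
  have : M * eta <= e / 8.
    rewrite /eta mulrA ler_pdivrMr; first nra.
    by rewrite mulr_gt0// ltr_wpDl.
  lra.
move/cvgrPdist_le/(_ _ e4): c => c.
near=> k.
have h1 : `|l - \int[P]_w h (Y' k w)| <= e / 4 by near: k.
have h2 : `|\int[P]_w h (Y k w) - \int[P]_w h (Y' k w)| <= e / 2 + e / 4 by near: k.
move: h1 h2; rewrite /= !ler_norml => /andP[? ?] /andP[? ?]; apply/andP; split; lra.
Unshelve. all: by end_near. Qed.

End slutsky.

(** * From chords to logarithms *)

Section minimizer_log.
Context d (Omega : measurableType d) (R : realType) (P : probability Omega R).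
Context (n : nat).
Variables (mu : probability (sphere R n) R) (p : sphere R n).
Variables (X : nat -> {RV P >-> sphere R n}).
Hypothesis hX : iid X mu.
Local Notation chord x := (enorm (vec x - vec p)).
Local Notation D x := (\int[mu]_q dev p x q).
Variables (C2 c0 a : R).
Hypotheses (C20 : 0 < C2) (c00 : 0 < c0) (a0 : 0 < a).
Hypothesis HC2 : forall x, \int[mu]_q (dev p x q ^+ 2) <= C2 * chord x ^+ 3.
Hypothesis Hc0 : forall x, c0 * chord x ^+ 2 <= D x.
Hypothesis Hlog : forall v, \int[mu]_q dotp v (sphere_log p q) = 0.
Hypothesis Hloc : forall e, 0 < e -> exists2 delta, 0 < delta &
  forall x, chord x <= delta -> `|D x - a / 2 * chord x ^+ 2| <= e * chord x ^+ 2.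

(** The logarithm differs from the chord vector by O(|x - p|^2), which after multiplication by sqrt
    k is O(B^2 / sqrt k) by tightness. *)
Lemma minimizer_log_expansion (eps eta : R) : 0 < eps -> 0 < eta ->
  exists k0, forall k, (k0 <= k)%N -> whp P eta (fun w => forall x,
    frechet_mean_set (empirical X k w) x ->
    enorm (Num.sqrt k%:R *: sphere_log p x - a^-1 *: (Num.sqrt k%:R *: emean p X k w)) <= eps).
Proof.
move=> eps0 eta0; have eta2 : 0 < eta / 2 by rewrite divr_gt0.
have eps2 : 0 < eps / 2 by rewrite divr_gt0.
have [k1 h1] := minimizer_expansion hX C20 HC2 c00 Hc0 Hlog a0 Hloc eps2 eta2.
have [B B0 [k2 h2]] := minimizer_tight hX C20 HC2 c00 Hc0 Hlog eta2.
have [k3 h3] := sqrt_nat_large (24 * B ^+ 2 / (eps / 2)).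
exists (maxn k1 (maxn k2 k3)) => k; rewrite !geq_max => /and3P[/h1 w1 /h2 w2 /h3[k0 kB]].
apply: (whp_le _ (whp_imp _ (whp_and w1 w2))); first lra.
move=> w [hx [_ hB]] x xm.
move: (hx x xm) (hB x xm) kB; set r := Num.sqrt k%:R => h4 h5 kB.
have r0 : 0 < r by rewrite sqrtr_gt0 ltr0n.
have := enormD (r *: (sphere_log p x - (vec x - vec p)))
  (r *: (vec x - vec p) - a^-1 *: (r *: emean p X k w)).
rewrite addrA -scalerDr subrK (enormZ r) (gtr0_norm r0).
have h6 : r * enorm (sphere_log p x - (vec x - vec p)) <= eps / 2.
  rewrite -(ler_pM2l r0).
  apply: (@le_trans _ _ (24 * (r * chord x) ^+ 2)).
    have := ler_wpM2l (sqr_ge0 r) (sphere_log_chord p x); rewrite exprMn; lra.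
  apply: (@le_trans _ _ (24 * B ^+ 2)).
    have c0' : 0 <= r * chord x by rewrite mulr_ge0 ?enorm_ge0// ltW.
    by rewrite ler_pM2l// ler_sqr ?nnegrE// ltW.
  by move: kB; rewrite ler_pdivrMr.
lra.
Qed.

End minimizer_log.

(** * The limit theorem *)

Theorem theorem2p9 (R : realType) (d : nat) (hd : (2 <= d)%N)
    (mu : probability (sphere R d) R) (mubar : sphere R d)
    (hmean : frechet_mean_set mu = [set mubar])
    (f : R -> R)
    (hfm : measurable_fun `[0, pi] f)
    (hf0 : forall t, 0 <= t <= pi -> 0 <= f t)
    (hmu : forall A : set (sphere R d), measurable A ->
       mu A = (\int[@volume R d]_(q in A) (f (sdist mubar q))%:E)%E)
    (hbounded : exists (U : set (sphere R d)) (M : R),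
       [/\ open U, cut_locus mubar `<=` U &
           forall q, U q -> f (sdist mubar q) <= M])
    (halpha : 0 < alpha d f)
    (dO : measure_display) (Omega : measurableType dO)
    (P : probability Omega R)
    (X : nat -> {RV P >-> sphere R d})
    (hX : iid X mu)
    (mubarn : nat -> {RV P >-> sphere R d})
    (hmubarn : forall (n : nat) (w : Omega), (0 < n)%N ->
       frechet_mean_set (empirical X n w) (mubarn n w))
    (N : probability 'rV[R]_d.+1 R)
    (hN : tangent_limit_distribution P mubar X N) :
  cvg_in_distribution P
    (fun n w => Num.sqrt n%:R *: sphere_log mubar (mubarn n w))
    (pushforward N (correction (alpha d f))).
Proof.
case: d hd mu mubar hmean hmu hbounded halpha X hX mubarn hmubarn N hN
  => [|[|m]]// _ mu p hmean hmu hbounded halpha X hX xn hxn N hN.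
set a := alpha m.+2 f.
have [c0 c00 Hc0] := popdev_ge hmean hfm hf0 hmu hbounded halpha.
have [C2 C20 HC2] := Rintegral_sqr_dev hfm hf0 hmu hbounded.
have Hloc := popdev_chord_cvg hfm hf0 hmu hbounded halpha.
have Hlog := Rintegral_dotp_sphere_log hfm hf0 hmu.
move=> g cg [M gM].
have ca : continuous (fun z : 'rV[R]_m.+3 => a^-1 *: z) by exact: scaler_continuous.
(* The limit defining N is tested on g composed with the correction map, which is how the
   pushforward appears. *)
have cga : continuous (fun z : 'rV[R]_m.+3 => g (a^-1 *: z)).
  by move=> z; apply: (continuous_comp (ca z)); exact: cg.
have [_ _ /(_ _ cga) hlim] := hN.
have mlog : measurable_fun setT (sphere_log p) := measurable_sphere_log p.
pose Y k w := Num.sqrt k%:R *: sphere_log p (xn k w).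
pose Y' k w := a^-1 *: (Num.sqrt k%:R *: emean p X k w).
have mcoord k : forall j, measurable_fun setT (fun w => sphere_log p (X k w) 0 j).
  move=> j; exact: (measurableT_comp (measurableT_comp (measurable_coord j) mlog) (measurable_funPT (X k))).
have mY k : measurable_fun setT (Y k).
  apply: measurable_fun_row => j; rewrite /Y.
  under eq_fun do rewrite mxE.
  apply: measurable_funM => //.
  exact: (measurableT_comp (measurableT_comp (measurable_coord j) mlog) (measurable_funPT (xn k))).
have mY' k : measurable_fun setT (Y' k).
  apply: measurable_fun_row => j; rewrite /Y' /emean.
  under eq_fun do rewrite !mxE summxE.
  by do 3 (apply: measurable_funM => //); apply: measurable_sum => i.
have YY' eps eta : 0 < eps -> 0 < eta -> exists k0, forall k,
    (k0 <= k)%N -> whp P eta (fun w => enorm (Y k w - Y' k w) <= eps).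
  move=> eps0 eta0.
  have [k0 h] := minimizer_log_expansion hX C20 c00 halpha HC2 Hc0 Hlog Hloc eps0 eta0.
  (* The extra unit keeps the sample size positive, as [hxn] speaks of nonempty samples. *)
  exists k0.+1 => k kk; apply: whp_imp (h k (ltnW kk)) => w; apply.
  by apply: hxn; exact: leq_ltn_trans kk.
have tight eta : 0 < eta -> exists B, exists k0, forall k,
    (k0 <= k)%N -> whp P eta (fun w => enorm (Y' k w) <= B).
  move=> eta0; have [B B0 [k0 h]] := minimizer_tight hX C20 HC2 c00 Hc0 Hlog eta0.
  exists (a^-1 * B), k0 => k /h; apply: whp_imp => w [hw _].
  by rewrite /Y' enormZ ger0_norm ?invr_ge0 ?(ltW halpha)// ler_pM2l// invr_gt0.
have mc : measurable_fun setT (correction a : 'rV[R]_m.+3 -> _).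
  apply: measurable_fun_row => j; under eq_fun do rewrite mxE.
  by apply: measurable_funM => //; exact: measurable_coord.
have ig : N.-integrable setT (EFin \o (fun z : 'rV[R]_m.+3 => g (a^-1 *: z))).
  apply: (@bounded_integrable _ _ _ N _ M) => //.
  exact: (continuous_measurable_row cg mc).
have -> : (\int[pushforward N (correction a)]_v (g v)%:E =
    (\int[N]_z g (a^-1 *: z))%:E)%E.
  rewrite -integral_EFin_Rintegral//.
  have mg : measurable_fun setT (EFin \o g).
    apply/measurable_EFinP.
    exact: (continuous_measurable_row cg (@measurable_id _ 'rV[R]_m.+3 setT)).
  have := @integral_pushforward _ _ _ _ R _ mc N setT _ mg ig measurableT.
  by rewrite preimage_setT.
apply: (slutsky mY mY' YY' tight cg gM).
rewrite -integral_EFin_Rintegral//.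
apply: hlim; exists M => v; exact: gM.
Qed.
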